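(* Let $X\subset\mathbb{P}^n$ be a nondegenerate irreducible variety with $2(\dim X+1)\le n+1$, whose homogeneous ideal in $R=\mathbb{K}[x_0,\ldots,x_n]$ is $I(X)=(\mathbf{f})$, i.e. generated by the entries of a tuple $\mathbf{f}=(f_0,\ldots,f_m)$ of elements of $R$. Then \[\dim\mathrm{Ter}_2(X)=\dim T_{J_{\mathbf{f}}^T,(\mathbf{f})}-2,\] where $\dim T_{J_{\mathbf{f}}^T,(\mathbf{f})}$ is the Krull dimension of the ideal $T_{J_{\mathbf f}^T,(\mathbf f)}$ of $Q=\mathbb{K}[z_{00},\ldots,z_{1n}]$ defined in the context.
   Context: The field $\mathbb{K}$ is algebraically closed of characteristic $0$. ''Nondegenerate'' means that $X$ spans $\mathbb{P}^n$. The Krull dimension of an ideal $T\subset Q$ means that of $Q/T$. Terracini locus: for a nondegenerate irreducible variety $X\subset\mathbb{P}^n$ with set of smooth points $X_{sm}$ and embedded tangent spaces $T_pX$, \[\mathrm{Ter}_r(X)=\overline{\{\{p_1,\ldots,p_r\}\in X_{sm}^{(r)}\mid \dim\langle T_{p_1}X,\ldots,T_{p_r}X\rangle<r(\dim X+1)-1\}},\] where $X_{sm}^{(r)}$ is the variety of unordered sets of $r$ distinct points of $X_{sm}$, $\langle\cdot\rangle$ denotes linear span, and the closure is taken in $X_{sm}^{(r)}$. Construction of the ideal (here with $r=2$): $J_{\mathbf{f}}$ is the $(n+1)\times(m+1)$ Jacobian matrix with $(J_{\mathbf f})_{ij}=\partial f_j/\partial x_i$. $Q=\mathbb{K}[z_{ij}\mid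 0\le i\le r-1,\ 0\le j\le n]$ is the homogeneous coordinate ring of $(\mathbb{P}^n)^r$ with its standard $\mathbb{Z}^r$-grading. For an $s\times t$ matrix $A$ with entries in $R$, $A(z_{i\bullet})$ is the matrix obtained by substituting $z_{ij}$ for $x_j$ in $A$, and $A(z_{\bullet\bullet})$ is the $rs\times t$ matrix obtained by concatenating the rows of $A(z_{0\bullet}),\ldots,A(z_{(r-1)\bullet})$. For $0\le i<j\le r-1$, $Z_{ij}=\begin{pmatrix} z_{i0}&\ldots&z_{in}\\ z_{j0}&\ldots&z_{jn}\end{pmatrix}$. $\Sigma_k(B)$ is the ideal of $Q$ generated by the $k\times k$ minors of a matrix $B$ with entries in $Q$. For an ideal $I\subset R$, let $\ell=\operatorname{rank}A$ if $I=(0)$ and $\ell=\operatorname{codim}I$ otherwise; $I(z_{i\bullet})$ is the ideal of $Q$ generated by the generators of $I$ with $z_{ij}$ substituted for $x_j$, and $I(z_{\bullet\bullet})=\sum_i I(z_{i\bullet})$. Then \[T_{A,I}=\sqrt{\left(\left(\Sigma_{\min\{r\ell,t\}}(A(z_{\bullet\bullet}))+I(z_{\bullet\bullet})\right):\Big(\bigcap_{i<j}\Sigma_2(Z_{ij})\Big)^\infty\right):\Big(\bigcap_i\Sigma_\ell(A(z_{i\bullet}))\Big)^\infty}.\] Here it is used with $r=2$, $A=J_{\mathbf f}^T$ (so $t=n+1$) and $I=(\mathbf f)$ (so $\ell=\operatorname{codim}X$). *)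

(* Defs.v *)
From HB Require Import structures.
Set Warnings "-notation-overridden,-ambiguous-paths,-notation-incompatible-prefix".
Set Warnings "-redundant-canonical-projection,-projection-no-head-constant".
From mathcomp Require Import all_boot all_order all_algebra finmap mpoly.
From mathcomp Require Import boolp classical_sets constructive_ereal.

Set Implicit Arguments.
Unset Strict Implicit.
Unset Printing Implicit Defensive.

Import Order.TTheory GRing.Theory Num.Theory.
Local Open Scope classical_set_scope.
Local Open Scope ring_scope.

(* Dimensions live in \bar int, so that the empty space and the zero ring have *)
(* dimension -oo: supremum of the lengths k of the chains c 0 < ... < c k.     *)
Definition chain_dim (T : Type) (C : set (set T)) : \bar int :=
  supremum -oo%E [set (k%:Z)%:E | k in
    [set k : nat | exists c : nat -> set T,
       (forall i, (i <= k)%N -> C (c i)) /\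
       (forall i, (i < k)%N -> c i `<` c i.+1)]].

Section Ideals.
Variable R : comNzRingType.
Implicit Types (S I J : set R).

Definition ideal_gen S : set R :=
  [set q | exists (k : nat) (a x : 'I_k -> R),
     (forall i, S (x i)) /\ q = \sum_(i < k) a i * x i].

Definition prime_ideal I : Prop :=
  idealr_closed (mem I) /\ prime_idealr_closed (mem I).

(* The primes of R / I, seen in R. *)
Definition krull_dim I : \bar int :=
  chain_dim [set P | prime_ideal P /\ I `<=` P].

(* dim R - dim R/I, as a natural number *)
Definition ideal_codim I : nat :=
  `|fine (krull_dim [set 0%R] - krull_dim I)%E|%N.

Definition ideal_sum I J : set R := ideal_gen (I `|` J).

Definition ideal_pow J k : set R :=
  ideal_gen [set \prod_(i < k) a i | a in
    [set a : 'I_k -> R | forall i, J (a i)]].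

Definition ideal_colon I J : set R := [set q | forall b, J b -> I (q * b)].

Definition saturation I J : set R := \bigcup_k ideal_colon I (ideal_pow J k).

Definition ideal_radical I : set R := [set q | exists k : nat, I (q ^+ k)].

(* Reordering the chosen rows or columns only changes the sign of a minor. *)
Definition minors_ideal (s t k : nat) (B : 'M[R]_(s, t)) : set R :=
  ideal_gen [set d | exists (f : 'I_k -> 'I_s) (g : 'I_k -> 'I_t),
     [/\ injective f, injective g & d = \det (mxsub f g B)]].

End Ideals.

Section Topology.
Variables (T : Type) (closed : set (set T)).

Definition irreducible (Z : set T) : Prop :=
  Z !=set0 /\ forall A B, closed A -> closed B ->
    Z `<=` A `|` B -> Z `<=` A \/ Z `<=` B.

(* Krull dimension of Y with the subspace topology *)
Definition top_dim (Y : set T) : \bar int :=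
  chain_dim [set Z | irreducible Z /\ exists2 C, closed C & Z = Y `&` C].

Definition top_closure (A : set T) : set T :=
  \bigcap_(C in [set C | closed C /\ A `<=` C]) C.

End Topology.

Record proj (K : fieldType) (n : nat) : Type := ProjPoint {
  proj_line :> {vspace 'rV[K]_n.+1};
  _ : \dim proj_line == 1%N
}.
HB.instance Definition _ (K : fieldType) (n : nat) :=
  [isSub for @proj_line K n].
HB.instance Definition _ (K : fieldType) (n : nat) :=
  [Choice of proj K n by <:].

Section Projective.
Variables (K : fieldType) (n : nat).
Local Notation V := 'rV[K]_n.+1.
Local Notation P := (proj K n).
Local Notation R := {mpoly K[n.+1]}.
Implicit Types (X : set P) (p : P) (g : R).

Definition represents (u : V) p : Prop := u \in (p : {vspace V}) /\ u != 0.

Definition vanishes_at g p : Prop :=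
  forall u, represents u p -> g.@[u 0] = 0.

Definition homogeneous g : Prop := exists d : nat, g \is d.-homog.

Definition zariski_closed : set (set P) :=
  [set Z | exists2 F : set R, F `<=` homogeneous &
     Z = [set p | forall g, F g -> vanishes_at g p]].

Definition proj_variety X : Prop :=
  zariski_closed X /\ irreducible zariski_closed X.

Definition dim_variety X : \bar int := top_dim zariski_closed X.

Definition nondegenerate_variety X : Prop :=
  forall W : {vspace V}, (forall p, X p -> (p <= W)%VS) -> W = fullv.

Definition homog_ideal X : set R :=
  ideal_gen [set g | homogeneous g /\ forall p, X p -> vanishes_at g p].

Definition tangent_vector X p (v : V) : Prop :=
  forall g u, homog_ideal X g -> represents u p ->
    \sum_(j < n.+1) (g^`M(j)).@[u 0] * v 0 j = 0.

Lemma tangent_space_ex X p :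
  exists W : {vspace V}, forall v, v \in W <-> tangent_vector X p v.
Proof.
have tD a v w : tangent_vector X p v -> tangent_vector X p w ->
    tangent_vector X p (a *: v + w).
  move=> tv tw g u Ig ru.
  under eq_bigr => j _ do rewrite !mxE mulrDr mulrCA.
  by rewrite big_split -mulr_sumr /= tv // tw // mulr0 addr0.
have t0 : tangent_vector X p 0.
  by move=> g u _ _; rewrite big1 // => j _; rewrite mxE mulr0.
pose sub (W : {vspace V}) := forall v, v \in W -> tangent_vector X p v.
pose Q k := `[< exists2 W, sub W & \dim W = k >].
have Q0 : exists k, Q k.
  exists 0%N; apply/asboolP; exists 0%VS; last exact: dimv0.
  by move=> v /[!memv0] /eqP ->.
have Qle k : Q k -> (k <= \dim (@fullv K V))%N.
  by case/asboolP => W _ <-; exact/dimvS/subvf.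
case: (ex_maxnP Q0 Qle) => k /asboolP[W sW dW] kmax.
exists W => v; split; first exact: sW.
move=> tv; suff /eqP -> : W == (W + <[v]>)%VS.
  by rewrite memvE addvSr.
rewrite eqEdim addvSl dW kmax //; apply/asboolP.
exists (W + <[v]>)%VS => // w /memv_addP[w1 w1W [w2 /vlineP[a ->] ->]].
by rewrite addrC; apply: tD => //; exact: sW.
Qed.

(* The linear subspace of K^(n+1) whose projectivization is T_p X. *)
Definition tangent_space X p : {vspace V} := sval (cid (tangent_space_ex X p)).

Definition proj_dim (W : {vspace V}) : \bar int := ((\dim W)%:Z - 1)%:E.

Definition smooth_points X : set P :=
  [set p | X p /\ proj_dim (tangent_space X p) = dim_variety X].

End Projective.

Section MultiProjective.
Variables (K : fieldType) (r n : nat).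
Local Notation Q := {mpoly K[r * n.+1]}.
Local Notation P := (proj K n).

(* z_ij; the variables of Q are indexed by the entries of an r x (n+1) matrix *)
Definition zvar (i : 'I_r) (j : 'I_n.+1) : Q := 'X_(mxvec_index i j).

Definition multihomogeneous (g : Q) : Prop :=
  exists d : 'I_r -> nat, forall m, m \in msupp g ->
    forall i, (\sum_(j < n.+1) m (mxvec_index i j))%N = d i.

Definition multi_vanishes_at (g : Q) (p : 'I_r -> P) : Prop :=
  forall M : 'M[K]_(r, n.+1), (forall i, represents (row i M) (p i)) ->
    g.@[mxvec M 0] = 0.

Definition multi_zariski_closed : set (set ('I_r -> P)) :=
  [set Z | exists2 F : set Q, F `<=` multihomogeneous &
     Z = [set p | forall g, F g -> multi_vanishes_at g p]].

Definition sym_points (Y : set P) : set {fset P} :=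
  [set S | #|` S|%fset = r /\ forall p, p \in S -> Y p].

(* Quotient topology: C is closed iff the set of its orderings is closed in    *)
(* the space of r-tuples of distinct points of Y.                              *)
Definition sym_closed (Y : set P) : set (set {fset P}) :=
  [set C | C `<=` sym_points Y /\
     exists2 F, multi_zariski_closed F &
       forall p : 'I_r -> P, injective p -> (forall i, Y (p i)) ->
         C [fset p i | i in 'I_r]%fset <-> F p].

Definition terracini_locus (X : set P) : set {fset P} :=
  top_closure (sym_closed (smooth_points X))
    [set S | sym_points (smooth_points X) S /\
       (proj_dim (\sum_(p <- S) tangent_space X p)%VS
          < (r%:Z)%:E * (dim_variety X + 1) - 1)%E].

Definition dim_terracini_locus (X : set P) : \bar int :=
  top_dim (sym_closed (smooth_points X)) (terracini_locus X).

Definition subst_z (i : 'I_r) (g : {mpoly K[n.+1]}) : Q :=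
  g \mPo [tuple zvar i j | j < n.+1].

Definition mx_z (s t : nat) (A : 'M[{mpoly K[n.+1]}]_(s, t)) (i : 'I_r) :
  'M[Q]_(s, t) := map_mx (subst_z i) A.

Definition mx_zz (s t : nat) (A : 'M[{mpoly K[n.+1]}]_(s, t)) :=
  \mxcol_(i < r) mx_z A i.

Definition Zmx (i j : 'I_r) : 'M[Q]_(1 + 1, n.+1) :=
  col_mx (\row_c zvar i c) (\row_c zvar j c).

(* I(z_..), for the ideal I generated by G *)
Definition ideal_zz (G : set {mpoly K[n.+1]}) : set Q :=
  ideal_gen (\bigcup_i ideal_gen (subst_z i @` G)).

Definition ell (s t : nat) (A : 'M[{mpoly K[n.+1]}]_(s, t))
    (I : set {mpoly K[n.+1]}) : nat :=
  if `[< I = [set 0] >] then \rank (map_mx (@tofrac _) A) else ideal_codim I.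

(* T_{A,I}, for the ideal I generated by G *)
Definition terracini_ideal (s t : nat) (A : 'M[{mpoly K[n.+1]}]_(s, t))
    (G : set {mpoly K[n.+1]}) : set Q :=
  let l := ell A (ideal_gen G) in
  ideal_radical
    (saturation
       (saturation
          (ideal_sum (minors_ideal (minn (r * l) t) (mx_zz A)) (ideal_zz G))
          (\bigcap_(ij in [set ij : 'I_r * 'I_r | (ij.1 < ij.2)%N])
             minors_ideal 2 (Zmx ij.1 ij.2)))
       (\bigcap_i minors_ideal l (mx_z A i))).

End MultiProjective.
Arguments terracini_ideal {K} r {n s t} A G.

Definition jacobian (K : fieldType) (n m : nat)
    (f : m.+1.-tuple {mpoly K[n.+1]}) : 'M[{mpoly K[n.+1]}]_(n.+1, m.+1) :=
  \matrix_(i, j) (tnth f j)^`M(i).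

(* Main.v *)
(* A prime of a polynomial ring over K is the kernel of evaluation at a point x
   with coordinates in an extension L of K, and Krull dimensions are computed as
   transcendence degrees of such points. In characteristic 0, the K-derivations
   K[x] -> L vanishing on a transcendence basis vanish, which gives the exchange
   property and bounds the rank of the Jacobian matrix of P at x by N - trdeg.
   Specializing the last element of a transcendence basis to a constant yields
   chains of primes avoiding a given polynomial, and the Nullstellensatz.

   Closed subsets of a quotient of multiprojective points correspond to primes of
   the multigraded coordinate ring, up to the symmetry exchanging the factors:
   such a subset lifts to a prime through the point t.x, for t generic in the
   r-dimensional torus. Setting one coordinate of each factor to 1 goes back, at the
   cost of r dimensions. With r = 1 this computes dim X, and with r = 2 the
   dimension of the Terracini locus.

   Let l = n - dim X. At a point of X the Jacobian matrix has rank at most l, with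
   equality exactly at the smooth points, where its left kernel is the tangent
   space. Since 2 (dim X + 1) <= n + 1, the tangent spaces at two smooth points
   span less than expected iff they have a common nonzero vector, i.e. iff the
   minors of size n + 1 of the concatenated matrix vanish. The defining condition
   of the Terracini locus is therefore already closed, and a prime over T contains
   a prime which contains these minors, f(z_0) and f(z_1), but neither the ideal
   of the diagonal nor that of the pairs with a singular point. *)

From HB Require Import structures.
Require Import Defs.
Set Warnings "-notation-overridden,-ambiguous-paths,-notation-incompatible-prefix".
Set Warnings "-redundant-canonical-projection,-projection-no-head-constant".
Set Warnings "-deprecated-since-mathcomp-2.4.0,-deprecated".
From mathcomp Require Import all_boot all_order all_algebra finmap mpoly.
From mathcomp Require Import boolp classical_sets constructive_ereal ring.

Set Implicit Arguments.
Unset Strict Implicit.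
Unset Printing Implicit Defensive.

Import Order.TTheory GRing.Theory Num.Theory.
Local Open Scope classical_set_scope.
Local Open Scope ring_scope.

(** * Dual numbers and extension of derivations *)

(** Both dimensions are suprema of lengths of chains, so the equality is obtained by transporting
    chains in both directions with a shift of exactly 2, and irreducible components never have to be
    formed. Two obstacles shape the argument. An irreducible set of unordered pairs may pull back to
    two components exchanged by the swap, so its ideal need not be prime: Zorn's lemma selects one
    component, and along a chain the selections must be made compatible. Moreover, the primes that
    occur are studied through generic points, so the conditions defining the locus are stated for
    points over any extension of K and shown invariant under rescaling each block. This invariance
    has to come from the ideal of X, because the polynomials f_j themselves may be inhomogeneous.
    Chains of primes are built so as to avoid a fixed polynomial; by the Nullstellensatz each prime
    of the chain then still has K-points that are pairs of distinct smooth points. *)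

Definition dualnum (L : comNzRingType) : Type := (L * L)%type.
HB.instance Definition _ (L : comNzRingType) :=
  GRing.Zmodule.copy (dualnum L) (L * L)%type.

Section DualNumbers.
Variable L : comNzRingType.
Implicit Types u v w : dualnum L.

Definition dn (a b : L) : dualnum L := (a, b).
Definition dn1 : dualnum L := (1, 0).
(** The pair (a, b) stands for a + b eps with eps^2 = 0. The alias [dualnum] keeps the componentwise
    product of pairs from being inferred. *)
Definition dnM u v : dualnum L := (u.1 * v.1, u.1 * v.2 + u.2 * v.1).

Fact dnMA : associative dnM.
Proof.
move=> u v w; rewrite /dnM /=; congr (_, _); first exact: mulrA.
by rewrite mulrDr mulrDl !mulrA addrA.
Qed.
Fact dnMC : commutative dnM.
Proof.
by move=> u v; rewrite /dnM /= mulrC addrC (mulrC u.2) (mulrC u.1 v.2).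
Qed.
Fact dn1M : left_id dn1 dnM.
Proof. by case=> a b; rewrite /dnM /= !mul1r mul0r addr0. Qed.
Fact dnMD : left_distributive dnM +%R.
Proof.
move=> [a b] [c d] [e f]; rewrite /dnM; congr (_, _) => /=; rewrite ?mulrDl //.
by rewrite addrACA.
Qed.
Fact dn1_neq0 : dn1 != 0.
Proof. by rewrite xpair_eqE oner_eq0. Qed.

HB.instance Definition _ :=
  GRing.Zmodule_isComNzRing.Build (dualnum L) dnMA dnMC dn1M dnMD dn1_neq0.

Definition dnfst u : L := u.1.
Fact dnfst_is_zmod_morphism : zmod_morphism dnfst. Proof. by []. Qed.
Fact dnfst_is_monoid_morphism : monoid_morphism dnfst. Proof. by []. Qed.
HB.instance Definition _ :=
  GRing.isZmodMorphism.Build (dualnum L) L dnfst dnfst_is_zmod_morphism.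
HB.instance Definition _ :=
  GRing.isMonoidMorphism.Build (dualnum L) L dnfst dnfst_is_monoid_morphism.

Definition dnsnd u : L := u.2.
Fact dnsnd_is_zmod_morphism : zmod_morphism dnsnd. Proof. by []. Qed.
HB.instance Definition _ :=
  GRing.isZmodMorphism.Build (dualnum L) L dnsnd dnsnd_is_zmod_morphism.

Arguments dnfst : simpl never.
Arguments dnsnd : simpl never.

Definition dninj (a : L) : dualnum L := (a, 0).
Fact dninj_is_zmod_morphism : zmod_morphism dninj.
Proof. by move=> a b; congr (_, _); rewrite /= subr0. Qed.
Fact dninj_is_monoid_morphism : monoid_morphism dninj.
Proof.
by split=> // a b; rewrite /dninj; congr (_, _); rewrite /= mulr0 mul0r addr0.
Qed.
HB.instance Definition _ :=
  GRing.isZmodMorphism.Build L (dualnum L) dninj dninj_is_zmod_morphism.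
HB.instance Definition _ :=
  GRing.isMonoidMorphism.Build L (dualnum L) dninj dninj_is_monoid_morphism.

Lemma dnE u v : u = v <-> dnfst u = dnfst v /\ dnsnd u = dnsnd v.
Proof.
by case: u v => [a b] [c d]; split=> [[-> ->]|[/= ac bd]]; last congr (_, _).
Qed.

Lemma dnsndD u v : dnsnd (u + v) = dnsnd u + dnsnd v. Proof. by []. Qed.
Lemma dnfstM u v : dnfst (u * v) = dnfst u * dnfst v. Proof. by []. Qed.
Lemma dnsndM u v : dnsnd (u * v) = dnfst u * dnsnd v + dnsnd u * dnfst v.
Proof. by []. Qed.

(** First order Taylor expansion at a + c eps; the coefficients contribute their own eps part. *)
Lemma horner_dual (P : {poly dualnum L}) a c :
  P.[dn a c] = dn (map_poly dnfst P).[a]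
                  ((map_poly dnsnd P).[a] + c * (map_poly dnfst P)^`().[a]).
Proof.
elim/poly_ind: P => [|P b IHP].
  by rewrite !horner0 !map_poly0 deriv0 !horner0 mulr0 addr0.
rewrite !hornerE IHP.
have E2 : map_poly dnsnd (P * 'X + b%:P) = map_poly dnsnd P * 'X + (dnsnd b)%:P.
  rewrite raddfD /= map_polyC /=; congr (_ + _).
  apply/polyP => i; rewrite coef_map_id0 ?raddf0 // !coefMX.
  by case: i => [|i] //=; rewrite ?raddf0 // coef_map_id0 ?raddf0.
rewrite E2 rmorphD rmorphM /= map_polyX map_polyC derivD derivM derivX derivC.
apply/dnE; rewrite !hornerE /=; split.
  by rewrite /dnfst /=.
rewrite dnsndD dnsndM /dnfst /dnsnd /=; ring.
Qed.

End DualNumbers.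
Arguments dnfst {L} u : simpl never.
Arguments dnsnd {L} u : simpl never.
Arguments dninj {L} a : simpl never.

(** The eps part is a function of the first part: [th] is the graph of a derivation into L from the
    image of R in L. *)
Definition functional (R : comNzRingType) (L : fieldType)
    (th : R -> dualnum L) := forall r, dnfst (th r) = 0 -> th r = 0.

Section ExtendOne.
Variables (R : comNzRingType) (L : fieldType).
Hypothesis charL : [pchar L] =i pred0.
Variable th : {rmorphism R -> dualnum L}.
Hypothesis th_fun : functional th.
Variable a : L.

Let th1 : {rmorphism R -> L} := dnfst \o th.

Lemma map_poly_th1 P : map_poly dnfst (map_poly th P) = map_poly th1 P.
Proof. by rewrite -map_poly_comp. Qed.

(** A derivation extends to the ring with [a] adjoined. If [a] is transcendental over the image, any
    value at [a] will do; otherwise a polynomial of least degree killing [a] dictates the value. *)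
Lemma functional_extend_one :
  exists c : L, functional (fun P : {poly R} => (map_poly th P).[dn a c]).
Proof.
have fstE c P : dnfst (map_poly th P).[dn a c] = (map_poly th1 P).[a].
  by rewrite horner_dual map_poly_th1.
have zeroE P : map_poly th1 P = 0 -> map_poly th P = 0.
  move=> P0; apply/polyP => i; rewrite coef0 coef_map; apply: th_fun.
  by have /polyP/(_ i) := P0; rewrite coef0 coef_map.
have [ex|nex] := pselect (exists P : {poly R},
    map_poly th1 P != 0 /\ (map_poly th1 P).[a] = 0); last first.
  exists 0 => P; rewrite fstE => P0.
  have [/zeroE ->|nz] := eqVneq (map_poly th1 P) 0; first by rewrite horner0.
  by case: nex; exists P.
pose pr k := `[< exists P : {poly R}, [/\ map_poly th1 P != 0,
    (map_poly th1 P).[a] = 0 & size (map_poly th1 P) = k] >].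
have expr : exists k, pr k.
  by case: ex => P [nz P0]; exists (size (map_poly th1 P)); apply/asboolP; exists P.
case: (ex_minnP expr) => k /asboolP[G [G_nz G0 Gsz]] kmin.
have minG P : (map_poly th1 P).[a] = 0 -> (size (map_poly th1 P) < k)%N ->
    map_poly th1 P = 0.
  move=> P0 lt; have [//|nz] := eqVneq (map_poly th1 P) 0.
  by have := kmin _ (asboolT (ex_intro _ P (And3 nz P0 erefl))); rewrite leqNgt lt.
have k_gt0 : (0 < k)%N by rewrite -Gsz size_poly_gt0.
have k_gt1 : (1 < k)%N.
  rewrite ltn_neqAle k_gt0 andbT; apply/eqP => k1.
  have /eqP/size_poly1P[c c_nz cE] : size (map_poly th1 G) = 1%N by rewrite Gsz.
  by move: G0; rewrite cE hornerC => /eqP; rewrite (negPf c_nz).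
(* The derivative has smaller size, so by minimality it could vanish at [a] only by being zero,
   which characteristic 0 forbids. *)
have G'_nz : ((map_poly th1 G)^`()).[a] != 0.
  apply/eqP => G'0.
  have derivE : (map_poly th1 G)^`() = map_poly th1 G^`() by rewrite deriv_map.
  have : map_poly th1 G^`() = 0.
    apply: minG; rewrite -derivE // -Gsz; exact: lt_size_deriv.
  rewrite -derivE => /polyP/(_ k.-2); rewrite coef_deriv coef0.
  have -> : k.-2.+1 = k.-1 by case: (k) k_gt1 => [|[|]].
  rewrite -Gsz -lead_coefE -mulr_natr => /eqP.
  rewrite mulf_eq0 lead_coef_eq0 (negPf G_nz) /= ((pcharf0P L).1 charL) Gsz.
  by case: (k) k_gt1 => [|[|]].
(* The unique value that makes the eps part of G(a + c eps) vanish in [horner_dual]. *)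
exists (- (map_poly dnsnd (map_poly th G)).[a] / ((map_poly th1 G)^`()).[a]).
set c := _ / _.
have vG : (map_poly th G).[dn a c] = 0.
  rewrite horner_dual map_poly_th1 G0; apply/dnE; split=> //.
  by rewrite /dnsnd /= /c mulrVK ?unitfE // subrr.
move=> P; move: {2}(size _) (leqnn (size (map_poly th1 P))) => e.
elim: e P => [|e IHe] P.
  by rewrite leqn0 size_poly_eq0 => /eqP/zeroE ->; rewrite horner0.
rewrite fstE => Pe P0; have [lt|le] := ltnP (size (map_poly th1 P)) k.
  by rewrite (zeroE P) ?horner0 // minG.
(* One step of pseudo-division by [G]: the size drops, and the value at a + c eps is only multiplied
   by the leading coefficient of [G], whose first part is nonzero. *)
pose P' := (G`_k.-1)%:P * P - (P`_(size (map_poly th1 P)).-1)%:P *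
             'X^(size (map_poly th1 P) - k) * G.
have P'v : (map_poly th P').[dn a c] = th G`_k.-1 * (map_poly th P).[dn a c].
  by rewrite rmorphB !rmorphM /= !map_polyC /= !hornerE vG mulr0 subr0.
have P'0 : (map_poly th P').[dn a c] = 0.
  apply: IHe; last by rewrite P'v dnfstM fstE P0 mulr0.
  set sp := size (map_poly th1 P) in P' P'v le Pe *.
  apply/leq_sizeP => j ej.
  have jsp : (sp.-1 <= j)%N by case: (sp) Pe => [|sp'] //=; rewrite ltnS => /leq_trans; apply.
  rewrite coef_map coefB -mulrA !coefCM coefXnM.
  have -> : (j < sp - k)%N = false.
    apply/negbTE; rewrite -leqNgt; apply: leq_trans jsp.
    by rewrite -subn1 leq_sub2l.
  rewrite [LHS]rmorphB !rmorphM.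
  have [->|jne] := eqVneq j sp.-1.
    have -> : (sp.-1 - (sp - k) = k.-1)%N.
      by rewrite -!subn1 subnAC subKn.
    by rewrite mulrC subrr.
  have jsp' : (sp <= j)%N by case: (sp) jsp jne => //= sp' h1 h2; rewrite ltn_neqAle eq_sym h2.
  have th1c (Q : {poly R}) i : th1 Q`_i = (map_poly th1 Q)`_i by rewrite coef_map.
  rewrite !th1c [X in _ * X - _](nth_default _ jsp').
  rewrite [X in _ - _ * X]nth_default ?mulr0 ?subrr // Gsz.
  by rewrite leq_subRL ?(leq_trans (leq_subr _ _)) // subnK.
have z1 : dnfst (map_poly th P).[dn a c] = 0 by rewrite fstE.
move: P'v; rewrite P'0 => /esym/dnE[_].
rewrite dnsndM z1 mulr0 addr0 => /eqP; rewrite mulf_eq0 => /orP[|/eqP z2].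
  have : lead_coef (map_poly th1 G) != 0 by rewrite lead_coef_eq0.
  by rewrite lead_coefE coef_map Gsz => /negPf; rewrite /th1 /= => ->.
by apply/dnE.
Qed.
End ExtendOne.

(** * Evaluation of multivariate polynomials, one variable at a time *)

Lemma rmorph_mpolyE (R S : comNzRingType) n (phi : {rmorphism {mpoly R[n]} -> S})
    (f : {rmorphism R -> S}) (x : 'I_n -> S) :
  (forall c, phi c%:MP = f c) -> (forall i, phi 'X_i = x i) ->
  phi =1 mmap f x.
Proof.
move=> phiC phiX g; rewrite [in LHS](mpolyE g) rmorph_sum; apply: eq_bigr => m _.
rewrite -mul_mpolyC rmorphM phiC; congr (_ * _).
by rewrite mpolyXE_id rmorph_prod; apply: eq_bigr => i _; rewrite rmorphXn phiX.
Qed.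

Lemma mmap_eq (R S : nzRingType) n (f f' : R -> S) (x x' : 'I_n -> S) :
  f =1 f' -> x =1 x' -> mmap f x =1 mmap f' x'.
Proof.
move=> ff xx g; apply: eq_bigr => m _; rewrite ff; congr (_ * _).
exact: mmap1_eq.
Qed.

Lemma rmorph_mmap (R S T : comNzRingType) n (f : {rmorphism R -> S})
    (h : {rmorphism S -> T}) (x : 'I_n -> S) g :
  h (mmap f x g) = mmap (h \o f) (h \o x) g.
Proof.
rewrite rmorph_sum; apply: eq_bigr => m _; rewrite rmorphM; congr (_ * _).
by rewrite rmorph_prod; apply: eq_bigr => i _; rewrite rmorphXn.
Qed.

Lemma mmap_mPo (R S : comNzRingType) n k (f : {rmorphism R -> S}) (x : 'I_k -> S)
    (g : {mpoly R[n]}) (q : n.-tuple {mpoly R[k]}) :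
  mmap f x (g \mPo q) = mmap f (fun i => mmap f x (tnth q i)) g.
Proof.
rewrite /comp_mpoly rmorph_mmap; apply: mmap_eq => // c.
by rewrite /= mmapC.
Qed.

Lemma muni_horner (R S : comNzRingType) n (f : {rmorphism R -> S})
    (x : 'I_n.+1 -> S) (g : {mpoly R[n.+1]}) :
  mmap f x g =
  (map_poly (mmap f (x \o widen_ord (leqnSn n))) (muni g)).[x ord_max].
Proof.
rewrite muniE rmorph_sum /= horner_sum; apply: eq_bigr => m _.
rewrite -mul_polyC rmorphM /= map_polyC map_polyXn /= hornerM hornerC hornerXn.
rewrite mmapZ mmapX -mulrA; congr (_ * _).
rewrite /mmap1 big_ord_recr /=; congr (_ * _); apply: eq_bigr => i _.
by rewrite mnmE.
Qed.

Lemma muni_inj (R : comNzRingType) n : injective (@muni n R).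
Proof.
move=> p q pq; rewrite -[p]comp_mpoly_id -[q]comp_mpoly_id /comp_mpoly.
by rewrite !muni_horner pq.
Qed.

Lemma muni_eq0 (R : comNzRingType) n (p : {mpoly R[n.+1]}) :
  (muni p == 0) = (p == 0).
Proof. by apply/eqP/eqP => [|->]; rewrite ?muni0 // -(muni0 n R) => /muni_inj. Qed.

Lemma muni_mwiden (R : comNzRingType) n (p : {mpoly R[n]}) : muni (mwiden p) = p%:P.
Proof.
pose phi : {rmorphism {mpoly R[n]} -> {poly {mpoly R[n]}}} := @muni n R \o @mwiden n R.
pose psi : {rmorphism {mpoly R[n]} -> {poly {mpoly R[n]}}} := polyC.
pose f : {rmorphism R -> {poly {mpoly R[n]}}} := polyC \o @mpolyC n R.
rewrite -[LHS]/(phi p) -[RHS]/(psi p).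
rewrite (@rmorph_mpolyE _ _ _ psi f (fun i => ('X_i)%:P)) //.
apply: rmorph_mpolyE => [c|i] /=; first by rewrite mwidenC muniC.
rewrite mwidenX muniE msuppX big_seq1 mcoeffX eqxx scale1r mnmwiden_ordmax.
rewrite expr0 alg_polyC; congr (('X_[_])%:P).
by apply/mnmP => j; rewrite mnmE mnmwiden_widen.
Qed.

Lemma muni_ordmax (R : comNzRingType) n : muni ('X_ord_max : {mpoly R[n.+1]}) = 'X.
Proof.
rewrite muniE msuppX big_seq1 mcoeffX eqxx scale1r mnm1E eqxx expr1.
have -> : [multinom (U_(@ord_max n)%MM (widen_ord (leqnSn n) i)) | i < n] = 0%MM.
  by apply/mnmP => i; rewrite mnmE mnm1E mnm0E -val_eqE /= gtn_eqF.
by rewrite mpolyX0 scale1r.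
Qed.

Definition ord_snoc (T : Type) n (c : 'I_n -> T) (a : T) (i : 'I_n.+1) : T :=
  if unlift ord_max i is Some j then c j else a.

Lemma ord_snoc_widen T n (c : 'I_n -> T) a i :
  ord_snoc c a (widen_ord (leqnSn n) i) = c i.
Proof.
rewrite /ord_snoc; have -> : widen_ord (leqnSn n) i = lift ord_max i.
  by apply: val_inj; rewrite /= /bump leqNgt ltn_ord.
by rewrite liftK.
Qed.

Lemma ord_snoc_max T n (c : 'I_n -> T) a : ord_snoc c a ord_max = a.
Proof. by rewrite /ord_snoc unlift_none. Qed.

Lemma functional_extend (L : fieldType) (charL : [pchar L] =i pred0) n
    (R : comNzRingType) (th : {rmorphism R -> dualnum L}) (x : 'I_n -> L) :
  functional th ->
  exists c : 'I_n -> L, functional (mmap th (fun i => dn (x i) (c i))).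
Proof.
move=> th_fun; elim: n x => [|n IHn] x.
  by exists (fun=> 0) => g; rewrite (nvar0_mpolyC g) mmapC; exact: th_fun.
have [c' c'P] := IHn (x \o widen_ord (leqnSn n)).
have [c0 c0P] := functional_extend_one charL c'P (x ord_max).
exists (ord_snoc c' c0) => g; rewrite muni_horner ord_snoc_max.
have /eq_map_poly -> : mmap th ((fun i => dn (x i) (ord_snoc c' c0 i))
   \o widen_ord (leqnSn n)) =1
   mmap th (fun i => dn ((x \o widen_ord (leqnSn n)) i) (c' i)).
  by apply: mmap_eq => // i; rewrite /= ord_snoc_widen.
exact: c0P.
Qed.

(** Both sides are ring morphisms in [g] that agree on constants and variables. Constants have no
    eps part, so the derivations involved are K-linear. *)
Lemma mmap_dual (K L : fieldType) (iota : {rmorphism K -> L}) n (x c : 'I_n -> L)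
    (g : {mpoly K[n]}) :
  mmap (dninj \o iota) (fun i => dn (x i) (c i)) g =
  dn (mmap iota x g) (\sum_(j < n) mmap iota x g^`M(j) * c j).
Proof.
pose phi g := dn (mmap iota x g) (\sum_(j < n) mmap iota x g^`M(j) * c j).
have phiD : zmod_morphism phi.
  move=> p q; apply/dnE; split; rewrite /dnfst /dnsnd /= ?rmorphB //.
  by rewrite -sumrB; apply: eq_bigr => j _; rewrite mderivB rmorphB mulrBl.
have phiM : monoid_morphism phi.
  split=> [|p q]; apply/dnE; split; rewrite /dnfst /dnsnd /= ?rmorph1 ?rmorphM //.
    by rewrite big1 // => j _; rewrite -mpolyC1 mderivC rmorph0 mul0r.
  rewrite mulr_sumr mulr_suml -big_split; apply: eq_bigr => j _ /=.
  by rewrite mderivM rmorphD !rmorphM /=; ring.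
pose phi' : {rmorphism {mpoly K[n]} -> dualnum L} :=
  HB.pack phi (GRing.isZmodMorphism.Build _ _ phi phiD)
              (GRing.isMonoidMorphism.Build _ _ phi phiM).
apply/esym; rewrite -[LHS]/(phi' g).
apply: (@rmorph_mpolyE _ _ _ phi' (dninj \o iota)) => [a|i]; apply/dnE.
  rewrite /dnfst /dnsnd /= mmapC; split=> //.
  by rewrite big1 // => j _; rewrite mderivC rmorph0 mul0r.
rewrite /dnfst /dnsnd /= mmapX mmap1U; split=> //.
rewrite (bigD1 i) //= big1 => [|j ji]; rewrite mderivX mnm1E.
  have -> : (U_(i) - U_(i))%MM = 0%MM :> 'X_{1..n}.
    by apply/mnmP => k; rewrite mnmBE subnn mnm0E.
  by rewrite eqxx scale1r mpolyX0 rmorph1 mul1r addr0.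
by rewrite eq_sym (negPf ji) scale0r rmorph0 mul0r.
Qed.

(** * Transcendence degree *)

Section AlgebraicIndependence.
Variables (K L : fieldType) (iota : {rmorphism K -> L}).

Definition alg_indep n (y : 'I_n -> L) := forall H, mmap iota y H = 0 -> H = 0.

(** The transcendence degree of K(x) is at least D. Polynomial witnesses suffice, since the
    coordinates of x contain a transcendence basis. *)
Definition trdeg_ge N (x : 'I_N -> L) (D : nat) :=
  exists Y : 'I_D -> {mpoly K[N]}, alg_indep (fun i => mmap iota x (Y i)).

Lemma alg_indep_snoc n (y : 'I_n -> L) a :
  alg_indep (ord_snoc y a) <->
  forall P : {poly {mpoly K[n]}}, (map_poly (mmap iota y) P).[a] = 0 -> P = 0.
Proof.
have snocE : (ord_snoc y a) \o widen_ord (leqnSn n) =1 y.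
  by move=> i; rewrite /= ord_snoc_widen.
have evE (H : {mpoly K[n.+1]}) :
    mmap iota (ord_snoc y a) H = (map_poly (mmap iota y) (muni H)).[a].
  rewrite muni_horner ord_snoc_max; congr (_.[_]); apply: eq_map_poly.
  exact: mmap_eq.
split=> [ind P Pa|ind H]; last first.
  by rewrite evE => /ind/eqP; rewrite muni_eq0 => /eqP.
have [Q QE] : exists Q, muni Q = P.
  elim/poly_ind: P {Pa} => [|P c [Q QE]]; first by exists 0; rewrite muni0.
  exists (Q * 'X_ord_max + mwiden c).
  by rewrite muniD muniM muni_ordmax muni_mwiden QE.
by rewrite -QE; rewrite (ind Q) ?muni0 // evE QE.
Qed.

Hypothesis charL : [pchar L] =i pred0.

(* A derivation at x, seen as the vector c of its values on the coordinates. *)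
Definition derivation_at N (x c : 'I_N -> L) :=
  forall g, mmap iota x g = 0 -> \sum_(j < N) mmap iota x g^`M(j) * c j = 0.

(** Independence makes the map sending the i-th variable to y_i + lam_i eps functional, whatever
    [lam] is; it is then extended to the coordinates of x. *)
Lemma alg_indep_derivation D N (Y : 'I_D -> {mpoly K[N]}) (x : 'I_N -> L)
    (lam : 'I_D -> L) : alg_indep (fun i => mmap iota x (Y i)) ->
  exists c : 'I_N -> L, derivation_at x c /\
    forall i, \sum_(j < N) mmap iota x (Y i)^`M(j) * c j = lam i.
Proof.
move=> indY; set y := (fun i => _) in indY.
pose th : {rmorphism {mpoly K[D]} -> dualnum L} :=
  mmap (dninj \o iota) (fun i => dn (y i) (lam i)).
have th_fun : functional th.
  by move=> H; rewrite /th /= mmap_dual /dnfst /= => /indY ->; rewrite -mmap_dual rmorph0.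
have [c cP] := functional_extend charL x th_fun.
have evE g : mmap th (fun i => dn (x i) (c i)) (map_mpoly (@mpolyC D K) g) =
             mmap (dninj \o iota) (fun i => dn (x i) (c i)) g.
  pose phi : {rmorphism {mpoly K[N]} -> dualnum L} :=
    mmap th (fun i => dn (x i) (c i)) \o map_mpoly (@mpolyC D K).
  rewrite -[LHS]/(phi g).
  apply: (@rmorph_mpolyE _ _ _ phi (dninj \o iota)) => [a|i].
    by rewrite /phi /= map_mpolyC mmapC /th /= mmapC.
  by rewrite /phi /= map_mpolyX mmapX mmap1U.
exists c; split=> [g g0|i].
  have := cP (map_mpoly (@mpolyC D K) g).
  by rewrite evE mmap_dual /dnfst /= g0 => /(_ erefl)/dnE[].
(* This polynomial takes the value Y_i(x) - y_i = 0, so its eps part vanishes too: that is the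
   prescribed value. *)
have := cP (map_mpoly (@mpolyC D K) (Y i) - ('X_i)%:MP).
rewrite rmorphB /= evE mmapC /th /= mmap_dual mmapX mmap1U.
rewrite /dnfst /= subrr => /(_ erefl)/dnE[_]; rewrite /dnsnd /= => /eqP.
by rewrite subr_eq0 => /eqP.
Qed.

End AlgebraicIndependence.

Section Substitution.
Variables (K L : fieldType) (iota : {rmorphism K -> L}).
Variables (N D : nat) (Y : 'I_D -> {mpoly K[N]}) (a : {mpoly K[N]}).

Definition poly_subst (P : {poly {mpoly K[D]}}) : {mpoly K[N]} :=
  (map_poly (mmap (@mpolyC N K) Y) P).[a].

Lemma mmap_subst (x : 'I_N -> L) (H : {mpoly K[D]}) :
  mmap iota x (mmap (@mpolyC N K) Y H) = mmap iota (fun i => mmap iota x (Y i)) H.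
Proof. by rewrite rmorph_mmap; apply: mmap_eq => // c; rewrite /= mmapC. Qed.

Lemma mmap_poly_subst (x : 'I_N -> L) P :
  mmap iota x (poly_subst P) =
  (map_poly (mmap iota (fun i => mmap iota x (Y i))) P).[mmap iota x a].
Proof.
rewrite /poly_subst -horner_map -map_poly_comp; congr (_.[_]).
by apply: eq_map_poly => H; rewrite /= mmap_subst.
Qed.

End Substitution.

Section TranscendenceDegree.
Variables (K L : fieldType) (iota : {rmorphism K -> L}).
Local Notation alg_indep := (alg_indep iota).
Local Notation trdeg_ge := (trdeg_ge iota).
Local Notation derivation_at := (derivation_at iota).

Lemma eq_alg_indep n (y y' : 'I_n -> L) : y =1 y' -> alg_indep y -> alg_indep y'.
Proof.
move=> yy ind H; rewrite -(@mmap_eq _ _ _ iota iota y y') //; exact: ind.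
Qed.

Lemma alg_indep_widen n (y : 'I_n.+1 -> L) :
  alg_indep y -> alg_indep (y \o widen_ord (leqnSn n)).
Proof.
move=> ind; have : alg_indep (ord_snoc (y \o widen_ord (leqnSn n)) (y ord_max)).
  apply: eq_alg_indep ind => i; case: (unliftP ord_max i) => [j ->|->].
    have -> : lift ord_max j = widen_ord (leqnSn n) j.
      by apply: val_inj; rewrite /= /bump leqNgt ltn_ord.
    by rewrite ord_snoc_widen.
  by rewrite ord_snoc_max.
move=> /alg_indep_snoc indP H H0; have := indP H%:P.
by rewrite map_polyC hornerC => /(_ H0)/eqP; rewrite polyC_eq0 => /eqP.
Qed.

Lemma trdeg_geW N (x : 'I_N -> L) D D' :
  (D' <= D)%N -> trdeg_ge x D -> trdeg_ge x D'.
Proof.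
move=> /subnK <-; elim: (D - D')%N => [|k IHk] //=; rewrite addSn => -[Y indY].
apply: IHk; exists (Y \o widen_ord (leqnSn _)); exact: alg_indep_widen indY.
Qed.

Lemma trdeg_ge0 N (x : 'I_N -> L) : trdeg_ge x 0.
Proof.
exists (fun=> 0) => H; rewrite (nvar0_mpolyC H) mmapC => /eqP.
by rewrite fmorph_eq0 => /eqP ->; rewrite mpolyC0.
Qed.

Hypothesis charL : [pchar L] =i pred0.

Definition grad N (x : 'I_N -> L) s (G : 'I_s -> {mpoly K[N]}) : 'M[L]_(s, N) :=
  \matrix_(i, j) mmap iota x (G i)^`M(j).

Lemma gradE N (x : 'I_N -> L) s (G : 'I_s -> {mpoly K[N]}) t (C : 'M_(t, N)) i k :
  (C *m (grad x G)^T) i k = \sum_(j < N) mmap iota x (G k)^`M(j) * C i j.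
Proof. by rewrite mxE; apply: eq_bigr => j _; rewrite !mxE mulrC. Qed.

Lemma derivation_basis N (x : 'I_N -> L) D (Y : 'I_D -> {mpoly K[N]}) :
  alg_indep (fun i => mmap iota x (Y i)) ->
  exists C : 'M[L]_(D, N), C *m (grad x Y)^T = 1%:M /\
    forall i, derivation_at x (C i).
Proof.
move=> indY.
have /choice[c cP] : forall i, exists c : 'I_N -> L, derivation_at x c /\
    forall k, \sum_(j < N) mmap iota x (Y k)^`M(j) * c j = (i == k)%:R.
  by move=> i; exact: alg_indep_derivation.
exists (\matrix_(i, j) c i j); split.
  apply/matrixP => i k; rewrite gradE [RHS]mxE -(cP i).2.
  by apply: eq_bigr => j _; rewrite mxE.
move=> i g g0; rewrite -[RHS]((cP i).1 g g0); apply: eq_bigr => j _.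
by rewrite mxE.
Qed.

(** The D derivations dual to an independent family are linearly independent and lie in the kernel
    of the gradients of all equations of x. *)
Lemma trdeg_rank N (x : 'I_N -> L) D s (G : 'I_s -> {mpoly K[N]}) :
  trdeg_ge x D -> (forall i, mmap iota x (G i) = 0) ->
  (D + \rank (grad x G) <= N)%N.
Proof.
move=> [Y indY] G0; have [C [C1 Cder]] := derivation_basis indY.
have CG : C *m (grad x G)^T = 0.
  by apply/matrixP => i k; rewrite gradE Cder // mxE.
have := mulmx0_rank_max CG; rewrite mxrank_tr; apply: leq_trans.
rewrite leq_add2r -{1}(mxrank1 L D) -C1; exact: mxrankM_maxl.
Qed.

Lemma trdeg_le N (x : 'I_N -> L) D : trdeg_ge x D -> (D <= N)%N.
Proof.
move=> xD; have le : (D + \rank (grad x (fun _ : 'I_0 => 0%R)) <= N)%N.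
  by apply: trdeg_rank => // i; rewrite mmap0.
exact: leq_trans (leq_addr _ _) le.
Qed.

Lemma trdeg_max N (x : 'I_N -> L) : exists2 D, trdeg_ge x D & ~ trdeg_ge x D.+1.
Proof.
have ex : exists D, `[< trdeg_ge x D >] by exists 0%N; exact/asboolP/trdeg_ge0.
have ub D : `[< trdeg_ge x D >] -> (D <= N)%N by move/asboolP/trdeg_le.
have [D /asboolP xD Dmax] := ex_maxnP ex ub; exists D => // xD1.
by have := Dmax _ (asboolT xD1); rewrite ltnn.
Qed.

(** Plays the role of the exchange lemma: if D > M, some nonzero combination of the D dual
    derivations kills all of [W], hence is zero, against duality. *)
Lemma trdeg_exchange N (x : 'I_N -> L) D M (W : 'I_M -> {mpoly K[N]}) :
  trdeg_ge x D ->
  (forall c, derivation_at x c ->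
     (forall k, \sum_(j < N) mmap iota x (W k)^`M(j) * c j = 0) -> c =1 (fun=> 0)) ->
  (D <= M)%N.
Proof.
move=> [Y indY] Wspan; have [C [C1 Cder]] := derivation_basis indY.
rewrite leqNgt; apply/negP => MD.
set A := C *m (grad x W)^T.
have : kermx A != 0.
  rewrite -mxrank_eq0 mxrank_ker subn_eq0 -ltnNge.
  exact: leq_ltn_trans (rank_leq_col _) MD.
case/rowV0Pn => mu; rewrite -submx0 sub_kermx => /eqP muA; rewrite submx0.
apply/negP; rewrite negbK.
have c0 : mu *m C = 0.
  apply/rowP => j; rewrite [RHS]mxE; apply: (Wspan (fun j => (mu *m C) 0 j)).
    move=> g g0; transitivity (\sum_i mu 0 i * \sum_j mmap iota x g^`M(j) * C i j).
      under eq_bigr => k _ do rewrite mxE mulr_sumr.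
      rewrite exchange_big /=; apply: eq_bigr => i _; rewrite mulr_sumr.
      by apply: eq_bigr => k _; rewrite mulrCA.
    by rewrite big1 // => i _; rewrite Cder // mulr0.
  by move=> k; rewrite -gradE -mulmxA -/A muA mxE.
by rewrite -[mu]mulmx1 -C1 mulmxA c0 mul0mx.
Qed.

(** Differentiating a relation P(w, a) = 0 of least degree in a gives P'(a) da = 0, where P'(a) is
    nonzero by minimality and characteristic 0. *)
Lemma derivation_algebraic N (x c : 'I_N -> L) M (W : 'I_M -> {mpoly K[N]}) a :
  derivation_at x c ->
  (forall k, \sum_(j < N) mmap iota x (W k)^`M(j) * c j = 0) ->
  alg_indep (fun k => mmap iota x (W k)) ->
  ~ alg_indep (ord_snoc (fun k => mmap iota x (W k)) (mmap iota x a)) ->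
  \sum_(j < N) mmap iota x a^`M(j) * c j = 0.
Proof.
move=> derc cW indW; set w := (fun k => _) in indW *; move=> dep.
pose val P := (map_poly (mmap iota w) P).[mmap iota x a].
pose pr k := `[< exists P, [/\ P != 0, val P = 0 & size P = k] >].
have expr : exists k, pr k.
  apply: contrapT => nex; apply: dep; apply/alg_indep_snoc => P P0.
  apply/eqP; apply: contrapT => /negP nz; apply: nex; exists (size P).
  by apply/asboolP; exists P.
case: (ex_minnP expr) => k /asboolP[P [P_nz P0 Psz]] kmin.
have map_nz Q : Q != 0 -> map_poly (mmap iota w) Q != 0.
  apply: contraNneq => Q0; apply/eqP/polyP => i; rewrite coef0; apply: indW.
  by have /polyP/(_ i) := Q0; rewrite coef_map coef0.
have k_gt1 : (1 < k)%N.
  rewrite -Psz; case E: (size P) => [|[|//]].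
    by move/eqP: E; rewrite size_poly_eq0 (negPf P_nz).
  have /eqP/size_poly1P[h h_nz hE] := E; move: P0.
  by rewrite /val hE map_polyC hornerC => /indW/eqP; rewrite (negPf h_nz).
have P'_nz : P^`() != 0.
  apply/eqP => /polyP/(_ k.-2); rewrite coef_deriv coef0.
  have -> : k.-2.+1 = k.-1 by case: (k) k_gt1 => [|[|]].
  rewrite -Psz -lead_coefE -mulr_natr => /eqP.
  rewrite mulf_eq0 lead_coef_eq0 (negPf P_nz) /= Psz => /eqP/(congr1 (mmap iota w)).
  rewrite rmorph_nat rmorph0 => /eqP; rewrite ((pcharf0P L).1 charL).
  by case: (k) k_gt1 => [|[|]].
have P'a : val P^`() != 0.
  apply/eqP => v0; have := kmin _ (asboolT (ex_intro _ _ (And3 P'_nz v0 erefl))).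
  by rewrite leqNgt -Psz lt_size_deriv.
pose dv : {rmorphism {mpoly K[N]} -> dualnum L} :=
  mmap (dninj \o iota) (fun j => dn (x j) (c j)).
have dvE g : dv g = dn (mmap iota x g) (\sum_(j < N) mmap iota x g^`M(j) * c j).
  exact: mmap_dual.
have : dv (poly_subst W a P) = 0.
  rewrite dvE derc ?mmap_poly_subst //; exact/dnE.
rewrite /poly_subst -horner_map -map_poly_comp dvE horner_dual => /dnE[_].
rewrite /dnsnd /= -!map_poly_comp.
rewrite (@eq_map_poly _ _ _ (fun=> 0)) => [|H]; last first.
  rewrite /= rmorph_mmap.
  rewrite (@mmap_eq _ _ _ _ (dninj \o iota) _ (dninj \o w)) => [|b|i].
  - by rewrite -rmorph_mmap.
  - by rewrite /= mmapC.
  by rewrite /= -/(dv _) dvE cW.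
have -> : map_poly (fun=> 0 : L) P = 0.
  by apply/polyP => i; rewrite coef_map_id0 // !coef0.
rewrite horner0 add0r => /eqP; rewrite mulf_eq0 => /orP[/eqP //|].
rewrite (@eq_map_poly _ _ _ (mmap iota w)) => [|H]; last first.
  by rewrite /= -/(dv _) dvE /dnfst /= mmap_subst.
by rewrite deriv_map (negPf P'a).
Qed.

End TranscendenceDegree.

Section TranscendenceDegreeChange.
Variables (K L L' : fieldType).
Variables (iota : {rmorphism K -> L}) (iota' : {rmorphism K -> L'}).

(** A family independent at the specialization x', together with [a], is independent at x: in a
    relation, the constant term in [a] vanishes at x', hence is zero, and one factor [a] can be
    cancelled. *)
Lemma trdeg_strict N (x : 'I_N -> L) (x' : 'I_N -> L') D a :
  (forall g, mmap iota x g = 0 -> mmap iota' x' g = 0) ->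
  mmap iota' x' a = 0 -> mmap iota x a != 0 ->
  trdeg_ge iota' x' D -> trdeg_ge iota x D.+1.
Proof.
move=> sub a0 a_nz [Y indY]; exists (ord_snoc Y a).
apply: (@eq_alg_indep _ _ _ _ (ord_snoc (fun i => mmap iota x (Y i)) (mmap iota x a))).
  by move=> i; rewrite /ord_snoc; case: unlift.
apply/alg_indep_snoc => P; elim/poly_ind: P => [//|P c IHP].
rewrite rmorphD rmorphM /= map_polyX map_polyC hornerMXaddC => v0.
have c0 : c = 0.
  apply: indY; have : mmap iota' x' (poly_subst Y a P * a + mmap (@mpolyC N K) Y c) = 0.
    by apply: sub; rewrite rmorphD rmorphM /= mmap_poly_subst mmap_subst.
  by rewrite rmorphD rmorphM /= a0 mulr0 add0r mmap_subst.
move: v0; rewrite c0 [X in _ + X]rmorph0 addr0 => /eqP; rewrite mulf_eq0 (negPf a_nz) orbF.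
by move=> /eqP/IHP ->; rewrite mul0r add0r polyC0.
Qed.

End TranscendenceDegreeChange.

Lemma sum_derivX (K L : fieldType) (iota : {rmorphism K -> L}) N
    (x c : 'I_N -> L) k :
  \sum_(j < N) mmap iota x ('X_k)^`M(j) * c j = c k.
Proof.
have := mmap_dual iota x c 'X_k; rewrite mmapX mmap1U => /dnE[_].
by rewrite /dnsnd /= => <-.
Qed.

(** K(x) lies in K(x0, s), whose transcendence degree exceeds that of K(x0) by at most r. At the
    point (x0, s), a derivation killing a transcendence basis of x0 and all of s is zero. *)
Lemma trdeg_scale (K L : fieldType) (iota : {rmorphism K -> L})
    (charL : [pchar L] =i pred0) N r (w : 'I_N -> 'I_r) (s : 'I_r -> L)
    (x x0 : 'I_N -> L) D :
  (forall j, x j = x0 j * s (w j)) -> trdeg_ge iota x D ->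
  trdeg_ge iota x0 (D - r).
Proof.
move=> xE [Y indY]; have [D0 [Y0 indY0] Dmax] := trdeg_max iota charL x0.
suff le : (D <= D0 + r)%N.
  by apply: (trdeg_geW (D := D0)); [rewrite leq_subLR addnC | exists Y0].
pose X (i : 'I_(N + r)) := match split i with inl j => x0 j | inr k => s k end.
have Xl j : X (lshift r j) = x0 j.
  by rewrite /X -[lshift r j]/(unsplit (inl j)) unsplitK.
have Xr k : X (rshift N k) = s k.
  by rewrite /X -[rshift N k]/(unsplit (inr k)) unsplitK.
pose emb := mmap (@mpolyC (N + r) K) (fun j => 'X_(lshift r j)).
have embE g : mmap iota X (emb g) = mmap iota x0 g.
  by rewrite mmap_subst; apply: mmap_eq => // j; rewrite mmapX mmap1U.
pose W (i : 'I_(D0 + r)) : {mpoly K[N + r]} :=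
  match split i with inl j => emb (Y0 j) | inr k => 'X_(rshift N k) end.
apply: (trdeg_exchange (iota := iota) charL (x := X) (W := W)).
  exists (fun i => mmap (@mpolyC (N + r) K)
                     (fun j => 'X_(lshift r j) * 'X_(rshift N (w j))) (Y i)).
  apply: eq_alg_indep indY => i; rewrite mmap_subst; apply: mmap_eq => // j.
  by rewrite xE rmorphM /= !mmapX !mmap1U Xl Xr.
move=> c derc Wc i.
have Wl j : W (lshift r j) = emb (Y0 j).
  by rewrite /W -[lshift r j]/(unsplit (inl j)) unsplitK.
have Wr k : W (rshift D0 k) = 'X_(rshift N k).
  by rewrite /W -[rshift D0 k]/(unsplit (inr k)) unsplitK.
rewrite -(splitK i); case: (split i) => [j|k] /=; last first.
  by have := Wc (rshift D0 k); rewrite Wr sum_derivX.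
rewrite -(sum_derivX iota X c).
apply: (derivation_algebraic charL (W := fun j => emb (Y0 j)) derc).
- by move=> k; rewrite -Wl Wc.
- by apply: eq_alg_indep indY0 => k; rewrite embE.
move=> ind; apply: Dmax; exists (ord_snoc Y0 'X_j).
apply: eq_alg_indep ind => k; rewrite /ord_snoc; case: unlift => [k'|].
  by rewrite embE.
by rewrite !mmapX !mmap1U.
Qed.

(** * Ideals and primes *)

Section IdealsAndPrimes.
Variable R : comNzRingType.
Implicit Types I J M G P : set R.

(** Unlike [idealr_closed], this allows the unit ideal. *)
Definition is_ideal I :=
  [/\ I 0, forall a b, I a -> I b -> I (a + b) & forall r a, I a -> I (r * a)].

Lemma ideal_sum_closed I k (u : 'I_k -> R) :
  is_ideal I -> (forall i, I (u i)) -> I (\sum_i u i).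
Proof. by case=> I0 ID _ Iu; apply: big_ind. Qed.

Lemma ideal_gen_ideal (S : set R) : is_ideal (ideal_gen S).
Proof.
split.
- by exists 0%N, (fun=> 0), (fun=> 0); split=> [[]//|]; rewrite big_ord0.
- move=> _ _ [k [a [x [Sx ->]]]] [k' [a' [x' [Sx' ->]]]].
  exists (k + k')%N, (fun i => match split i with inl j => a j | inr j => a' j end),
    (fun i => match split i with inl j => x j | inr j => x' j end); split.
    by move=> i; case: split.
  rewrite big_split_ord /=; congr (_ + _); apply: eq_bigr => i _.
    by rewrite -[lshift k' i]/(unsplit (inl i)) unsplitK.
  by rewrite -[rshift k i]/(unsplit (inr i)) unsplitK.
- move=> r _ [k [a [x [Sx ->]]]]; exists k, (fun i => r * a i), x; split=> //.
  by rewrite mulr_sumr; apply: eq_bigr => i _; rewrite mulrA.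
Qed.

Lemma sub_ideal_gen (S : set R) : S `<=` ideal_gen S.
Proof.
move=> g Sg; exists 1%N, (fun=> 1), (fun=> g); split=> //.
by rewrite big_ord1 mul1r.
Qed.

Lemma ideal_gen_min (S : set R) I : is_ideal I -> S `<=` I -> ideal_gen S `<=` I.
Proof.
move=> idI SI _ [k [a [x [Sx ->]]]]; apply: ideal_sum_closed => // i.
by case: idI => _ _; apply; exact: SI.
Qed.

Lemma prime_idealP P : prime_ideal P <->
  [/\ is_ideal P, ~ P 1 & forall a b, P (a * b) -> P a \/ P b].
Proof.
split=> [[[P0 P1 PD] PM]|[[P0 PD PM] P1 PP]].
  have {}P0 : P 0 by move: P0; rewrite inE.
  have PM' r a : P a -> P (r * a).
    by move=> Pa; rewrite -[_ * _]addr0 -in_setE PD // inE.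
  split=> //.
  - split=> // a b Pa Pb; rewrite -[a]mul1r -in_setE PD // inE //.
  - by move=> P1'; move: P1; rewrite mem_set.
  - move=> a b Pab; have := PM a b; rewrite !inE => /(_ Pab)/orP.
    by rewrite !inE.
split; first split.
- by rewrite inE.
- by apply/negP; rewrite inE.
- by move=> a u v; rewrite !inE => Pu Pv; apply: PD => //; exact: PM.
- by move=> u v; rewrite !inE => /PP [] Pu; apply/orP; [left|right]; rewrite inE.
Qed.

(* Taking [s = id] gives primes avoiding a multiplicative set; with an involution
   [s], the condition bears on I and on its image under s together. *)
Lemma ideal_maximal (s : R -> R) G I : is_ideal I ->
  (forall x, I x -> I (s x) -> G x) ->
  exists J, [/\ is_ideal J, I `<=` J, forall x, J x -> J (s x) -> G x &
    forall J', is_ideal J' -> J `<=` J' -> ~ J' `<=` J ->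
      exists x, [/\ J' x, J' (s x) & ~ G x]].
Proof.
move=> idI IG.
(* Zorn's lemma also asks about the empty chain, whose union is empty; adjoining [I] makes that case
   hold. *)
pose Pr (A : set R) := is_ideal (A `|` I) /\
  forall x, (A `|` I) x -> (A `|` I) (s x) -> G x.
have [] := @Zorn_bigcup R Pr.
  move=> F FP tot.
  have dir x y : ((\bigcup_(X in F) X) `|` I) x -> ((\bigcup_(X in F) X) `|` I) y ->
      (I x /\ I y) \/ exists2 X, F X & (X `|` I) x /\ (X `|` I) y.
    move=> [[X FX Xx]|Ix] [[Y FY Yy]|Iy]; last by left.
    - right; have [XY|YX] := tot _ _ FX FY.
        by exists Y => //; split; left=> //; exact: XY.
      by exists X => //; split; left=> //; exact: YX.
    - by right; exists X => //; split; [left|right].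
    - by right; exists Y => //; split; [right|left].
  have up X x : F X -> (X `|` I) x -> ((\bigcup_(X in F) X) `|` I) x.
    by move=> FX [Xx|]; [left; exists X|right].
  split; first split.
  - by right; case: idI.
  - move=> a b Ja Jb; have [[Ia Ib]|[X FX [Xa Xb]]] := dir _ _ Ja Jb.
      by right; case: idI => _ + _; apply.
    by apply: (up X) => //; case: (FP _ FX) => -[_ + _] _; apply.
  - move=> r a Ja; have [[Ia _]|[X FX [Xa _]]] := dir _ _ Ja Ja.
      by right; case: idI => _ _; apply.
    by apply: (up X) => //; case: (FP _ FX) => -[_ _ +] _; apply.
  - move=> x Jx Jsx; have [[Ia Ib]|[X FX [Xa Xb]]] := dir _ _ Jx Jsx.
      exact: IG.
    by case: (FP _ FX) => _; apply.
move=> A [[idA AG] Amax]; exists (A `|` I); split; [exact: idA|by move=> x; right|exact: AG|].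
move=> J' idJ' AJ' nJ'; apply: contrapT => nex; apply: (Amax J').
  split; first by move=> x Ax; apply: AJ'; left.
  by move=> J'A; apply: nJ' => x /J'A; left.
have J'E : J' `|` I = J'.
  by apply/seteqP; split=> [x [//|Ix]|x]; [apply: AJ'; right|left].
rewrite /Pr J'E; split=> // x J'x J'sx; apply: contrapT => nG; apply: nex.
by exists x.
Qed.

Definition adjoin J a := [set x | exists j r, J j /\ x = j + r * a].

Lemma adjoin_ideal J a : is_ideal J -> is_ideal (adjoin J a).
Proof.
case=> J0 JD JM; split.
- by exists 0, 0; rewrite mul0r addr0.
- move=> _ _ [j [r [Jj ->]]] [j' [r' [Jj' ->]]]; exists (j + j'), (r + r').
  by split; [exact: JD|rewrite mulrDl addrACA].
- move=> q _ [j [r [Jj ->]]]; exists (q * j), (q * r).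
  by split; [exact: JM|rewrite mulrDr mulrA].
Qed.

Lemma sub_adjoin J a : is_ideal J -> J `<=` adjoin J a.
Proof. by move=> _ x Jx; exists x, 0; rewrite mul0r addr0. Qed.

Lemma adjoin_mem J a : is_ideal J -> adjoin J a a.
Proof. by case=> J0 _ _; exists 0, 1; rewrite add0r mul1r. Qed.

Lemma adjoinM J a b x y : is_ideal J -> J (a * b) ->
  adjoin J a x -> adjoin J b y -> J (x * y).
Proof.
case=> J0 JD JM Jab [j [r [Jj ->]]] [j' [r' [Jj' ->]]].
rewrite mulrDl !mulrDr -!addrA; apply: (JD); first by rewrite mulrC; exact: JM.
apply: (JD); first by rewrite mulrC; exact: JM.
apply: (JD); first exact: JM.
have -> : r * a * (r' * b) = r * r' * (a * b) by ring.
exact: JM.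
Qed.

Lemma prime_avoiding M I : is_ideal I -> M 1 ->
  (forall a b, M a -> M b -> M (a * b)) -> (forall x, I x -> ~ M x) ->
  exists P, [/\ prime_ideal P, I `<=` P & forall x, P x -> ~ M x].
Proof.
move=> idI M1 MM IM.
have [|J [idJ IJ JG Jmax]] := @ideal_maximal id (~` M) I idI; first by move=> x Ix _; exact: IM.
exists J; split=> //; last by move=> x Jx; exact: JG.
apply/prime_idealP; split=> //; first by move=> J1; exact: (JG _ J1 J1).
move=> a b Jab; apply: contrapT => /not_orP[Ja Jb].
have [||x [Jax _ /contrapT Mx]] := Jmax _ (adjoin_ideal a idJ).
- exact: sub_adjoin.
- by move=> sub; apply: Ja; apply: sub; exact: adjoin_mem.
have [||y [Jby _ /contrapT My]] := Jmax _ (adjoin_ideal b idJ).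
- exact: sub_adjoin.
- by move=> sub; apply: Jb; apply: sub; exact: adjoin_mem.
have Jxy := adjoinM idJ Jab Jax Jby.
exact: (JG _ Jxy Jxy (MM _ _ Mx My)).
Qed.

End IdealsAndPrimes.

Section PrimeQuotient.
Variables (R : comNzRingType) (P : set R).
Hypothesis primeP : prime_ideal P.

Definition prime_pred : R -> bool := fun x => `[< P x >].
Local Notation S := prime_pred.
Let SE x : (x \in S) = `[< P x >]. Proof. by []. Qed.

Fact prime_pred_idealr : idealr_closed S.
Proof.
have [[P0 PD PM] P1 _] := (prime_idealP P).1 primeP.
split; rewrite ?SE; first exact/asboolP.
  by apply/negP; move/asboolP.
by move=> a u v /asboolP Pu /asboolP Pv; apply/asboolP/PD => //; exact: PM.
Qed.

Fact prime_pred_prime : prime_idealr_closed S.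
Proof.
move=> u v /asboolP Puv; have [_ _ PP] := (prime_idealP P).1 primeP.
by case: (PP _ _ Puv) => Pu; apply/orP; [left|right]; exact/asboolP.
Qed.

HB.instance Definition _ := isIdealr.Build R S prime_pred_idealr.
HB.instance Definition _ := isPrimeIdealrClosed.Build R S prime_pred_prime.

Let I : prime_idealr R := PrimeIdealr.clone R prime_pred _.
Definition prime_quotient : Type := {ideal_quot I}.
HB.instance Definition _ := GRing.ComNzRing.on prime_quotient.

(** Inverses are chosen classically, only to make the quotient an integral domain with units, from
    which the fraction field can be formed. *)
Definition pq_unit : {pred prime_quotient} := fun x => `[< exists y, y * x = 1 >].
Definition pq_inv (x : prime_quotient) : prime_quotient :=
  if pselect (exists y, y * x = 1) is left e then sval (cid e) else x.

Fact pq_mulVx : {in pq_unit, left_inverse 1 pq_inv *%R}.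
Proof.
by move=> x /asboolP e; rewrite /pq_inv; case: pselect => // e'; case: cid.
Qed.
Fact pq_unitPl x y : y * x = 1 -> pq_unit x.
Proof. by move=> yx; apply/asboolP; exists y. Qed.
Fact pq_invr_out : {in [predC pq_unit], pq_inv =1 id}.
Proof.
move=> x /negP nu; rewrite /pq_inv; case: pselect => // e; case: nu.
exact/asboolP.
Qed.
HB.instance Definition _ :=
  GRing.ComNzRing_hasMulInverse.Build prime_quotient pq_mulVx pq_unitPl pq_invr_out.
HB.instance Definition _ :=
  GRing.ComUnitRing_isIntegral.Build prime_quotient (@Quotient.rquot_IdomainAxiom R I).

Definition pq_proj : {rmorphism R -> {fraction prime_quotient}} :=
  (@tofrac prime_quotient) \o (\pi_({ideal_quot I})%qT : R -> prime_quotient).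

Lemma pq_proj_eq0 x : pq_proj x = 0 <-> P x.
Proof.
have pi0 : (\pi_({ideal_quot I})%qT 0 : prime_quotient) = 0 by exact: raddf0.
have piE : ((\pi_({ideal_quot I})%qT x : prime_quotient) == 0) = `[< P x >].
  by rewrite -pi0 -[RHS]SE -[x in RHS]subr0; apply/esym/(Quotient.idealrBE I).
rewrite /pq_proj /=; split=> [/eqP|Px].
  by rewrite tofrac_eq0 piE => /asboolP.
by apply/eqP; rewrite tofrac_eq0 piE; apply/asboolP.
Qed.

End PrimeQuotient.

Definition pt_ker (K L : fieldType) (iota : {rmorphism K -> L}) N (x : 'I_N -> L) :
  set {mpoly K[N]} := [set g | mmap iota x g = 0].

Lemma pt_ker_prime (K L : fieldType) (iota : {rmorphism K -> L}) N (x : 'I_N -> L) :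
  prime_ideal (pt_ker iota x).
Proof.
apply/prime_idealP; rewrite /pt_ker /=; split; first split.
- exact: mmap0.
- by move=> a b /= a0 b0; rewrite rmorphD /= a0 b0 addr0.
- by move=> r a /= a0; rewrite rmorphM /= a0 mulr0.
- by rewrite /= rmorph1 => /eqP; rewrite oner_eq0.
- by move=> a b /eqP; rewrite /= rmorphM mulf_eq0 => /orP[]/eqP; [left|right].
Qed.

(** The generic point of P: the classes of the variables in the residue field. *)
Lemma prime_point (K : fieldType) N (P : set {mpoly K[N]}) : prime_ideal P ->
  exists (L : fieldType) (iota : {rmorphism K -> L}) (x : 'I_N -> L), P = pt_ker iota x.
Proof.
move=> primeP; pose phi := pq_proj primeP.
exists _, (phi \o @mpolyC N K), (fun i => phi 'X_i).
apply/seteqP; split=> g; rewrite /pt_ker /= -(@rmorph_mpolyE _ _ _ phi) //.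
  by move=> Pg; exact/pq_proj_eq0.
by move/pq_proj_eq0.
Qed.

(** * Specialization, chains of primes and the Nullstellensatz *)

Section PrimeAbove.
Variables (K L : fieldType) (iota : {rmorphism K -> L}).
Hypothesis charK : [pchar K] =i pred0.

Lemma char0_inj : injective (fun n : nat => n%:R : K).
Proof.
move=> i j /eqP; wlog le : i j / (i <= j)%N => [hw|].
  by have [le|/ltnW le] := leqP i j; [exact: hw|rewrite eq_sym => /hw ->].
rewrite eq_sym -subr_eq0 -natrB // ((pcharf0P K).1 charK) subn_eq0 => lt.
by apply/eqP; rewrite eqn_leq le.
Qed.

(** In characteristic 0 the integers below the size of [p] have distinct images, too many to be all
    roots. *)
Lemma poly_nonroot (S : idomainType) (f : {rmorphism K -> S}) (p : {poly S}) :
  p != 0 -> exists c : K, p.[f c] != 0.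
Proof.
move=> p_nz; apply: contrapT => nex.
have roots : all (root p) [seq f (i%:R) | i <- seq.iota 0 (size p)].
  apply/allP => _ /mapP[i _ ->]; apply/negPn/negP => nr; apply: nex.
  by exists i%:R.
have := max_poly_roots p_nz roots.
rewrite map_inj_uniq ?iota_uniq ?size_map ?size_iota ?ltnn; first by move/(_ isT).
by move=> i j /fmorph_inj; exact: char0_inj.
Qed.

End PrimeAbove.

Lemma mmap_mwiden (R S : comNzRingType) n (f : {rmorphism R -> S}) (y : 'I_n.+1 -> S) H :
  mmap f y (mwiden H) = mmap f (y \o widen_ord (leqnSn n)) H.
Proof. by rewrite muni_horner muni_mwiden map_polyC hornerC. Qed.

Lemma mmap_mwiden_snoc (R S : comNzRingType) n (f : {rmorphism R -> S})
    (y : 'I_n -> S) a H :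
  mmap f (ord_snoc y a) (mwiden H) = mmap f y H.
Proof.
by rewrite mmap_mwiden; apply: mmap_eq => // i; rewrite /= ord_snoc_widen.
Qed.

Lemma mmap_ordmax_snoc (R S : comNzRingType) n (f : {rmorphism R -> S})
    (y : 'I_n -> S) a :
  mmap f (ord_snoc y a) 'X_ord_max = a.
Proof. by rewrite mmapX mmap1U ord_snoc_max. Qed.

Lemma exprM_inv (F : fieldType) (z : F) k i :
  z != 0 -> (i <= k)%N -> z ^+ k * z^-1 ^+ i = z ^+ (k - i).
Proof. by move=> z_nz ik; rewrite exprVn expfB_cond // (negPf z_nz). Qed.

Section Specialization.
Variables (K L : fieldType) (iota : {rmorphism K -> L}).
Hypothesis charK : [pchar K] =i pred0.
Variables (N : nat) (x : 'I_N -> L).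

(** After cancelling powers of [b], a relation for [b] has a nonzero constant term h(Y), and the
    other terms are divisible by [b]. Avoiding h(Y) thus forces a prime to avoid [b]. *)
Lemma algebraic_multiple D (Y : 'I_D -> {mpoly K[N]}) b P :
  P != 0 -> mmap iota x b != 0 ->
  mmap iota x (poly_subst Y b P) = 0 ->
  exists h, h != 0 /\ exists b',
    mmap iota x (mmap (@mpolyC N K) Y h) = mmap iota x (b * b').
Proof.
move=> + b_nz; elim/poly_ind: P => [|P c IHP]; first by rewrite eqxx.
rewrite /poly_subst rmorphD rmorphM /= map_polyX map_polyC hornerMXaddC.
have [-> nz|c_nz _] := eqVneq c 0.
  rewrite [X in _ + X]rmorph0 addr0 rmorphM /= => /eqP.
  rewrite mulf_eq0 (negPf b_nz) orbF => /eqP; apply: IHP.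
  by apply: contraNneq nz => ->; rewrite mul0r polyC0 addr0.
move=> /eqP; rewrite rmorphD /= addrC addr_eq0 => /eqP E; exists c; split=> //.
by exists (- poly_subst Y b P); rewrite E -rmorphN /= mulrN mulrC.
Qed.

(** Once [s] is inverted, every leading coefficient is invertible and each coordinate of x satisfies
    a monic equation. The inverse of s(y) is the extra last coordinate. *)
Lemma integral_generated D (y : 'I_D -> L) (s : {mpoly K[D]}) :
  mmap iota y s != 0 ->
  (forall j, exists (l : {mpoly K[D]}) (p : {poly {mpoly K[D]}}),
     [/\ s = lead_coef p * l, p != 0 &
     (map_poly (mmap iota y) p).[x j] = 0]) ->
  forall a, integralOver (mmap iota (ord_snoc y (mmap iota y s)^-1)) (mmap iota x a).
Proof.
move=> s_nz xP; set rho := mmap iota _.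
have int_x j : integralOver rho (x j).
  have [l [p [sE p_nz px]]] := xP j.
  have : mmap iota y (lead_coef p) * mmap iota y l != 0 by rewrite -rmorphM /= -sE.
  rewrite mulf_eq0 negb_or => /andP[lp_nz l_nz].
  have lcE : lead_coef (map_poly (mmap iota y) p) = mmap iota y (lead_coef p).
    by rewrite lead_coef_map_eq.
  apply: (@integral_root_monic _ _ _ _
    ((mmap iota y (lead_coef p))^-1 *: map_poly (mmap iota y) p)).
  - by rewrite monicE lead_coefZ lcE mulVf.
  - by rewrite rootE hornerZ px mulr0.
  apply/integral_poly => i; rewrite coefZ coef_map.
  suff -> : (mmap iota y (lead_coef p))^-1 * mmap iota y p`_i =
      rho (mwiden (l * p`_i) * 'X_ord_max) by exact: integral_id.
  rewrite /rho rmorphM /= mmap_mwiden_snoc mmap_ordmax_snoc rmorphM /=.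
  by rewrite sE rmorphM /=; field; rewrite l_nz lp_nz.
move=> a; apply: big_ind => [||m _]; first exact: integral0.
  exact: integral_add.
apply: integral_mul.
  have -> : iota (a@_m) = rho (a@_m)%:MP by rewrite /rho /= mmapC.
  exact: integral_id.
apply: big_ind => [||j _]; [exact: integral1|exact: integral_mul|].
elim: (m j) => [|k IHk]; first exact: integral1.
by rewrite exprS; exact: integral_mul.
Qed.

Lemma clear_denominators D (y : 'I_D -> L) (s : {mpoly K[D]}) G :
  mmap iota y s != 0 ->
  exists k F, mmap iota y s ^+ k * mmap iota (ord_snoc y (mmap iota y s)^-1) G =
              mmap iota y F.
Proof.
move=> s_nz; set S := mmap iota y s in s_nz *.
exists (size (muni G)), (\sum_(i < size (muni G)) (muni G)`_i * s ^+ (size (muni G) - i)).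
rewrite muni_horner ord_snoc_max.
rewrite (eq_map_poly (g := mmap iota y)); last first.
  by apply: mmap_eq => // i; rewrite /= ord_snoc_widen.
rewrite horner_poly mulr_sumr rmorph_sum; apply: eq_bigr => i _ /=.
rewrite rmorphM rmorphXn /= -/S mulrCA; congr (_ * _).
by rewrite exprM_inv // ltnW.
Qed.

(* If [h / t] is integral over A then h^e lies in t A. *)
Lemma integral_quotient (A : comNzRingType) (rho : {rmorphism A -> L}) (h t : A) al :
  integralOver rho al -> al * rho t = rho h ->
  exists e F, rho (h ^+ e) = rho (t * F).
Proof.
move=> [q q_mon qal] alt; set e := (size q).-1.
exists e, (- \sum_(i < e) q`_i * h ^+ i * t ^+ (e - i.+1)).
have sz : size q = e.+1 by rewrite /e prednK // size_poly_gt0 monic_neq0.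
have /eqP := qal; rewrite horner_poly sz big_ord_recr /= -[e in q`_e]/((size q).-1).
rewrite -[q`__]lead_coefE (monicP q_mon) rmorph1 mul1r => /eqP.
rewrite addrC addr_eq0 => /eqP E.
rewrite rmorphXn -alt exprMn E rmorphM rmorphN !mulrN mulNr; congr (- _).
rewrite rmorph_sum mulr_suml mulr_sumr; apply: eq_bigr => i _.
have -> : rho t ^+ e = rho t ^+ i * (rho t * rho t ^+ (e - i.+1)).
  by rewrite -exprS -exprD -addSnnS subnKC.
by rewrite !rmorphM !rmorphXn -alt exprMn /=; ring.
Qed.

(** Sets the last element of a transcendence basis equal to a constant. The difficulty is to find a
    prime over the resulting ideal at which the other D elements stay independent; this is done by
    integrality over K[y, 1/s]. *)
Lemma trdeg_specialize D b :
  trdeg_ge iota x D.+1 -> ~ trdeg_ge iota x D.+2 -> mmap iota x b != 0 ->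
  exists P, [/\ prime_ideal P, pt_ker iota x `<=` P,
    exists2 g, P g & mmap iota x g != 0, ~ P b &
    exists Y : 'I_D -> {mpoly K[N]}, forall H, P (mmap (@mpolyC N K) Y H) -> H = 0].
Proof.
move=> [Y indY] maxY b_nz; set y := (fun i => _) in indY.
have algP g : exists P, P != 0 /\ (map_poly (mmap iota y) P).[mmap iota x g] = 0.
  apply: contrapT => nex; apply: maxY; exists (ord_snoc Y g).
  apply: (@eq_alg_indep _ _ _ _ (ord_snoc y (mmap iota x g))).
    by move=> i; rewrite /ord_snoc; case: unlift.
  apply/alg_indep_snoc => P P0; apply/eqP; apply: contrapT => /negP nz.
  by apply: nex; exists P.
have [P [P_nz Pb]] := algP b.
have [h [h_nz [b' hE]]] : exists h, h != 0 /\ exists b',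
    mmap iota x (mmap (@mpolyC N K) Y h) = mmap iota x (b * b').
  by apply: (algebraic_multiple P_nz b_nz); rewrite mmap_poly_subst.
have /choice[p pP] j : exists P, P != 0 /\ (map_poly (mmap iota y) P).[x j] = 0.
  by have [P' P'P] := algP 'X_j; exists P'; rewrite mmapX mmap1U in P'P.
pose s : {mpoly K[D.+1]} := \prod_j lead_coef (p j).
have s_nz : s != 0.
  by apply/prodf_neq0 => j _; rewrite lead_coef_eq0; case: (pP j).
have sy_nz : mmap iota y s != 0 by apply: contra_neq s_nz; exact: indY.
have intL a : integralOver (mmap iota (ord_snoc y (mmap iota y s)^-1)) (mmap iota x a).
  apply: integral_generated => // j.
  exists (\prod_(i | i != j) lead_coef (p i)), (p j).
  by split; [rewrite /s (bigD1 j) |case: (pP j)|case: (pP j)].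
(* The constant must keep both [s] (the denominators) and [h] (the multiple of [b]) nonzero. *)
have [c c_nz] : exists c : K, (muni (s * h)).[c%:MP] != 0.
  by apply: (@poly_nonroot _ charK _ (@mpolyC D K)); rewrite muni_eq0 mulf_neq0.
pose spec : {rmorphism {mpoly K[D.+1]} -> {mpoly K[D]}} :=
  horner_eval (c%:MP : {mpoly K[D]}) \o @muni D K.
have specE H : spec H = (muni H).[c%:MP] by [].
have spec_widen H : spec (mwiden H) = H by rewrite specE muni_mwiden hornerC.
have [specs spech] : spec s != 0 /\ spec h != 0.
  by apply/andP; rewrite -negb_or -mulf_eq0 -rmorphM.
pose T : {mpoly K[D.+1]} := 'X_ord_max - c%:MP.
have specT : spec T = 0.
  by rewrite specE muniB muni_ordmax muniC hornerXsubC subrr.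
have T_nz : T != 0.
  by rewrite -muni_eq0 muniB muni_ordmax muniC polyXsubC_eq0.
pose Y' := Y \o widen_ord (leqnSn D); pose g := Y ord_max - c%:MP.
have gE : g = mmap (@mpolyC N K) Y T by rewrite rmorphB /= mmapX mmap1U mmapC.
have ty : mmap iota x g = mmap iota y T by rewrite gE mmap_subst.
have g_nz : mmap iota x g != 0.
  by rewrite ty; apply: contra_neq T_nz; exact: indY.
have kerI : is_ideal (pt_ker iota x).
  by have [] := (prime_idealP _).1 (pt_ker_prime iota x).
(* A prime disjoint from [M] is exactly one at which the first D elements remain independent. *)
pose M := [set m | exists2 H : {mpoly K[D]}, H != 0 & m = mmap (@mpolyC N K) Y' H].
have disj z : adjoin (pt_ker iota x) g z -> ~ M z.
  (* Here r(x) = H/T is integral over K[y, 1/s], so T divides a power of H there, and divides s^k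
     H^e in K[y] for some k. Setting the last variable to [c] kills T but neither [s] nor H. *)
  move=> [j [r [j0 ->]]] [H H_nz E].
  have E1 : mmap iota x r * mmap iota y T = mmap iota y (mwiden H).
    have := congr1 (mmap iota x) E; rewrite rmorphD rmorphM /= j0 add0r ty => ->.
    by rewrite mmap_subst mmap_mwiden.
  set rho : {rmorphism {mpoly K[D.+2]} -> L} :=
    mmap iota (ord_snoc y (mmap iota y s)^-1).
  have rhoE G : rho (mwiden G) = mmap iota y G by exact: mmap_mwiden_snoc.
  have [e [F FE]] : exists e F, rho (mwiden (mwiden H) ^+ e) = rho (mwiden T * F).
    by apply: (@integral_quotient _ rho _ _ _ (intL r)); rewrite !rhoE.
  have FE' : mmap iota y (mwiden H) ^+ e = mmap iota y T * rho F.
    by rewrite -!rhoE -rmorphXn FE rmorphM.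
  have [k [F' F'E]] := clear_denominators F sy_nz.
  have : s ^+ k * mwiden H ^+ e - T * F' = 0.
    apply: indY; apply/eqP; rewrite rmorphB subr_eq0 !rmorphM !rmorphXn /=.
    by rewrite -F'E FE' mulrCA.
  move/(congr1 spec)/eqP; rewrite rmorphB !rmorphM !rmorphXn spec_widen specT.
  rewrite mul0r subr0 rmorph0 mulf_eq0.
  by rewrite !expf_eq0 (negPf specs) (negPf H_nz) !andbF.
have M1 : M 1 by exists 1; rewrite ?oner_eq0 ?rmorph1.
have MM u v : M u -> M v -> M (u * v).
  move=> [H H_nz ->] [H' H'_nz ->]; exists (H * H'); first exact: mulf_neq0.
  by rewrite rmorphM.
have [Q [primeQ IQ QM]] := prime_avoiding (adjoin_ideal g kerI) M1 MM disj.
have kerQ : pt_ker iota x `<=` Q by move=> z /(sub_adjoin g kerI)/IQ.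
have Qg : Q g by apply: IQ; exact: adjoin_mem.
have [[Q0 QD QMul] Q1 _] := (prime_idealP _).1 primeQ.
have indQ H : Q (mmap (@mpolyC N K) Y' H) -> H = 0.
  move=> QH; apply/eqP; apply: contrapT => /negP H_nz; apply: (QM _ QH).
  by exists H.
exists Q; split=> //; [by exists g| |by exists Y'].
move=> Qb; have Qh : Q (mmap (@mpolyC N K) Y h).
  have -> : mmap (@mpolyC N K) Y h = (mmap (@mpolyC N K) Y h - b * b') + b' * b.
    by rewrite (mulrC b') subrK.
  apply: QD; last exact: QMul.
  by apply: kerQ; rewrite /pt_ker /= rmorphB /= hE subrr.
(* Modulo [g] the last element equals [c], so h(Y) and its specialization agree modulo Q. *)
suff /indQ h0 : Q (mmap (@mpolyC N K) Y' (spec h)) by move: spech; rewrite h0 eqxx.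
pose sigma : {rmorphism {mpoly K[D]} -> {mpoly K[N]}} := mmap (@mpolyC N K) Y'.
pose p' := map_poly sigma (muni h).
have p'c : p'.[c%:MP] = sigma (spec h).
  have -> : c%:MP_[N] = sigma c%:MP by rewrite /sigma /= mmapC.
  by rewrite horner_map.
have /factor_theorem[q qE] : root (p' - p'.[c%:MP]%:P) c%:MP.
  by rewrite rootE hornerD hornerN hornerC subrr.
have hE' : mmap (@mpolyC N K) Y h = p'.[Y ord_max].
  by rewrite muni_horner.
have := congr1 (fun P => P.[Y ord_max]) qE.
rewrite hornerD hornerN hornerC hornerM hornerXsubC -hE' p'c => E.
have -> : mmap (@mpolyC N K) Y' (spec h) =
  mmap (@mpolyC N K) Y h + (- q.[Y ord_max]) * g.
  by rewrite mulNr -E opprB addrC subrK.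
by apply: QD => //; exact: QMul.
Qed.

End Specialization.

(** Stated on the ideal alone, so that it does not depend on the choice of a generic point. *)
Definition prime_trdeg_ge (K : fieldType) N (P : set {mpoly K[N]}) (D : nat) :=
  exists Y : 'I_D -> {mpoly K[N]}, forall H, P (mmap (@mpolyC N K) Y H) -> H = 0.

Lemma pt_ker_trdeg (K L : fieldType) (iota : {rmorphism K -> L}) N (x : 'I_N -> L) D :
  prime_trdeg_ge (pt_ker iota x) D <-> trdeg_ge iota x D.
Proof.
split=> -[Y indY]; exists Y => H.
  by rewrite -mmap_subst; exact: indY.
by rewrite /pt_ker /= mmap_subst; exact: indY.
Qed.

Lemma proper_setP (T : Type) (A B : set T) :
  A `<` B <-> A `<=` B /\ exists2 x, B x & ~ A x.
Proof.
split=> [[AB nBA]|[AB [x Bx nAx]]]; split=> //; last by move/(_ _ Bx).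
by apply: contrapT => nex; apply: nBA => x Bx; apply: contrapT => nAx; apply: nex; exists x.
Qed.

Definition has_chain (T : Type) (C : set (set T)) (k : nat) :=
  exists c : nat -> set T, (forall i, (i <= k)%N -> C (c i)) /\
    (forall i, (i < k)%N -> c i `<` c i.+1).

Section PrimeDimension.
Variables (K : fieldType) (N : nat).
Hypothesis charK : [pchar K] =i pred0.
Implicit Types P : set {mpoly K[N]}.

Lemma point_char (L : fieldType) (iota : {rmorphism K -> L}) : [pchar L] =i pred0.
Proof. by move=> p; rewrite (fmorph_pchar iota) charK. Qed.

Lemma prime_trdeg_geW P D D' : prime_ideal P ->
  (D' <= D)%N -> prime_trdeg_ge P D -> prime_trdeg_ge P D'.
Proof.
move=> /prime_point[L [iota [x ->]]] le /pt_ker_trdeg h.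
by apply/pt_ker_trdeg; exact: trdeg_geW h.
Qed.

Lemma prime_trdeg_strict P P' D : prime_ideal P -> prime_ideal P' ->
  P `<` P' -> prime_trdeg_ge P' D -> prime_trdeg_ge P D.+1.
Proof.
move=> /prime_point[L [iota [x ->]]] /prime_point[L' [iota' [x' ->]]].
move=> /proper_setP[sub [a a0 a_nz]].
move=> /pt_ker_trdeg h; apply/pt_ker_trdeg; apply: (trdeg_strict sub a0 _ h).
exact/eqP.
Qed.

Lemma prime_trdeg_sub P P' D :
  P `<=` P' -> prime_trdeg_ge P' D -> prime_trdeg_ge P D.
Proof. by move=> sub [Y indY]; exists Y => H /sub/indY. Qed.

Lemma prime_trdeg_le P D : prime_ideal P -> prime_trdeg_ge P D -> (D <= N)%N.
Proof.
by move=> /prime_point[L [iota [x ->]]] /pt_ker_trdeg/trdeg_le; apply; exact: point_char.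
Qed.

(** The last clause says that the transcendence degree drops by at most one from [P] to [Q]. *)
Lemma prime_specialize P b : prime_ideal P -> ~ P b ->
  (forall D, prime_trdeg_ge P D -> D = 0%N) \/
  exists D Q, [/\ prime_ideal Q, P `<` Q, ~ Q b, prime_trdeg_ge Q D &
     ~ prime_trdeg_ge P D.+2].
Proof.
move=> /prime_point[L [iota [x ->]]] /eqP b_nz.
have [D xD maxD] := trdeg_max iota (point_char iota) x.
case: D => [|D] in xD maxD *.
  left=> D /pt_ker_trdeg xD'; apply/eqP; rewrite -leqn0 leqNgt; apply/negP => lt.
  by apply: maxD; exact: trdeg_geW xD'.
right; have [Q [primeQ sub [g Qg g_nz] Qb QD]] := trdeg_specialize charK xD maxD b_nz.
exists D, Q; split=> //; last by move/pt_ker_trdeg.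
by apply/proper_setP; split=> //; exists g => //; apply/eqP.
Qed.

Lemma prime_chain_avoiding P b D : prime_ideal P -> ~ P b -> prime_trdeg_ge P D ->
  exists c : nat -> set {mpoly K[N]}, [/\ c 0%N = P,
    forall i, (i <= D)%N -> prime_ideal (c i) /\ ~ c i b &
    forall i, (i < D)%N -> c i `<` c i.+1].
Proof.
elim: D P => [|D IHD] P primeP Pb PD; first by exists (fun=> P); split=> // i; rewrite ltn0.
have [/(_ _ PD) //|[D' [Q [primeQ PQ Qb QD' maxP]]]] := prime_specialize primeP Pb.
have le : (D <= D')%N.
  rewrite leqNgt; apply/negP => lt; apply: maxP.
  by apply: prime_trdeg_geW PD; rewrite ?ltnS.
have [c [c0 cP clt]] := IHD Q primeQ Qb (prime_trdeg_geW primeQ le QD').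
exists (fun i => if i is i'.+1 then c i' else P); split=> // [[|i]|[|i]] //.
- by rewrite ltnS => /cP.
- by rewrite c0.
- by rewrite ltnS => /clt.
Qed.

End PrimeDimension.

Section Nullstellensatz.
Variables (K : closedFieldType) (N : nat).
Hypothesis charK : [pchar K] =i pred0.

(** Specializations away from [b] lower the transcendence degree to 0; the coordinates are then
    algebraic over K, hence in K. *)
Lemma nullstellensatz (P : set {mpoly K[N]}) b : prime_ideal P -> ~ P b ->
  exists2 u : 'I_N -> K, (forall g, P g -> g.@[u] = 0) & b.@[u] != 0.
Proof.
pose bounded D := forall D', prime_trdeg_ge P D' -> (D' <= D)%N.
move=> primeP; move: {2}N (fun D => @prime_trdeg_le _ _ charK P D primeP) => d.
elim: d P {bounded} primeP => [|d IHd] P primeP Pd Pb; last first.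
  have [P0|[D' [Q [primeQ PQ Qb QD' maxP]]]] := prime_specialize charK primeP Pb.
    by apply: IHd => // D' /P0 ->.
  have [sub _] := PQ.
  have [|u uQ ub] := IHd Q primeQ _ Qb; last by exists u => // g /sub/uQ.
  by move=> D /(prime_trdeg_strict primeP primeQ PQ)/Pd.
case: (prime_point primeP) => L [iota [x PE]]; rewrite PE in Pd Pb *.
have /choice[u uE] j : exists z : K, x j = iota z.
  have : ~ alg_indep iota (ord_snoc (fun _ : 'I_0 => 0) (x j)).
    move=> ind; suff /Pd : prime_trdeg_ge (pt_ker iota x) 1 by [].
    apply/pt_ker_trdeg; exists (fun=> 'X_j); apply: eq_alg_indep ind => i.
    by rewrite mmapX mmap1U ord1 (_ : 0 = ord_max) ?ord_snoc_max //; apply: val_inj.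
  move/alg_indep_snoc/existsNP => [p /not_implyP[p0 p_nz]].
  pose q : {poly K} := map_poly (mcoeff 0%MM) p.
  have qE : map_poly iota q = map_poly (mmap iota (fun _ : 'I_0 => 0)) p.
    rewrite -map_poly_comp; apply: eq_map_poly => H /=.
    by rewrite [in RHS](nvar0_mpolyC H) mmapC.
  have q_nz : q != 0.
    apply/eqP => q0; apply: p_nz; apply/polyP => i; rewrite coef0.
    by have /polyP/(_ i) := q0; rewrite coef_map coef0 (nvar0_mpolyC p`_i) /= mpolyCK => ->.
  have [r qr] := closed_field_poly_normal q.
  have : root (map_poly iota q) (x j) by apply/eqP; rewrite qE.
  rewrite qr map_polyZ rootZ ?fmorph_eq0 ?lead_coef_eq0 // rmorph_prod /=.
  under eq_bigr => z _ do rewrite rmorphB /= map_polyX map_polyC /=.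
  rewrite -(big_map iota xpredT (fun z => 'X - z%:P)) root_prod_XsubC.
  by case/mapP => z _ ->; exists z.
have evE g : mmap iota x g = iota g.@[u].
  by rewrite /meval rmorph_mmap; apply: mmap_eq.
exists u => [g|]; first by rewrite /pt_ker /= evE => /eqP; rewrite fmorph_eq0 => /eqP.
by apply/eqP => b0; apply: Pb; rewrite /pt_ker /= evE b0 rmorph0.
Qed.

End Nullstellensatz.

(** * Dimensions as maximal lengths of chains *)

Section ChainDim.
Variables (T : Type) (C : set (set T)).

Lemma chain_dim_empty : (forall k, ~ has_chain C k) -> chain_dim C = -oo%E.
Proof.
move=> nC; rewrite /chain_dim; set A := [set _ | _ in _].
have -> : A = set0; last exact: supremum0.
by apply/seteqP; split=> // x [k /nC].
Qed.

Lemma chain_dimE d : has_chain C d -> (forall k, has_chain C k -> (k <= d)%N) ->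
  chain_dim C = (d%:Z)%:E.
Proof.
move=> Cd Cmax; rewrite /chain_dim; set A := [set _ | _ in _].
have Ad : A (d%:Z)%:E by exists d.
have Amax : supremums A (d%:Z)%:E.
  split; first by move=> _ [k /Cmax le <-]; rewrite lee_fin.
  by move=> y /(_ _ Ad).
rewrite /supremum ifF; last by apply/negbTE/set0P; exists (d%:Z)%:E.
have Ax : supremums A (xget -oo%E (supremums A)) by apply: xgetPex; exists (d%:Z)%:E.
exact: (@is_subset1_supremums _ _ A _ _ Ax Amax).
Qed.

End ChainDim.

(** The bound N guarantees that the suprema are attained. If one side has no chain then neither has
    the other, and both dimensions are -oo, which absorbs the shift. *)
Lemma chain_dim_shift (T T' : Type) (C : set (set T)) (C' : set (set T')) r N :
  (forall k, has_chain C k -> has_chain C' (k + r)) ->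
  (forall k, has_chain C' k -> exists2 k', has_chain C k' & (k <= k' + r)%N) ->
  (forall k, has_chain C' k -> (k <= N)%N) ->
  (chain_dim C = chain_dim C' - (r%:Z)%:E)%E /\
  (forall k, has_chain C k -> exists2 d, chain_dim C = (d%:Z)%:E & (k <= d)%N).
Proof.
move=> CC' C'C C'N; have [[k Ck]|nC] := pselect (exists k, has_chain C k); last first.
  split=> [|k Ck]; last by case: nC; exists k.
  have nC' j : ~ has_chain C' j.
    by move=> C'j; have [k' Ck' _] := C'C _ C'j; apply: nC; exists k'.
  by rewrite (chain_dim_empty nC') chain_dim_empty // => k Ck; apply: nC; exists k.
have ex : exists k, `[< has_chain C k >] by exists k; exact/asboolP.
have ub j : `[< has_chain C j >] -> (j <= N)%N.
  by move/asboolP/CC'/C'N; apply: leq_trans; exact: leq_addr.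
have [d /asboolP Cd dmax] := ex_maxnP ex ub.
have Cdim : chain_dim C = (d%:Z)%:E.
  by apply: chain_dimE => // j Cj; apply: dmax; exact/asboolP.
split; last by move=> j Cj; exists d => //; apply: dmax; exact/asboolP.
rewrite Cdim (@chain_dimE _ C' (d + r)); first by rewrite -EFinB PoszD addrK.
  exact: CC'.
move=> j C'j; have [j' Cj' le] := C'C _ C'j; apply: leq_trans le _; rewrite leq_add2r dmax //.
exact/asboolP.
Qed.

Section KrullDim.
Variables (K : fieldType) (N : nat).
Hypothesis charK : [pchar K] =i pred0.
Implicit Types I P : set {mpoly K[N]}.

Definition primes_over I := [set P | prime_ideal P /\ I `<=` P].

Lemma chain_trdeg c k m : (forall i, (i <= k)%N -> prime_ideal (c i)) ->
  (forall i, (i < k)%N -> c i `<` c i.+1) ->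
  prime_trdeg_ge (c k) m -> prime_trdeg_ge (c 0%N : set {mpoly K[N]}) (k + m).
Proof.
elim: k m => [//|k IHk] m cP clt ck; rewrite addSnnS; apply: IHk.
- by move=> i ile; apply: cP; exact: leqW.
- by move=> i ilt; apply: clt; exact: leqW.
by apply: prime_trdeg_strict ck; [exact: cP|exact: cP|exact: clt].
Qed.

Lemma chain_subset T (c : nat -> set T) k i : (forall i, (i < k)%N -> c i `<` c i.+1) ->
  (i <= k)%N -> c 0%N `<=` c i.
Proof.
move=> clt; elim: i => [|i IHi] ik; first by [].
have [sub _] := clt _ ik; exact: (subset_trans (IHi (ltnW ik)) sub).
Qed.

Lemma primes_over_chain I P k : I `<=` P -> prime_ideal P -> prime_trdeg_ge P k ->
  has_chain (primes_over I) k.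
Proof.
move=> IP primeP Pk; have [_ P1 _] := (prime_idealP _).1 primeP.
have [c [c0 cP clt]] := prime_chain_avoiding charK primeP P1 Pk.
exists c; split=> // i ik; split; first by case: (cP _ ik).
by apply: (subset_trans IP); rewrite -c0; exact: chain_subset clt ik.
Qed.

Lemma primes_over_chain_bound I k : has_chain (primes_over I) k -> (k <= N)%N.
Proof.
move=> [c [cP clt]]; have c0k : prime_trdeg_ge (c 0%N) (k + 0).
  apply: chain_trdeg clt _; first by move=> i /cP[].
  have [L [iota [x ->]]] := prime_point (cP k (leqnn _)).1.
  by apply/pt_ker_trdeg; exact: trdeg_ge0.
by have := prime_trdeg_le charK (cP 0%N (leq0n _)).1 c0k; rewrite addn0.
Qed.

Lemma chain_bottom_trdeg I k : has_chain (primes_over I) k ->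
  exists P, [/\ prime_ideal P, I `<=` P & prime_trdeg_ge P k].
Proof.
move=> [c [cP clt]]; exists (c 0%N).
have [primec0 Ic0] := cP _ (leq0n k); split=> //; rewrite -[k]addn0.
apply: chain_trdeg clt _; first by move=> i /cP[].
have [L [iota [x ->]]] := prime_point (cP k (leqnn _)).1.
by apply/pt_ker_trdeg; exact: trdeg_ge0.
Qed.

Lemma krull_dim_prime P D : prime_ideal P -> prime_trdeg_ge P D ->
  ~ prime_trdeg_ge P D.+1 -> krull_dim P = (D%:Z)%:E.
Proof.
move=> primeP PD maxD; apply: chain_dimE => [|k].
  exact: (primes_over_chain _ primeP).
move/chain_bottom_trdeg => [Q [primeQ PQ Qk]].
rewrite leqNgt; apply/negP => lt; apply: maxD.
by apply: prime_trdeg_sub PQ _; exact: prime_trdeg_geW Qk.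
Qed.

Lemma zero_prime : prime_ideal [set 0 : {mpoly K[N]}].
Proof.
apply/prime_idealP; split; first split=> //=.
- by move=> a b -> ->; rewrite addr0.
- by move=> r a ->; rewrite mulr0.
- by move/eqP; rewrite oner_eq0.
- by move=> a b /= /eqP; rewrite mulf_eq0 => /orP[]/eqP; [left|right].
Qed.

Lemma krull_dim0 : krull_dim [set 0 : {mpoly K[N]}] = (N%:Z)%:E.
Proof.
apply: krull_dim_prime; first exact: zero_prime.
  exists (fun i => 'X_i) => H /=; rewrite -[X in X = 0](_ : H = _) //.
  rewrite -[LHS]comp_mpoly_id; apply: mmap_eq => // i.
  by rewrite tnth_map tnth_ord_tuple.
by move/(prime_trdeg_le charK zero_prime); rewrite ltnn.
Qed.

End KrullDim.

(** * Saturations and the primes above them *)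

Section Saturation.
Variables (R : comNzRingType) (T : finType) (G : T -> R).

Lemma ideal_gen_range g : ideal_gen (range G) g ->
  exists c : T -> R, g = \sum_t c t * G t.
Proof.
pose J : set R := [set g | exists c : T -> R, g = \sum_t c t * G t].
move: g; apply: (@ideal_gen_min _ _ J); first split.
- by exists (fun=> 0); rewrite big1 // => t _; rewrite mul0r.
- move=> _ _ [c ->] [c' ->]; exists (fun t => c t + c' t).
  by rewrite -big_split; apply: eq_bigr => t _; rewrite mulrDl.
- move=> r _ [c ->]; exists (fun t => r * c t).
  by rewrite mulr_sumr; apply: eq_bigr => t _; rewrite mulrA.
move=> _ [t _ <-]; exists (fun t' => (t' == t)%:R).
rewrite (bigD1 t) //= eqxx mul1r big1 ?addr0 // => t' /negPf ->.
by rewrite mul0r.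
Qed.

(** Pigeonhole: each term of the expanded product contains k > #|T| A generators, so one of them
    occurs at least A times. *)
Lemma prod_gens_nilpotent (I : set R) A k (u : 'I_k -> R) :
  is_ideal I -> (forall t, I (G t ^+ A)) -> (#|T| * A < k)%N ->
  (forall i, ideal_gen (range G) (u i)) -> I (\prod_i u i).
Proof.
move=> idI GA kbig uG; have [I0 ID IM] := idI.
have /choice[c cE] i : exists c : T -> R, u i = \sum_t c t * G t.
  exact: ideal_gen_range.
under eq_bigr => i _ do rewrite cE.
rewrite bigA_distr_bigA /=; apply: big_ind => // f _.
rewrite big_split /=; apply: (IM).
rewrite (partition_big f xpredT) //=.
have [t tA] : exists t, (A <= #|[pred i | f i == t]|)%N.
  apply: contrapT => nex; move: kbig; rewrite ltnNge => /negP; apply.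
  have -> : k = (\sum_(t : T) #|[pred i | f i == t]|)%N.
    rewrite -[LHS]card_ord -sum1_card (partition_big f xpredT) //=.
    by apply: eq_bigr => t _; rewrite sum1_card.
  rewrite -sum_nat_const; apply: leq_sum => t _.
  by rewrite leqNgt; apply/negP => lt; apply: nex; exists t; exact: ltnW.
rewrite (bigD1 t) //= mulrC; apply: (IM).
rewrite (eq_bigr (fun=> G t)) => [|i /eqP -> //].
rewrite prodr_const -(subnK tA) exprD; exact: IM.
Qed.

(** If every prime between [I] and [q] contained all the generators, they would be nilpotent modulo
    [I] after localizing at [q]; a common denominator outside [q] would then lie in the saturation.
    Asking only for products of two elements of [J] allows [J] to be an intersection of ideals. *)
Lemma saturation_prime (I J q : set R) : is_ideal I -> prime_ideal q ->
  (forall a b, J a -> J b -> ideal_gen (range G) (a * b)) ->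
  saturation I J `<=` q ->
  exists P, [/\ prime_ideal P, I `<=` P, P `<=` q & exists t, ~ P (G t)].
Proof.
move=> idI primeq JG satq; have [[q0 qD qM] q1 qP] := (prime_idealP _).1 primeq.
have [I0 ID IM] := idI.
apply: contrapT => nex.
have /choice[a aP] t : exists a, exists2 s, ~ q s & I (G t ^+ a * s).
  apply: contrapT => nt; apply: nex.
  (* A prime disjoint from [M] is contained in [q] and does not contain [G t]. *)
  pose M := [set m | exists a, exists2 s, ~ q s & m = G t ^+ a * s].
  have M1 : M 1 by exists 0%N, 1; rewrite ?mulr1.
  have MM x y : M x -> M y -> M (x * y).
    move=> [a [s qs ->]] [b [s' qs' ->]]; exists (a + b)%N, (s * s').
      by move=> /qP[].
    by rewrite mulrACA exprD.
  have [x Ix [a [s qs xE]]|P [primeP IP PM]] := prime_avoiding idI M1 MM.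
    by apply: nt; exists a, s => //; rewrite -xE.
  exists P; split=> //; last first.
    by exists t => PG; apply: (PM _ PG); exists 1%N, 1; rewrite ?mulr1.
  move=> x Px; apply: contrapT => qx; apply: (PM _ Px).
  by exists 0%N, x; rewrite ?mul1r.
have /choice[s sP] t : exists s, ~ q s /\ I (G t ^+ a t * s).
  by have [s qs Is] := aP t; exists s.
pose S := \prod_t s t; pose A := (\sum_t a t)%N.
have qS : ~ q S.
  by apply: (big_ind (fun x => ~ q x)) => [||t _]; [exact: q1|move=> x y qx qy /qP[]|case: (sP t)].
pose I' := [set x | I (x * S)].
have idI' : is_ideal I'.
  split; rewrite /I' /=; first by rewrite mul0r.
    by move=> x y Ix Iy; rewrite mulrDl; exact: ID.
  by move=> r x Ix; rewrite -mulrA; exact: IM.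
have GA t : I' (G t ^+ A).
  have AE : A = (a t + (A - a t))%N by rewrite subnKC // /A (bigD1 t) //= leq_addr.
  have SE : S = s t * \prod_(i | i != t) s i by rewrite /S (bigD1 t).
  rewrite /I' /= AE SE exprD; set B := G t ^+ (A - a t); set C := \prod_(i | _) _.
  have -> : G t ^+ a t * B * (s t * C) = B * C * (G t ^+ a t * s t) by ring.
  by apply: (IM); case: (sP t).
(* The exponent k + k lets the factors from [J] be paired, each pair lying in the ideal of the
   generators. *)
pose k := (#|T| * A).+1.
apply: qS; apply: satq; exists (k + k)%N => // b.
move: b; apply: (@ideal_gen_min _ _ [set b | I (S * b)]).
  split; rewrite /=; first by rewrite mulr0.
    by move=> x y Ix Iy; rewrite mulrDr; exact: ID.
  by move=> r x Ix; rewrite mulrCA; exact: IM.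
move=> _ [u uJ <-]; rewrite /= mulrC.
have -> : \prod_(i < k + k) u i = \prod_(i < k) (u (lshift k i) * u (rshift k i)).
  by rewrite big_split_ord big_split.
apply: (@prod_gens_nilpotent I' A) => // i; exact: JG.
Qed.

End Saturation.

(** * Multigradings *)

Section Grading.
Variables (K : fieldType) (N r : nat) (w : 'I_N -> 'I_r).
Local Notation Q := {mpoly K[N]}.
Implicit Types (g h : Q) (d e : 'X_{1..r}).

Definition wdeg (m : 'X_{1..N}) : 'X_{1..r} :=
  [multinom (\sum_(j | w j == i) m j)%N | i < r].

(* [torus g] is g(t z), with z_j multiplied by the variable t_(w j). *)
Definition torus : {rmorphism Q -> {mpoly Q[r]}} :=
  mmap (@mpolyC r Q \o @mpolyC N K) (fun j => ('X_j)%:MP * 'X_(w j)).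

Lemma torusC c : torus c%:MP = c%:MP%:MP.
Proof. by rewrite /torus /= mmapC. Qed.

Lemma torusX j : torus 'X_j = ('X_j)%:MP * 'X_(w j).
Proof. by rewrite /torus /= mmapX mmap1U. Qed.

Definition component d g : Q := (torus g)@_d.

Definition multihom_deg d g := torus g = g%:MP * 'X_[d].
Definition multihom g := exists d, multihom_deg d g.

Lemma wdeg_prod (m : 'X_{1..N}) :
  \prod_(j < N) ('X_(w j) : {mpoly Q[r]}) ^+ m j = 'X_[wdeg m].
Proof.
rewrite (eq_bigr (fun j => 'X_[U_(w j) *+ m j])) => [|j _]; last by rewrite mpolyXn.
rewrite -(big_morph _ (@mpolyXD _ _) (mpolyX0 _ _)); congr 'X_[_].
apply/mnmP => i; rewrite mnm_sumE mnmE [RHS]big_mkcond /=.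
by apply: eq_bigr => j _; rewrite mulmnE mnm1E; case: eqP; rewrite ?mul1n ?mul0n.
Qed.

Lemma torusE g :
  torus g = \sum_(m <- msupp g) (g@_m *: 'X_[m])%:MP * 'X_[wdeg m].
Proof.
rewrite /torus /= /mmap; apply: eq_bigr => m _.
rewrite /= -mul_mpolyC rmorphM /= -mulrA; congr (_ * _).
rewrite /mmap1; under eq_bigr => j _ do rewrite exprMn.
rewrite big_split /= wdeg_prod; congr (_ * _).
by rewrite [in RHS]mpolyXE_id rmorph_prod; apply: eq_bigr => j _; rewrite rmorphXn.
Qed.

Lemma coef_component d g m : (component d g)@_m = g@_m * (wdeg m == d)%:R.
Proof.
rewrite /component torusE raddf_sum /= raddf_sum /=.
under eq_bigr => m' _ do rewrite mul_mpolyC mcoeffZ mcoeffX mulr_natr mcoeffMn mcoeffZ mcoeffX.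
have [msg|msg] := boolP (m \in msupp g).
  rewrite (bigD1_seq m) ?msupp_uniq //= big1 ?addr0 => [|m' /negPf ->].
    by rewrite eqxx mulr1 mulr_natr.
  by rewrite mulr0 mul0rn.
rewrite (memN_msupp_eq0 msg) mul0r big_seq big1 // => m' m'g.
have /negPf -> : m' != m by apply: contraNneq msg => <-.
by rewrite mulr0 mul0rn.
Qed.

Lemma multihom_degP d g :
  multihom_deg d g <-> forall m, m \in msupp g -> wdeg m = d.
Proof.
split=> [gd m msg|gd].
  apply/eqP; apply: contraT => /negPf ne; have := coef_component d g m.
  rewrite /component gd mul_mpolyC mcoeffZ mcoeffX eqxx mulr1 ne mulr0 => E.
  by move: msg; rewrite mcoeff_msupp E eqxx.
apply/mpolyP => e; rewrite mul_mpolyC mcoeffZ mcoeffX; apply/mpolyP => m.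
rewrite -/(component e g) coef_component [in RHS]mulr_natr mcoeffMn.
have [/gd -> | /memN_msupp_eq0 ->] := boolP (m \in msupp g).
  by rewrite mulr_natr.
by rewrite mul0r mul0rn.
Qed.

Lemma component_multihom d g : multihom_deg d (component d g).
Proof.
apply/multihom_degP => m; rewrite mcoeff_msupp coef_component.
by case: (eqVneq (wdeg m) d) => // _; rewrite mulr0 eqxx.
Qed.

Lemma multihom_component d e g :
  multihom_deg d g -> component e g = if d == e then g else 0.
Proof.
move=> gd; rewrite /component gd mul_mpolyC mcoeffZ mcoeffX.
by case: eqP; rewrite ?mulr1 ?mulr0.
Qed.

Lemma multihomM d e g h :
  multihom_deg d g -> multihom_deg e h -> multihom_deg (d + e)%MM (g * h).
Proof.
move=> gd he; rewrite /multihom_deg rmorphM gd he mpolyXD rmorphM /=; ring.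
Qed.

Lemma multihom_sum (T : eqType) (s : seq T) d (F : T -> Q) :
  (forall i, i \in s -> multihom_deg d (F i)) -> multihom_deg d (\sum_(i <- s) F i).
Proof.
move=> Fd; rewrite /multihom_deg !rmorph_sum mulr_suml /= big_seq [RHS]big_seq.
by apply: eq_bigr => i /Fd.
Qed.

Lemma multihomXn j k : multihom_deg (U_(w j) *+ k)%MM ('X_j ^+ k).
Proof. by rewrite /multihom_deg rmorphXn /= torusX exprMn rmorphXn /= mpolyXn. Qed.

Lemma multihomC c : multihom_deg 0%MM c%:MP.
Proof. by rewrite /multihom_deg torusC mpolyX0 mulr1. Qed.

Lemma multihom_prodX (jj : 'I_r -> 'I_N) e : (forall i, w (jj i) = i) ->
  multihom_deg e (\prod_i 'X_(jj i) ^+ e i).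
Proof.
move=> wj; rewrite {1}(multinomUE_id e).
apply: (big_rec2 (fun d g => multihom_deg d g)); first by rewrite -mpolyC1; exact: multihomC.
move=> i d g _ gd; apply: multihomM gd.
by rewrite -{1}(wj i); exact: multihomXn.
Qed.

Lemma sum_component g : g = \sum_(e <- msupp (torus g)) component e g.
Proof.
apply/mpolyP => m; rewrite raddf_sum /=.
under eq_bigr => e _ do rewrite coef_component.
have [msg|msg] := boolP (m \in msupp g); last first.
  by rewrite (memN_msupp_eq0 msg) big1 // => e _; rewrite mul0r.
have cm : (component (wdeg m) g)@_m != 0.
  by rewrite coef_component eqxx mulr1 -mcoeff_msupp.
have ms : wdeg m \in msupp (torus g).
  by rewrite mcoeff_msupp; apply: contraNneq cm => E; rewrite /component E mcoeff0.
rewrite (bigD1_seq (wdeg m)) ?msupp_uniq //= eqxx mulr1 big1 ?addr0 //.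
by move=> e; rewrite eq_sym => /negPf ->; rewrite mulr0.
Qed.

Lemma multihom_scale (L : comNzRingType) (iota : {rmorphism K -> L})
    (x : 'I_N -> L) d g (s : 'I_r -> L) : multihom_deg d g ->
  mmap iota (fun j => x j * s (w j)) g = mmap iota x g * \prod_i s i ^+ d i.
Proof.
pose ev : {rmorphism {mpoly L[r]} -> L} := meval s.
pose phi : {rmorphism Q -> L} := ev \o (map_mpoly (mmap iota x) \o torus).
have E : phi =1 mmap iota (fun j => x j * s (w j)).
  apply: rmorph_mpolyE => [c|j].
    by rewrite /phi /ev /= torusC map_mpolyC /= mmapC mevalC.
  rewrite /phi /ev /= torusX rmorphM /= map_mpolyC map_mpolyX /= mmapX mmap1U.
  by rewrite mevalM mevalC mevalXU.
move=> gd; rewrite -E /phi /ev /= gd rmorphM /= map_mpolyC map_mpolyX mevalM mevalC.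
by rewrite mevalX.
Qed.

Section TorusPoint.
Variables (L : fieldType) (iota : {rmorphism K -> L}) (x : 'I_N -> L).

Definition gen_iota : {rmorphism K -> {fraction {mpoly L[r]}}} :=
  (@tofrac {mpoly L[r]}) \o (@mpolyC r L \o iota).
Definition gen_point (j : 'I_N) : {fraction {mpoly L[r]}} :=
  @tofrac {mpoly L[r]} ((x j)%:MP * 'X_(w j)).

Lemma gen_pointE g :
  mmap gen_iota gen_point g = tofrac (map_mpoly (mmap iota x) (torus g)).
Proof.
pose phi : {rmorphism Q -> {fraction {mpoly L[r]}}} :=
  (@tofrac {mpoly L[r]}) \o (map_mpoly (mmap iota x) \o torus).
apply/esym; rewrite -[LHS]/(phi g); apply: rmorph_mpolyE => [c|j].
  by rewrite /phi /= torusC map_mpolyC /= mmapC.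
by rewrite /phi /= torusX rmorphM /= map_mpolyC map_mpolyX /= mmapX mmap1U.
Qed.

(** Each component is multiplied by its own monomial in the torus variables, so components cannot
    cancel one another. *)
Lemma gen_point_ker g :
  pt_ker gen_iota gen_point g <-> forall d, mmap iota x (component d g) = 0.
Proof.
rewrite /pt_ker /= gen_pointE; split=> [/eqP|g0].
  rewrite tofrac_eq0 => /eqP E d; have := congr1 (mcoeff d) E.
  by rewrite mcoeff_map_mpoly mcoeff0.
apply/eqP; rewrite tofrac_eq0; apply/eqP/mpolyP => d.
by rewrite mcoeff_map_mpoly mcoeff0 -[RHS](g0 d).
Qed.

Lemma gen_point_sub g : pt_ker gen_iota gen_point g -> mmap iota x g = 0.
Proof.
move/gen_point_ker => g0; rewrite (sum_component g) rmorph_sum big1 // => d _.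
exact: g0.
Qed.

Lemma multihom_gen_point g : multihom g ->
  (mmap iota x g = 0 <-> pt_ker gen_iota gen_point g).
Proof.
move=> [d gd]; split=> [g0|]; last exact: gen_point_sub.
apply/gen_point_ker => e; rewrite (multihom_component e gd).
by case: eqP => _ //; rewrite rmorph0.
Qed.

End TorusPoint.

Definition graded_core (P : set Q) := [set g | forall d, P (component d g)].

(** The core of the kernel of evaluation at x is the kernel of evaluation at t.x, hence prime. *)
Lemma graded_core_prime P : prime_ideal P -> prime_ideal (graded_core P).
Proof.
move=> /prime_point[L [iota [x ->]]].
have -> : graded_core (pt_ker iota x) = pt_ker (gen_iota iota) (gen_point x).
  by apply/seteqP; split=> g /gen_point_ker.
exact: pt_ker_prime.
Qed.

Lemma graded_core_sub P : prime_ideal P -> graded_core P `<=` P.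
Proof.
move=> /prime_point[L [iota [x ->]]] g /gen_point_ker; exact: gen_point_sub.
Qed.

Lemma graded_core_component P d g :
  prime_ideal P -> graded_core P g -> graded_core P (component d g).
Proof.
move=> /prime_idealP[[P0 _ _] _ _] Pg e.
rewrite (multihom_component e (component_multihom d g)).
by case: eqP.
Qed.

End Grading.

(** * Dimension of a quotient of multiprojective points *)

Section Swap.
Variables (K : fieldType) (N r : nat) (w : 'I_N -> 'I_r).
Variables (sigma : 'I_N -> 'I_N) (tau : 'I_r -> 'I_r).
Hypothesis sigmaK : involutive sigma.
Hypothesis sigma_w : forall j, w (sigma j) = tau (w j).
Local Notation Q := {mpoly K[N]}.
Implicit Types g h : Q.

Definition swap : {rmorphism Q -> Q} := mmap (@mpolyC N K) (fun j => 'X_(sigma j)).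

Lemma swapC c : swap c%:MP = c%:MP. Proof. by rewrite /swap /= mmapC. Qed.
Lemma swapX j : swap 'X_j = 'X_(sigma j).
Proof. by rewrite /swap /= mmapX mmap1U. Qed.

Lemma swapK : involutive swap.
Proof.
move=> g; pose phi : {rmorphism Q -> Q} := swap \o swap.
rewrite -[LHS]/(phi g) -[RHS]comp_mpoly_id.
apply: rmorph_mpolyE => [c|j]; rewrite /phi /= ?swapC // !swapX sigmaK.
by rewrite tnth_map tnth_ord_tuple.
Qed.

Lemma mmap_swap (L : fieldType) (iota : {rmorphism K -> L}) x g :
  mmap iota x (swap g) = mmap iota (x \o sigma) g.
Proof.
rewrite /swap /= mmap_subst; apply: mmap_eq => // j.
by rewrite /= mmapX mmap1U.
Qed.

Lemma multihom_swap g : multihom w g -> multihom w (swap g).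
Proof.
move=> [d gd].
pose rho : {rmorphism {mpoly Q[r]} -> {mpoly Q[r]}} :=
  mmap (@mpolyC r Q \o swap) (fun i => 'X_(tau i)).
have E : torus K w (swap g) = rho (torus K w g).
  pose phi : {rmorphism Q -> {mpoly Q[r]}} := torus K w \o swap.
  pose psi : {rmorphism Q -> {mpoly Q[r]}} := rho \o torus K w.
  pose f : {rmorphism K -> {mpoly Q[r]}} := @mpolyC r Q \o @mpolyC N K.
  rewrite -[LHS]/(phi g) -[RHS]/(psi g).
  rewrite (@rmorph_mpolyE _ _ _ psi f (fun j => ('X_(sigma j))%:MP * 'X_(w (sigma j)))).
  - apply: rmorph_mpolyE => [c|j]; rewrite /phi /=.
      by rewrite swapC torusC.
    by rewrite swapX torusX.
  - by move=> c; rewrite /psi /rho /= torusC mmapC /= swapC.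
  move=> j; rewrite /psi /rho /= torusX rmorphM /= mmapC /=.
  by rewrite !mmapX !mmap1U sigma_w.
exists (\sum_(i < r) (U_(tau i) *+ d i))%MM.
rewrite /multihom_deg E gd rmorphM /rho /= mmapC mmapX; congr (_ * _).
rewrite /mmap1 (big_morph _ (@mpolyXD _ _) (mpolyX0 _ _)).
by apply: eq_bigr => i _; rewrite mpolyXn.
Qed.

Lemma multihomMM g h : multihom w g -> multihom w h -> multihom w (g * h).
Proof. by move=> [d gd] [e he]; exists (d + e)%MM; exact: multihomM. Qed.

End Swap.

Section QuotientDimension.
Variable K : closedFieldType.
Hypothesis charK : [pchar K] =i pred0.
Variables (N r : nat) (w : 'I_N -> 'I_r).
Variables (sigma : 'I_N -> 'I_N) (tau : 'I_r -> 'I_r).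
Hypothesis sigmaK : involutive sigma.
Hypothesis sigma_w : forall j, w (sigma j) = tau (w j).
Local Notation Q := {mpoly K[N]}.
Local Notation multihom := (@multihom K N r w).
Local Notation swap := (swap K sigma).

Variables (I0 B : set Q).

(** The field L is arbitrary so that this applies both to K-points and to generic points of
    primes. *)
Definition good (L : fieldType) (iota : {rmorphism K -> L}) (x : 'I_N -> L) :=
  (forall g, I0 g -> mmap iota x g = 0) /\ exists2 b, B b & mmap iota x b != 0.

Hypothesis good_scale : forall (L : fieldType) (iota : {rmorphism K -> L}) x
  (s : 'I_r -> L), (forall i, s i != 0) -> good iota x ->
  good iota (fun j => x j * s (w j)).
Hypothesis good_nz : forall (L : fieldType) (iota : {rmorphism K -> L}) x,
  good iota x -> forall i, exists2 j, w j = i & x j != 0.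

(* A point of Y has homogeneous coordinates [u] (relation [rep]), unique up to
   scaling each block and up to the permutation [sigma] of the blocks; the points
   of Y are the zeros of I0 off the zeros of B. *)
Variables (T : Type) (closed : set (set T)) (Y : set T).
Variable rep : T -> ('I_N -> K) -> Prop.
Let Kid : {rmorphism K -> K} := idfun.
Hypothesis rep_ex : forall t, Y t -> exists u, rep t u.
Hypothesis rep_good : forall t u, Y t -> rep t u -> good Kid u.
Hypothesis good_rep : forall u, good Kid u -> exists2 t, Y t & rep t u.
Hypothesis rep_orbit : forall t u u', Y t -> rep t u -> rep t u' ->
  exists (s : 'I_r -> K) (v : 'I_N -> K), [/\ forall i, s i != 0,
    v = u \/ v = u \o sigma & u' =1 (fun j => v j * s (w j))].
Hypothesis rep_swap : forall t u, rep t u -> rep t (u \o sigma).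
Hypothesis closed_eqs : forall C, closed C -> exists2 F, F `<=` multihom &
  forall t, Y t -> (C t <-> forall g u, F g -> rep t u -> g.@[u] = 0).
Hypothesis eqs_closed : forall F, F `<=` multihom -> (forall g, F g -> F (swap g)) ->
  exists2 C, closed C &
  forall t, Y t -> (C t <-> forall g u, F g -> rep t u -> g.@[u] = 0).

Definition pieces : set (set T) :=
  [set Z | irreducible closed Z /\ exists2 C, closed C & Z = Y `&` C].

Lemma meval_swap (u : 'I_N -> K) g : (swap g).@[u] = g.@[u \o sigma].
Proof. exact: (mmap_swap sigma Kid). Qed.

Lemma closed_eqs_swap C : closed C -> exists F, [/\ F `<=` multihom,
  forall g, F g -> F (swap g) &
  forall t, Y t -> (C t <-> forall g u, F g -> rep t u -> g.@[u] = 0)].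
Proof.
move=> /closed_eqs[F Fhom FC]; exists [set g | F g \/ F (swap g)]; split.
- by move=> g [/Fhom //|/Fhom/(multihom_swap sigma_w)]; rewrite swapK.
- by move=> g [Fg|Fg]; [right|left]; rewrite ?swapK.
move=> t Yt; rewrite FC //; split=> [h g u [Fg|Fg] tu|h g u Fg]; last by apply: h; left.
  exact: h tu.
by rewrite -[g](swapK sigmaK) meval_swap; apply: h => //; exact: rep_swap.
Qed.

Lemma multihom_eval_orbit t u u' g : Y t -> rep t u -> rep t u' -> multihom g ->
  g.@[u] = 0 -> (swap g).@[u] = 0 -> g.@[u'] = 0.
Proof.
move=> Yt tu tu' [d gd] g0 sg0; have [s [v [s_nz vE u'E]]] := rep_orbit Yt tu tu'.
rewrite (meval_eq g u'E) /meval (multihom_scale Kid v s gd).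
have -> : mmap Kid v g = 0; last by rewrite mul0r.
by case: vE => ->; rewrite // -[LHS]meval_swap.
Qed.

(* Polynomials all of whose homogeneous components vanish on Z. *)
Definition vanish (Z : set T) : set Q :=
  [set g | forall t u d, Z t -> rep t u -> (component w d g).@[u] = 0].

Lemma vanishP Z g : vanish Z g <-> forall t u, Z t -> rep t u ->
  pt_ker (gen_iota r Kid) (gen_point w u) g.
Proof.
split=> [vg t u Zt tu|vg t u d Zt tu].
  by apply/gen_point_ker => d; exact: vg tu.
by have /gen_point_ker := vg t u Zt tu; apply.
Qed.

Lemma vanish_ideal Z : is_ideal (vanish Z).
Proof.
have idk u := (prime_idealP _).1 (pt_ker_prime (gen_iota r Kid) (gen_point w u)).
split.
- by apply/vanishP => t u _ _; case: (idk u) => -[].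
- move=> a b /vanishP va /vanishP vb; apply/vanishP => t u Zt tu.
  case: (idk u) => -[_ + _] _ _; apply; [exact: va tu|exact: vb tu].
- move=> c a /vanishP va; apply/vanishP => t u Zt tu.
  by case: (idk u) => -[_ _ +] _ _; apply; exact: va tu.
Qed.

Lemma vanish_multihom Z g : multihom g ->
  (vanish Z g <-> forall t u, Z t -> rep t u -> g.@[u] = 0).
Proof.
move=> hg; split=> [/vanishP vg t u Zt tu|vg].
  by apply/(multihom_gen_point Kid u hg); exact: vg tu.
by apply/vanishP => t u Zt tu; apply/(multihom_gen_point Kid u hg); exact: vg tu.
Qed.

Lemma component_hom d g : multihom (component w d g).
Proof. by exists d; exact: component_multihom. Qed.

Lemma gen_ker_swap u g : pt_ker (gen_iota r Kid) (gen_point w u) (swap g) ->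
  pt_ker (gen_iota r Kid) (gen_point w (u \o sigma)) g.
Proof.
suff H v h : pt_ker (gen_iota r Kid) (gen_point w v) h ->
    pt_ker (gen_iota r Kid) (gen_point w (v \o sigma)) (swap h).
  by move/H; rewrite swapK.
move/gen_point_ker => h0; rewrite (sum_component w h) rmorph_sum.
have [[K0 KD _] _ _] := (prime_idealP _).1
  (pt_ker_prime (gen_iota r Kid) (gen_point w (v \o sigma))).
apply: big_ind => // d _.
apply: ((multihom_gen_point Kid (v \o sigma)
  (multihom_swap sigma_w (component_hom d h))).1 _).
rewrite mmap_swap -[RHS](h0 d); apply: mmap_eq => // j /=.
by rewrite sigmaK.
Qed.

Lemma vanish_swap Z g : vanish Z g -> vanish Z (swap g).
Proof.
move=> /vanishP vg; apply/vanishP => t u Zt tu.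
rewrite (_ : u = (u \o sigma) \o sigma); last first.
  by apply/funext => j; rewrite /= sigmaK.
by apply: gen_ker_swap; rewrite swapK //; apply: vg Zt _; exact: rep_swap.
Qed.

(* The zero set of P maps onto Z: points of Z are zeros of P up to the swap. *)
Definition lift_of (Z : set T) (P : set Q) :=
  [/\ prime_ideal P, forall d g, P g -> P (component w d g), vanish Z `<=` P &
      forall g, P g -> P (swap g) -> vanish Z g].

(** A maximal ideal [J] is taken among those where x and swap x both lie in [J] only if x vanishes
    on Z. If a and b violate primality, maximality yields x in J + (a) and y in J + (b), each with
    its swap and not vanishing on Z; irreducibility gives a point where neither vanishes, up to
    swap, while their product must vanish on Z. *)
Lemma lift_exists Z : pieces Z -> exists P, lift_of Z P.
Proof.
move=> [[[t0 Zt0] irrZ] [C _ ZE]].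
have ZY t : Z t -> Y t by rewrite ZE => -[].
have idZ := vanish_ideal Z.
have [J [idJ ZJ JZ Jmax]] := @ideal_maximal _ swap (vanish Z) (vanish Z) idZ
  (fun x vx _ => vx).
have primeJ : prime_ideal J.
  apply/prime_idealP; split=> //.
    move=> J1; have [u tu] := rep_ex (ZY _ Zt0).
    have /vanishP/(_ t0 u Zt0 tu)/gen_point_sub : vanish Z 1.
      by apply: JZ => //; rewrite rmorph1.
    by rewrite rmorph1 => /eqP; rewrite oner_eq0.
  move=> a b Jab; apply: contrapT => /not_orP[Ja Jb].
  have wit c : ~ J c -> exists x, [/\ adjoin J c x, adjoin J c (swap x) & ~ vanish Z x].
    move=> Jc; apply: Jmax; [exact: adjoin_ideal|exact: sub_adjoin|].
    by move=> sub; apply: Jc; apply: sub; exact: adjoin_mem.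
  have [x [Jx Jsx vx]] := wit a Ja; have [y [Jy Jsy vy]] := wit b Jb.
  (* Closed sets of unordered points need homogeneous equations stable under the swap. *)
  pose F (z : Q) := [set h | exists e, h = component w e z \/ h = swap (component w e z)].
  have Fhom z : F z `<=` multihom.
    move=> h [e [->|->]]; first exact: component_hom.
    by apply: (multihom_swap sigma_w); exact: component_hom.
  have Fswap z h : F z h -> F z (swap h).
    by move=> [e [->|->]]; exists e; [right|left]; rewrite ?swapK.
  have [A clA AE] := eqs_closed (@Fhom x) (@Fswap x).
  have [A' clA' A'E] := eqs_closed (@Fhom y) (@Fswap y).
  have nsub z D : ~ vanish Z z ->
      (forall t, Y t -> (D t <-> forall g u, F z g -> rep t u -> g.@[u] = 0)) ->
      ~ Z `<=` D.
    move=> vz DE ZD; apply: vz => t u e Zt tu.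
    by apply: ((DE t (ZY t Zt)).1 (ZD t Zt) _ u _ tu); exists e; left.
  have : ~ Z `<=` A `|` A'.
    move=> ZAA'; have [] := irrZ _ _ clA clA' ZAA'.
      exact: (nsub x A vx AE).
    exact: (nsub y A' vy A'E).
  move/existsNP => [t /not_implyP[Zt /not_orP[At A't]]].
  have [u tu] := rep_ex (ZY t Zt).
  have pick z D : (forall t, Y t -> (D t <-> forall g u, F z g -> rep t u -> g.@[u] = 0)) ->
      ~ D t -> ~ pt_ker (gen_iota r Kid) (gen_point w u) z \/
               ~ pt_ker (gen_iota r Kid) (gen_point w u) (swap z).
    move=> DE Dt; apply: contrapT => /not_orP[/contrapT kz /contrapT ksz].
    apply: Dt; apply/(DE t (ZY t Zt)) => g u' Fg tu'.
    have ksz' := gen_ker_swap ksz.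
    have comp0 e : (component w e z).@[u] = 0 by have /gen_point_ker := kz; apply.
    have comp1 e : (component w e z).@[u \o sigma] = 0.
      by have /gen_point_ker := ksz'; apply.
    apply: (multihom_eval_orbit (ZY t Zt) tu tu' (Fhom _ _ Fg)).
      by case: Fg => e [->|->]; rewrite ?meval_swap.
    by case: Fg => e [->|->]; rewrite ?swapK // meval_swap.
  have [_ _ kP] := (prime_idealP _).1 (pt_ker_prime (gen_iota r Kid) (gen_point w u)).
  (* Replacing x by its swap if necessary makes it nonzero at t.u for the chosen representative [u];
     the same is done for y. *)
  have [x' [Jx' Jsx' kx']] : exists x', [/\ adjoin J a x', adjoin J a (swap x') &
      ~ pt_ker (gen_iota r Kid) (gen_point w u) x'].
    have [k|k] := pick x A AE At; first by exists x.
    by exists (swap x); rewrite swapK.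
  have [y' [Jy' Jsy' ky']] : exists y', [/\ adjoin J b y', adjoin J b (swap y') &
      ~ pt_ker (gen_iota r Kid) (gen_point w u) y'].
    have [k|k] := pick y A' A'E A't; first by exists y.
    by exists (swap y); rewrite swapK.
  have : vanish Z (x' * y').
    by apply: JZ; rewrite ?rmorphM; apply: adjoinM Jab _ _.
  by move/vanishP => /(_ t u Zt tu)/kP[].
exists (graded_core w J); split.
- exact: graded_core_prime.
- by move=> d g; exact: graded_core_component.
- move=> g vg d; apply: ZJ; apply/(vanish_multihom Z (component_hom d g)).
  by move=> t u Zt tu; exact: vg tu.
move=> g Jg Jsg; apply: JZ; exact: (graded_core_sub primeJ).
Qed.

Lemma lift_swap Z P : lift_of Z P ->
  exists P', lift_of Z P' /\ forall g, P' g -> P (swap g).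
Proof.
move=> [primeP Pcomp ZP PZ]; have [[P0 PD PM] P1 PP] := (prime_idealP _).1 primeP.
have primeS : prime_ideal [set g | P (swap g)].
  apply/prime_idealP; split=> /=; first split => /=.
  + by rewrite rmorph0.
  + by move=> a b Pa Pb; rewrite rmorphD; exact: PD.
  + by move=> c a Pa; rewrite rmorphM; exact: PM.
  + by rewrite rmorph1.
  + by move=> a b; rewrite rmorphM => /PP.
have sub g : graded_core w [set g | P (swap g)] g -> P (swap g).
  by move/(graded_core_sub primeS).
exists (graded_core w [set g | P (swap g)]); split; last exact: sub.
split.
- exact: graded_core_prime.
- by move=> d g; exact: graded_core_component.
- move=> g vg d; apply: ZP; apply: vanish_swap.
  apply/(vanish_multihom Z (component_hom d g)).
  by move=> t u Zt tu; exact: vg tu.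
by move=> g /sub Psg /sub; rewrite swapK // => Pg; exact: PZ.
Qed.

(** [I0] need not consist of homogeneous polynomials: invariance of [good] under generic scalars
    makes every component vanish. *)
Lemma vanish_I0 Z : Z `<=` Y -> I0 `<=` vanish Z.
Proof.
move=> ZY g I0g; apply/vanishP => t u Zt tu.
have gu := rep_good (ZY _ Zt) tu.
pose x j : {fraction {mpoly K[r]}} := gen_iota r Kid (u j).
have evE h : mmap (gen_iota r Kid) x h = gen_iota r Kid h.@[u].
  by rewrite /meval rmorph_mmap; apply: mmap_eq.
have gx : good (gen_iota r Kid) x.
  case: gu => gI0 [b Bb b_nz]; split=> [h I0h|].
    by rewrite evE -[h.@[u]]/(mmap Kid u h) gI0 // rmorph0.
  by exists b => //; rewrite evE fmorph_eq0.
have [|+ _] := good_scale (s := fun i => @tofrac {mpoly K[r]} 'X_i) _ gx.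
  by move=> i; rewrite tofrac_eq0 -msize_poly_eq0 msizeX.
move=> /(_ g I0g) E; rewrite /pt_ker /= -[RHS]E; apply: mmap_eq => // j.
by rewrite /gen_point /x /gen_iota /= rmorphM.
Qed.

Lemma piece_sub Z : pieces Z -> Z `<=` Y.
Proof. by move=> [_ [C _ ->]] t []. Qed.

(** One variable outside P is chosen in each block. Distinct monomials in these have distinct
    multidegrees, so, P being multigraded, a relation splits into single terms. *)
Lemma lift_good_trdeg Z P : pieces Z -> lift_of Z P -> (exists2 b, B b & ~ P b) ->
  prime_trdeg_ge P r.
Proof.
move=> pZ [primeP Pcomp ZP PZ] [b Bb Pb].
have [[P0 PD PM] P1 PP] := (prime_idealP _).1 primeP.
have /choice[j jP] i : exists j, w j = i /\ ~ P 'X_j.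
  case: (prime_point primeP) => L [iota [x PE]].
  have gx : good iota x.
    split=> [g I0g|]; last by exists b => //; apply/eqP => b0; apply: Pb; rewrite PE.
    by have := ZP _ (vanish_I0 (piece_sub pZ) I0g); rewrite PE.
  have [j wj xj] := good_nz gx i; exists j; split=> //.
  by rewrite PE /pt_ker /= mmapX mmap1U; apply/eqP.
exists (fun i => 'X_(j i)) => H PH; apply/mpolyP => e; rewrite mcoeff0.
pose X e : Q := \prod_i 'X_(j i) ^+ e i.
have comp : component w e (mmap (@mpolyC N K) (fun i => 'X_(j i)) H) = (H@_e)%:MP * X e.
  have -> : mmap (@mpolyC N K) (fun i => 'X_(j i)) H =
            \sum_(m <- msupp H) (H@_m)%:MP * X m by [].
  have XE m : multihom_deg w m (X m) by apply: multihom_prodX => i; case: (jP i).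
  rewrite /component rmorph_sum raddf_sum /=.
  have cE m : component w e ((H@_m)%:MP * X m) =
              if m == e then (H@_m)%:MP * X m else 0.
    apply: multihom_component; rewrite -[m in multihom_deg _ m]add0m.
    by apply: multihomM; [exact: multihomC|exact: XE].
  under eq_bigr => m _ do rewrite -/(component w e _) cE.
  have [me|me] := boolP (e \in msupp H).
    rewrite (bigD1_seq e) ?msupp_uniq //= eqxx big1 ?addr0 //.
    by move=> m /negPf ->.
  rewrite (memN_msupp_eq0 me) mpolyC0 mul0r big_seq big1 // => m mH.
  by have /negPf -> : m != e by apply: contraNneq me => <-.
have := Pcomp e _ PH; rewrite comp => /PP[PHe|PX].
  apply/eqP; apply: contrapT => /negP He; apply: P1.
  have -> : 1 = (H@_e)^-1%:MP * (H@_e)%:MP :> Q by rewrite -mpolyCM mulVf // mpolyC1.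
  exact: PM.
suff : ~ P (X e) by [].
rewrite /X; apply: (big_ind (fun g => ~ P g)) => //; first by move=> a c Pa Pc /PP[].
move=> i _; elim: (e i) => [|k IHk]; first by rewrite expr0.
by rewrite exprS => /PP[]; first exact: (jP i).2.
Qed.

(** If one lift contained [b] and the swapped lift did too, [b] would vanish on all of Z. *)
Lemma lift_bottom Z : pieces Z ->
  exists P, lift_of Z P /\ exists2 b, B b & ~ P b.
Proof.
move=> pZ; have [P LP] := lift_exists pZ; have [[[t0 Zt0] _] _] := pZ.
have Yt0 := piece_sub pZ Zt0; have [u tu] := rep_ex Yt0.
have [_ [b Bb b_nz]] := rep_good Yt0 tu.
have nb : ~ vanish Z b.
  move/vanishP => /(_ t0 u Zt0 tu)/gen_point_sub b0.
  by move/eqP: b_nz; apply.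
have [Pb|Pb] := pselect (P b); last by exists P; split=> //; exists b.
have [P' [LP' P'P]] := lift_swap LP; exists P'; split=> //; exists b => // P'b.
by apply: nb; case: LP => _ _ _; apply=> //; exact: P'P.
Qed.

(** Makes the choices compatible: a product of an element of a lift of Z' with one of the swapped
    lift vanishes on Z', hence lies in P, and P being prime contains one of the two lifts. *)
Lemma lift_below Z Z' P : pieces Z -> pieces Z' -> Z `<` Z' -> lift_of Z P ->
  exists P', lift_of Z' P' /\ P' `<` P.
Proof.
move=> pZ pZ' /proper_setP[ZZ' [t Z't nZt]] LP.
have strict Q' : lift_of Z' Q' -> Q' `<=` P -> Q' `<` P.
  move=> [_ _ _ Q'Z'] Q'P; apply/proper_setP; split=> //.
  apply: contrapT => nex.
  have PQ' g : P g -> Q' g by move=> Pg; apply: contrapT => nQ'; apply: nex; exists g.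
  have Yt := piece_sub pZ' Z't; have [_ [C clC ZE]] := pZ.
  have [F [Fhom Fswap FC]] := closed_eqs_swap clC.
  apply: nZt; rewrite ZE; split=> //; apply/FC => // g u Fg tu.
  have vF h : F h -> vanish Z h.
    move=> Fh; apply/(vanish_multihom Z (Fhom _ Fh)) => t' u' Zt' t'u'.
    have [_ Ct'] : (Y `&` C) t' by rewrite -ZE.
    by apply: ((FC t' (piece_sub pZ Zt')).1 Ct' h u').
  have [_ _ ZP _] := LP.
  have /(vanish_multihom Z' (Fhom _ Fg)) : vanish Z' g; last by move=> h; exact: (h t u Z't tu).
  by apply: Q'Z'; apply: PQ'; apply: ZP; apply: vF => //; exact: Fswap.
have [Q' LQ'] := lift_exists pZ'; have [Q'' [LQ'' Q''Q']] := lift_swap LQ'.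
have [sub|nsub] := pselect (Q' `<=` P); first by exists Q'; split=> //; exact: strict.
exists Q''; split=> //; apply: strict => //.
move/existsNP: nsub => [a /not_implyP[Q'a Pa]] a' Q''a'.
have [primeP _ ZP _] := LP; have [_ _ PP] := (prime_idealP _).1 primeP.
have [primeQ' _ _ Q'Z'] := LQ'; have [[_ _ QM] _ _] := (prime_idealP _).1 primeQ'.
have : P (a * a').
  apply: ZP; have : vanish Z' (a * a').
    apply: Q'Z'; first by rewrite mulrC; exact: QM.
    by rewrite rmorphM; apply: QM; exact: Q''Q'.
  by move=> v t' u d Zt'; apply: v; exact: ZZ'.
by case/PP.
Qed.

(** The summand [r] is already present for the smallest piece; each strict inclusion of the chain
    adds one. *)
Theorem chain_to_prime k : has_chain pieces k ->
  exists P, [/\ prime_ideal P, I0 `<=` P, exists2 b, B b & ~ P b &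
                prime_trdeg_ge P (k + r)].
Proof.
move=> [c [cP clt]].
suff [P [LP good_P Pk]] : exists P, [/\ lift_of (c k) P, exists2 b, B b & ~ P b &
    prime_trdeg_ge P (k + r)].
  exists P; split=> //; first by case: LP.
  have pk := cP _ (leqnn k); case: LP => _ _ ZP _.
  by move=> g /(vanish_I0 (piece_sub pk))/ZP.
elim: k cP clt => [|k IHk] cP clt.
  have [P [LP gP]] := lift_bottom (cP _ (leqnn 0)).
  by exists P; split=> //; exact: (lift_good_trdeg (cP _ (leqnn 0)) LP gP).
have [||P [LP [b Bb Pb] Pk]] := IHk.
- by move=> i ik; apply: cP; exact: leqW.
- by move=> i ik; apply: clt; exact: leqW.
have [P' [LP' P'P]] := lift_below (cP _ (leqnSn k)) (cP _ (leqnn _)) (clt _ (ltnSn k)) LP.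
exists P'; split=> //; first by exists b => // /(proj1 P'P).
have [primeP _ _ _] := LP; have [primeP' _ _ _] := LP'.
by rewrite addSn; exact: prime_trdeg_strict P'P Pk.
Qed.

Definition image_of (q : set Q) : set T :=
  [set t | Y t /\ exists2 u, rep t u & forall g, q g -> multihom g -> g.@[u] = 0].

(** The products g (swap h), with g and h in [q], cut out the union of the zero set of [q] and its
    swap. *)
Lemma image_of_closed q : is_ideal q -> exists2 C, closed C & image_of q = Y `&` C.
Proof.
move=> [_ _ qM].
pose F : set Q := [set f | exists g h, [/\ q g, multihom g, q h, multihom h & f = g * swap h]].
have Fhom : F `<=` multihom.
  move=> f [g [h [_ hg _ hh fE]]]; rewrite fE.
  exact: (multihomMM hg (multihom_swap sigma_w hh)).
have Fswap f : F f -> F (swap f).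
  move=> [g [h [qg hg qh hh ->]]]; exists h, g; split=> //.
  by rewrite rmorphM swapK // mulrC.
have [C clC CE] := eqs_closed Fhom Fswap; exists C => //.
apply/seteqP; split=> t [Yt].
  move=> [u0 tu0 qu0]; split=> //; apply/(CE t Yt) => _ u [g [h [qg hg qh hh ->]]] tu.
  have F0 f : F f -> f.@[u0] = 0.
    by move=> [g' [h' [qg' hg' _ _ ->]]]; rewrite mevalM qu0 ?mul0r.
  have Fgh : F (g * swap h) by exists g, h.
  by apply: (multihom_eval_orbit Yt tu0 tu (Fhom _ Fgh)); apply: F0 => //; exact: Fswap.
move/(CE t Yt) => Ct; split=> //; have [u tu] := rep_ex Yt.
have [all0|] := pselect (forall g, q g -> multihom g -> g.@[u] = 0); first by exists u.
move/existsNP => [g /not_implyP[qg /not_implyP[hg gu]]].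
exists (u \o sigma); first exact: rep_swap.
move=> h qh hh; have := Ct (g * swap h) u; rewrite mevalM meval_swap.
move=> /(_ _ tu)/eqP; rewrite mulf_eq0 => E; apply/eqP.
have : (g.@[u] == 0) || (h.@[u \o sigma] == 0) by apply: E; exists g, h.
by case/orP => // /eqP.
Qed.

Lemma image_of_point q g : prime_ideal q -> I0 `<=` q -> ~ q g ->
  (exists2 b, B b & ~ q b) ->
  exists t u, [/\ image_of q t, rep t u & g.@[u] != 0].
Proof.
move=> primeq I0q qg [b Bb qb]; have [_ _ qP] := (prime_idealP _).1 primeq.
have [|u qu] := nullstellensatz (b := g * b) charK primeq; first by move/qP => [].
rewrite mevalM mulf_eq0 negb_or => /andP[gu bu].
have [|t Yt tu] := good_rep (u := u).
  by split=> [h /I0q/qu //|]; exists b.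
by exists t, u; split=> //; split=> //; exists u => // h qh _; exact: qu.
Qed.

Lemma image_of_piece q : prime_ideal q -> I0 `<=` q -> (exists2 b, B b & ~ q b) ->
  pieces (image_of q).
Proof.
move=> primeq I0q Bq; have [idq q1 qP] := (prime_idealP _).1 primeq.
split; last exact: image_of_closed.
split; first by have [t [_ [qt _ _]]] := image_of_point primeq I0q q1 Bq; exists t.
move=> A A' clA clA' sub.
have [F [Fhom Fswap FA]] := closed_eqs_swap clA.
have [F' [Fhom' Fswap' FA']] := closed_eqs_swap clA'.
have contained G D : G `<=` multihom -> (forall g, G g -> G (swap g)) ->
    (forall t, Y t -> (D t <-> forall g u, G g -> rep t u -> g.@[u] = 0)) ->
    G `<=` q -> image_of q `<=` D.
  move=> Ghom Gswap GD Gq t [Yt [u0 tu0 qu0]]; apply/(GD t Yt) => g u Gg tu.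
  have hg := Ghom _ Gg.
  apply: (multihom_eval_orbit Yt tu0 tu hg); first by apply: qu0 => //; exact: Gq.
  by apply: qu0; [apply: Gq; exact: Gswap|exact: Ghom (Gswap _ Gg)].
have [FQ|] := pselect (F `<=` q); first by left; exact: contained FQ.
move/existsNP => [a /not_implyP[Fa qa]].
have [FQ|] := pselect (F' `<=` q); first by right; exact: contained FQ.
move/existsNP => [a' /not_implyP[Fa' qa']].
have [|t [u [qt tu]]] := @image_of_point q (a * a') primeq I0q _ Bq; first by move/qP => [].
rewrite mevalM mulf_eq0 negb_or => /andP[au a'u].
have Yt : Y t by case: qt.
case: (sub t qt) => Dt.
  by have /eqP := (FA t Yt).1 Dt a u Fa tu; rewrite (negPf au).
by have /eqP := (FA' t Yt).1 Dt a' u Fa' tu; rewrite (negPf a'u).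
Qed.

(* Multiplying the components by powers of variables that are 1 modulo q makes
   a polynomial multihomogeneous without changing it modulo q. *)
Lemma homogenize (jj : 'I_r -> 'I_N) a : (forall i, w (jj i) = i) ->
  exists2 a', multihom a' & forall q, prime_ideal q ->
    (forall i, q ('X_(jj i) - 1)) -> (q a' <-> q a).
Proof.
move=> wj; pose S := msupp (torus K w a).
pose E := (\sum_(e <- S) e)%MM.
pose X (e : 'X_{1..r}) : Q := \prod_i 'X_(jj i) ^+ e i.
have XE m : multihom_deg w m (X m) by exact: multihom_prodX.
exists (\sum_(e <- S) component w e a * X (E - e)%MM).
  exists E; apply: multihom_sum => e eS.
  have EE : (e + (E - e))%MM = E.
    apply/mnmP => i; rewrite mnmDE mnmBE subnKC // /E mnm_sumE.
    by rewrite (bigD1_seq e) ?msupp_uniq //= leq_addr.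
  by have := multihomM (component_multihom w e a) (XE (E - e)%MM); rewrite EE.
move=> q /prime_point[L [iota [x ->]]] qj.
rewrite /pt_ker /= {2}(sum_component w a) !rmorph_sum.
suff -> : \sum_(e <- S) mmap iota x (component w e a * X (E - e)%MM) =
          \sum_(e <- S) mmap iota x (component w e a) by [].
apply: eq_bigr => e _; rewrite rmorphM /= -[RHS]mulr1; congr (_ * _).
rewrite rmorph_prod big1 // => i _; rewrite rmorphXn /= mmapX mmap1U.
have := qj i; rewrite /pt_ker /= rmorphB rmorph1 /= mmapX mmap1U => /eqP.
by rewrite subr_eq0 => /eqP ->; rewrite expr1n.
Qed.

(** Let a' be homogeneous in q' and not in [q]. A zero of [q] where a' is nonzero, or where a' (swap
    a') is nonzero when swap a' is not in [q], represents a point missed by the image of q'. *)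
Lemma image_of_strict (jj : 'I_r -> 'I_N) q q' : (forall i, w (jj i) = i) ->
  prime_ideal q -> prime_ideal q' -> (forall i, q ('X_(jj i) - 1)) ->
  I0 `<=` q -> (exists2 b, B b & ~ q b) -> q `<` q' -> image_of q' `<` image_of q.
Proof.
move=> wj primeq primeq' qj I0q Bq /proper_setP[qq' [a q'a qa]].
have [a' ha' a'P] := homogenize a wj.
have q'a' : q' a' by apply/(a'P q') => // i; apply: qq'; exact: qj.
have qa' : ~ q a' by move/(a'P q primeq qj).
split; first by move=> t [Yt [u tu q'u]]; split=> //; exists u => // g /qq'; exact: q'u.
move=> sub; have [_ _ qP] := (prime_idealP _).1 primeq.
have [qsa'|qsa'] := pselect (q (swap a')).
  have q'sa' := qq' _ qsa'.
  have [t [u [qt tu]]] := image_of_point primeq I0q qa' Bq.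
  have [Yt [u' tu' q'u']] := sub t qt.
  rewrite (multihom_eval_orbit Yt tu' tu ha') ?eqxx //; first exact: q'u'.
  by apply: q'u' => //; exact: (multihom_swap sigma_w ha').
have [|t [u [qt tu]]] := @image_of_point q (a' * swap a') primeq I0q _ Bq.
  by move/qP => [].
have [Yt [u' tu' q'u']] := sub t qt.
have hs : multihom (swap a') by exact: (multihom_swap sigma_w ha').
rewrite (multihom_eval_orbit Yt tu' tu (multihomMM ha' hs)) ?eqxx //.
  by rewrite mevalM q'u' // mul0r.
by rewrite rmorphM swapK // mevalM mulrC q'u' // mul0r.
Qed.

(** A chain of primes is built above the kernel of a dehomogenized generic point and then mapped to
    subsets of Y. *)
Theorem prime_to_chain P k : prime_ideal P -> I0 `<=` P -> (exists2 b, B b & ~ P b) ->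
  prime_trdeg_ge P k -> has_chain pieces (k - r).
Proof.
move=> /prime_point[L [iota [x ->]]] I0P [b Bb Pb] /pt_ker_trdeg Pk.
have gx : good iota x.
  by split=> [g /I0P //|]; exists b => //; apply/eqP.
have /choice[jj jP] i : exists j, w j = i /\ x j != 0.
  by have [j wj xj] := good_nz gx i; exists j.
have wj i : w (jj i) = i by case: (jP i).
have xj i : x (jj i) != 0 by case: (jP i).
(* One nonzero coordinate per block becomes 1, so every prime above contains these variables minus
   1, as [homogenize] requires. *)
pose x0 j := x j * (x (jj (w j)))^-1.
have gx0 : good iota x0.
  by apply: (good_scale (s := fun i => (x (jj i))^-1)) => // i; rewrite invr_eq0.
have x0k : trdeg_ge iota x0 (k - r).
  apply: (trdeg_scale (point_char charK iota) (w := w) (s := fun i => x (jj i)) _ Pk).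
  by move=> j; rewrite /x0 mulfVK.
have [I0x0 [b' Bb' b'x0]] := gx0.
have b'P : ~ pt_ker iota x0 b' by apply/eqP.
have [c [c0 cP clt]] :=
  prime_chain_avoiding charK (pt_ker_prime iota x0) b'P ((pt_ker_trdeg _ _ _).2 x0k).
have sub0 i : (i <= k - r)%N -> pt_ker iota x0 `<=` c i.
  by move=> ik; rewrite -c0; exact: chain_subset clt ik.
have I0c i : (i <= k - r)%N -> I0 `<=` c i.
  by move=> ik g /I0x0 g0; apply: (sub0 _ ik).
have cj l i : (i <= k - r)%N -> c i ('X_(jj l) - 1).
  move=> ik; apply: (sub0 _ ik); rewrite /pt_ker /= rmorphB rmorph1 /= mmapX mmap1U.
  by rewrite /x0 wj divff // subrr.
have Bc i : (i <= k - r)%N -> exists2 b, B b & ~ c i b.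
  by move=> ik; exists b' => //; case: (cP i ik).
(* Larger primes have smaller images, so the chain is read backwards. *)
exists (fun i => image_of (c (k - r - i)%N)); split=> i ik.
  have le := leq_subr i (k - r).
  by apply: image_of_piece; [case: (cP _ le)|exact: I0c|exact: Bc].
have le1 := leq_subr i (k - r); have le2 := leq_subr i.+1 (k - r).
apply: (image_of_strict wj).
- by case: (cP _ le2).
- by case: (cP _ le1).
- by move=> l; exact: cj.
- exact: I0c.
- exact: Bc.
have -> : (k - r - i = (k - r - i.+1).+1)%N by rewrite subnSK.
by apply: clt; rewrite subnSK // leq_subr.
Qed.

End QuotientDimension.

(** * Projective varieties *)

Section ProjectivePoints.
Variables (K : fieldType) (n : nat).
Local Notation V := 'rV[K]_n.+1.
Implicit Types (p : proj K n) (u v : V).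

Lemma represents_line u p : represents u p -> (p : {vspace V}) = <[u]>%VS.
Proof.
case: p => W /= dimW [/= uW u_nz]; apply/esym/eqP.
by rewrite eqEdim -memvE uW dim_vline u_nz (eqP dimW).
Qed.

Lemma represents_ex p : exists u, represents u p.
Proof.
case: p => W dimW; exists (vpick W); split=> /=; first exact: memv_pick.
by rewrite vpick0 -dimv_eq0 (eqP dimW).
Qed.

Lemma represents_scale p u v : represents u p -> represents v p ->
  exists2 c, c != 0 & v = c *: u.
Proof.
move=> pu [vp v_nz]; move: vp; rewrite (represents_line pu) => /vlineP[c vE].
by exists c => //; apply: contraNneq v_nz => c0; rewrite vE c0 scale0r.
Qed.

Fact proj_of_subproof u : u != 0 -> \dim <[u]> == 1%N.
Proof. by move=> u_nz; rewrite dim_vline u_nz. Qed.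

Lemma represented_ex u : u != 0 -> exists p, represents u p.
Proof.
by move=> u_nz; exists (ProjPoint (proj_of_subproof u_nz)); split=> //; exact: memv_line.
Qed.

Lemma homogeneousP (g : {mpoly K[n.+1]}) :
  homogeneous g <-> multihom (fun _ : 'I_n.+1 => ord0 : 'I_1) g.
Proof.
have wE (m : 'X_{1..n.+1}) : wdeg (fun _ : 'I_n.+1 => ord0 : 'I_1) m = [multinom mdeg m | _ < 1].
  by apply/mnmP => i; rewrite !mnmE mdegE; apply: eq_bigl => j; rewrite [i]ord1.
split=> [[d /dhomogP gd]|[d /multihom_degP gd]].
  exists [multinom d | _ < 1]; apply/multihom_degP => m /gd /= <-; exact: wE.
exists (d ord0); apply/dhomogP => m /gd <- /=.
by rewrite wE mnmE.
Qed.

Lemma homog_ideal_gen (X : set (proj K n)) g :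
  homogeneous g -> (forall p, X p -> vanishes_at g p) -> homog_ideal X g.
Proof. by move=> hg Xg; apply: sub_ideal_gen. Qed.

Lemma homog_ideal_vanish (X : set (proj K n)) g p u :
  homog_ideal X g -> X p -> represents u p -> g.@[u 0] = 0.
Proof.
move=> [k [a [x [Sx ->]]]] Xp pu; rewrite raddf_sum big1 //= => i _.
by rewrite mevalM; have [_ /(_ p Xp u pu) ->] := Sx i; rewrite mulr0.
Qed.

(** The generators are homogeneous. [L] is only a ring, so that dual numbers are allowed. *)
Lemma homog_ideal_scale (X : set (proj K n)) (L : comNzRingType)
    (iota : {rmorphism K -> L}) x s :
  (forall g, homog_ideal X g -> mmap iota x g = 0) ->
  forall g, homog_ideal X g -> mmap iota (fun j => x j * s) g = 0.
Proof.
move=> x0 g [k [a [h [Sh ->]]]]; rewrite rmorph_sum big1 //= => i _.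
have [hh Xh] := Sh i; rewrite rmorphM /=.
have [d hd] := (homogeneousP _).1 hh.
rewrite (multihom_scale iota x (fun=> s) hd) x0 ?mul0r ?mulr0 //.
exact: homog_ideal_gen.
Qed.

End ProjectivePoints.

Lemma swap_id (K : fieldType) N (g : {mpoly K[N]}) : swap K id g = g.
Proof.
rewrite -[RHS]comp_mpoly_id; apply: mmap_eq => // j.
by rewrite tnth_map tnth_ord_tuple.
Qed.

Section DimensionOfVariety.
Variables (K : closedFieldType) (n : nat) (X : set (proj K n)).
Hypothesis charK : [pchar K] =i pred0.
Hypothesis varX : proj_variety X.

Let w (j : 'I_n.+1) : 'I_1 := ord0.
(** Excludes the vertex of the affine cone. With one block and the identity as swap, the quotient is
    X itself. *)
Let B : set {mpoly K[n.+1]} := [set b | exists j, b = 'X_j].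
Let rep (p : proj K n) (u : 'I_n.+1 -> K) := represents (\row_j u j) p.
Let Kid : {rmorphism K -> K} := idfun.
Local Notation good := (good (homog_ideal X) B).
Local Notation pieces := (pieces (@zariski_closed K n) X).

Let meval_row (u : 'I_n.+1 -> K) (g : {mpoly K[n.+1]}) : g.@[(\row_j u j) 0] = g.@[u].
Proof. by apply: meval_eq => j; rewrite mxE. Qed.

Let good_nz (L : fieldType) (iota : {rmorphism K -> L}) x :
  good iota x -> forall i : 'I_1, exists2 j, w j = i & x j != 0.
Proof.
move=> [_ [_ [j ->] xj]] i; exists j; first by rewrite [i]ord1.
by move: xj; rewrite mmapX mmap1U.
Qed.

Let good_scale (L : fieldType) (iota : {rmorphism K -> L}) x (s : 'I_1 -> L) :
  (forall i, s i != 0) -> good iota x -> good iota (fun j => x j * s (w j)).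
Proof.
move=> s_nz gx; have [I0x _] := gx; split; first exact: (homog_ideal_scale (s ord0) I0x).
have [j _ xj] := good_nz gx ord0; exists 'X_j; first by exists j.
by rewrite mmapX mmap1U mulf_neq0.
Qed.

Let row_nz (u : 'I_n.+1 -> K) : \row_j u j != 0 <-> exists j, u j != 0.
Proof.
split=> [/eqP u_nz|[j uj]].
  apply: contrapT => nex; apply: u_nz; apply/rowP => j; rewrite !mxE; apply/eqP.
  by apply: contrapT => /negP uj; apply: nex; exists j.
by apply: contraNneq uj => /rowP/(_ j); rewrite !mxE => ->.
Qed.

Let rep_ex p : X p -> exists u, rep p u.
Proof.
move=> _; have [u pu] := represents_ex p; exists (u 0).
by rewrite /rep (_ : \row_j u 0 j = u) //; apply/rowP => j; rewrite mxE.
Qed.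

Let rep_good p u : X p -> rep p u -> good Kid u.
Proof.
move=> Xp pu; split=> [g Ig|].
  by rewrite -[LHS](meval_row u g); exact: homog_ideal_vanish Ig Xp pu.
have [j uj] := (row_nz u).1 pu.2; exists 'X_j; first by exists j.
by rewrite mmapX mmap1U.
Qed.

Let good_rep u : good Kid u -> exists2 p, X p & rep p u.
Proof.
move=> gu; have [I0u _] := gu; have [j _ uj] := good_nz gu ord0.
have /represented_ex[p pu] : \row_j u j != 0 by apply/row_nz; exists j.
exists p => //; have [[F Fhom XE] _] := varX; rewrite XE => g Fg v pv.
have [c c_nz vE] := represents_scale pu pv.
have Xg : homog_ideal X g.
  by apply: homog_ideal_gen; [exact: Fhom|move=> q; rewrite XE; apply].
have [d gd] := (homogeneousP _).1 (Fhom _ Fg).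
have E : v 0 =1 (fun j => u j * c) by move=> k; rewrite vE !mxE mulrC.
by rewrite (meval_eq g E) /meval (multihom_scale Kid u (fun=> c) gd) I0u // mul0r.
Qed.

Let rep_orbit p u u' : X p -> rep p u -> rep p u' ->
  exists (s : 'I_1 -> K) (v : 'I_n.+1 -> K), [/\ forall i, s i != 0,
    v = u \/ v = u \o id & u' =1 (fun j => v j * s (w j))].
Proof.
move=> _ pu pu'; have [c c_nz E] := represents_scale pu pu'.
exists (fun=> c), u; split=> //; first by left.
by move=> j; have /rowP/(_ j) := E; rewrite !mxE mulrC.
Qed.

Let rep_swap p u : rep p u -> rep p (u \o id). Proof. by []. Qed.

Let vanishes_rep g p : vanishes_at g p <-> forall u, rep p u -> g.@[u] = 0.
Proof.
split=> [pg u pu|pg u pu]; first by rewrite -meval_row; exact: pg.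
apply: (pg (u 0)); rewrite /rep (_ : \row_j u 0 j = u) //.
by apply/rowP => j; rewrite mxE.
Qed.

Let closed_eqs C : zariski_closed C -> exists2 F, F `<=` multihom w &
  forall p, X p -> (C p <-> forall g u, F g -> rep p u -> g.@[u] = 0).
Proof.
move=> [F Fhom ->]; exists F => [g /Fhom/homogeneousP //|p _].
split=> [pF g u /pF/vanishes_rep|pF g Fg]; first by apply.
by apply/vanishes_rep => u; exact: pF.
Qed.

Let eqs_closed F : F `<=` multihom w -> (forall g, F g -> F (swap K id g)) ->
  exists2 C, zariski_closed C &
  forall p, X p -> (C p <-> forall g u, F g -> rep p u -> g.@[u] = 0).
Proof.
move=> Fhom _; exists [set p | forall g, F g -> vanishes_at g p].
  by exists F => // g /Fhom/homogeneousP.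
move=> p _; split=> [pF g u /pF/vanishes_rep|pF g Fg]; first by apply.
by apply/vanishes_rep => u; exact: pF.
Qed.

Let idK : involutive (id : 'I_n.+1 -> 'I_n.+1). Proof. by []. Qed.
Let id_w j : w (id j) = id (w j). Proof. by []. Qed.

Let pieceX : pieces X.
Proof.
have [clX irrX] := varX; split=> //; exists X => //.
by rewrite setIid.
Qed.

(** When the swap is the identity, the two inclusions in [lift_of] force the lift to be the ideal of
    X. *)
Lemma homog_ideal_prime : prime_ideal (homog_ideal X).
Proof.
have [P [primeP _ XP PX]] :=
  lift_exists idK id_w rep_ex rep_orbit eqs_closed pieceX.
suff -> : homog_ideal X = P by [].
apply/seteqP; split=> g.
  move=> Ig; apply: XP; apply: (vanish_I0 good_scale rep_good (Z := X)) => //.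
move=> Pg; have : vanish w rep X g by apply: PX => //; rewrite swap_id.
move=> vg; rewrite (sum_component w g).
have [I00 ID _] := ideal_gen_ideal [set g | homogeneous g /\ forall p, X p -> vanishes_at g p].
apply: big_ind => // d _; apply: homog_ideal_gen.
  by apply/homogeneousP; exact: component_hom.
by move=> p Xp; apply/vanishes_rep => u pu; exact: vg pu.
Qed.

(** The coordinate ring is that of the affine cone, one dimension larger than X. *)
Lemma dim_variety_trdeg : exists d : nat, [/\ dim_variety X = (d%:Z)%:E,
  prime_trdeg_ge (homog_ideal X) d.+1 & ~ prime_trdeg_ge (homog_ideal X) d.+2].
Proof.
have primeX := homog_ideal_prime.
have BX : exists2 b, B b & ~ homog_ideal X b.
  have [[[p Xp] _] _] := pieceX; have [u pu] := rep_ex Xp.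
  have [_ [b Bb b_nz]] := rep_good Xp pu; exists b => // Ib; move/eqP: b_nz; apply.
  by have [+ _] := rep_good Xp pu; apply.
have up k : has_chain pieces k -> has_chain (primes_over (homog_ideal X)) (k + 1).
  move/(chain_to_prime idK id_w good_scale good_nz rep_ex rep_good rep_orbit
    rep_swap closed_eqs eqs_closed) => [P [primeP I0P _ Pk]].
  exact: (primes_over_chain charK I0P primeP Pk).
have down k : has_chain (primes_over (homog_ideal X)) k ->
    exists2 k', has_chain pieces k' & (k <= k' + 1)%N.
  move/(@chain_bottom_trdeg _ _ _ _) => [P [primeP I0P Pk]]; exists (k - 1)%N.
    apply: (prime_to_chain charK idK id_w good_scale good_nz rep_ex good_rep rep_orbit
      rep_swap closed_eqs eqs_closed primeX) => //.
    exact: prime_trdeg_sub I0P Pk.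
  by rewrite addn1 subn1; exact: leqSpred.
have [dimE dimN] := chain_dim_shift up down (primes_over_chain_bound charK (I := homog_ideal X)).
have [|d dE _] := dimN 0%N; first by exists (fun=> X); split=> // i; rewrite ltn0.
exists d; have dX : dim_variety X = (d%:Z)%:E by [].
case: (prime_point primeX) => L [iota [x XE]].
have [D xD maxD] := trdeg_max iota (point_char charK iota) x.
have XD : prime_trdeg_ge (homog_ideal X) D by rewrite XE; apply/pt_ker_trdeg.
have nXD : ~ prime_trdeg_ge (homog_ideal X) D.+1 by rewrite XE => /pt_ker_trdeg.
have := dimE; rewrite dE -/(krull_dim (homog_ideal X)) (krull_dim_prime charK primeX XD nXD).
rewrite -EFinB => -[/eqP]; rewrite eq_sym subr_eq -PoszD eqz_nat addn1 => /eqP DE.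
by rewrite -DE; split.
Qed.

End DimensionOfVariety.

(** * Minors and Jacobian matrices *)

Section MinorsAndRank.
Variable L : fieldType.

Lemma rank_mxsub s t s' t' (f : 'I_s' -> 'I_s) (g : 'I_t' -> 'I_t) (M : 'M[L]_(s, t)) :
  (\rank (mxsub f g M) <= \rank M)%N.
Proof.
rewrite mxsubcr -mxrank_tr trmx_mxsub; apply: leq_trans (mxrankS (rowsub_sub _ _)) _.
rewrite mxrank_tr; exact: mxrankS (rowsub_sub _ _).
Qed.

Lemma rank_rowsub s t k (M : 'M[L]_(s, t)) : (k <= \rank M)%N ->
  exists2 f : 'I_k -> 'I_s, injective f & \rank (rowsub f M) = k.
Proof.
move=> kM; pose f i := maxrankfun M (widen_ord kM i).
exists f; first by move=> i j /maxrankfun_inj/(congr1 val) /= ij; exact: val_inj.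
have fE : rowsub f M = rowsub (widen_ord kM) (rowsub (maxrankfun M) M).
  by rewrite -rowsub_comp.
rewrite fE rowsubE mxrankMfree ?maxrowsub_free //; apply/eqP.
rewrite -/(row_free _); apply/row_freeP; exists (\matrix_(i, j) (i == widen_ord kM j)%:R).
apply/matrixP => i j; rewrite !mxE (bigD1 (widen_ord kM i)) //= !mxE eqxx mul1r.
rewrite big1 ?addr0 => [|l li]; first by congr ((_ : bool)%:R); rewrite -!val_eqE.
by rewrite !mxE eq_sym (negPf li) mul0r.
Qed.

Lemma minor_rankP s t k (M : 'M[L]_(s, t)) :
  (exists (f : 'I_k -> 'I_s) (g : 'I_k -> 'I_t),
     [/\ injective f, injective g & \det (mxsub f g M) != 0]) <->
  (k <= \rank M)%N.
Proof.
split=> [[f [g [_ _ d_nz]]]|kM].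
  have := rank_mxsub f g M; rewrite mxrank_unit //.
  by rewrite unitmxE unitfE.
have [f f_inj fM] := rank_rowsub kM.
have kM' : (k <= \rank (rowsub f M)^T)%N by rewrite mxrank_tr fM.
have [g g_inj gM] := rank_rowsub kM'.
exists f, g; split=> //; rewrite mxsubcr -unitfE -unitmxE.
rewrite -unitmx_tr trmx_mxsub -row_free_unit.
by rewrite /row_free gM.
Qed.

Lemma kernel_rank s t t' (M : 'M[L]_(s, t)) (M' : 'M[L]_(s, t')) :
  (forall v : 'rV_s, v *m M = 0 -> v *m M' = 0) -> (\rank M' <= \rank M)%N.
Proof.
move=> ker; have : (kermx M <= kermx M')%MS.
  apply/row_subP => i; apply/sub_kermxP/ker/sub_kermxP; exact: row_sub.
by move/mxrankS; rewrite !mxrank_ker leq_sub2lE // rank_leq_row.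
Qed.

End MinorsAndRank.

Lemma minors_idealP (R : comNzRingType) (L : fieldType) (phi : {rmorphism R -> L})
    s t k (M : 'M[R]_(s, t)) :
  (forall d, minors_ideal k M d -> phi d = 0) <-> (\rank (map_mx phi M) < k)%N.
Proof.
rewrite ltnNge; split=> [phi0|/negP rk d].
  apply/negP => /minor_rankP[f [g [f_inj g_inj /eqP d_nz]]]; apply: d_nz.
  rewrite -map_mxsub det_map_mx; apply: phi0; apply: sub_ideal_gen.
  by exists f, g.
move=> [l [a [x [Sx ->]]]]; rewrite rmorph_sum big1 // => i _; rewrite rmorphM /=.
have [f [g [f_inj g_inj ->]]] := Sx i.
rewrite -det_map_mx map_mxsub; apply/eqP; rewrite mulf_eq0; apply/orP; right.
by apply: contraT => d_nz; case: rk; apply/minor_rankP; exists f, g.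
Qed.

Section JacobianKernel.
Variables (K L : fieldType) (iota : {rmorphism K -> L}) (n m : nat).
Variable (f : m.+1.-tuple {mpoly K[n.+1]}).
Local Notation G := [set g | g \in f].

Definition jac (y : 'I_n.+1 -> L) : 'M[L]_(n.+1, m.+1) :=
  map_mx (mmap iota y) (jacobian f).

Lemma jac_kerP y (v : 'rV[L]_n.+1) : v *m jac y = 0 <->
  forall g, g \in f -> \sum_(j < n.+1) mmap iota y g^`M(j) * v 0 j = 0.
Proof.
have E i : (v *m jac y) 0 i = \sum_(j < n.+1) mmap iota y (tnth f i)^`M(j) * v 0 j.
  by rewrite mxE; apply: eq_bigr => j _; rewrite !mxE mulrC.
split=> [v0 g /tnthP[i ->]|v0]; first by rewrite -E v0 mxE.
by apply/rowP => i; rewrite [RHS]mxE E v0 // mem_tnth.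
Qed.

(* First order vanishing along v, as the vanishing of g(y + eps v). *)
Lemma jac_ker_dualP y (v : 'rV[L]_n.+1) : (forall g, g \in f -> mmap iota y g = 0) ->
  (v *m jac y = 0 <-> forall g, ideal_gen G g ->
     mmap (dninj \o iota) (fun j => dn (y j) (v 0 j)) g = 0).
Proof.
move=> y0; rewrite jac_kerP; split=> [v0 g|v0 g fg].
  move=> [k [a [x [Gx ->]]]]; rewrite rmorph_sum big1 // => i _; rewrite rmorphM /=.
  by rewrite [X in _ * X]mmap_dual y0 ?v0 ?mulr0 //; exact: Gx.
have := v0 g (@sub_ideal_gen _ G g fg); rewrite mmap_dual => /dnE[_].
by rewrite /dnsnd.
Qed.

(** The entries of [f] may be inhomogeneous, so the Jacobian matrix has no simple behaviour under
    scaling. Its left kernel does: y + eps v is a zero of the homogeneous ideal, and so is s (y +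
    eps v). *)
Lemma jac_ker_scale (X : set (proj K n)) y s (v : 'rV[L]_n.+1) :
  homog_ideal X = ideal_gen G -> s != 0 ->
  (forall g, g \in f -> mmap iota y g = 0) ->
  v *m jac y = 0 -> v *m jac (fun j => y j * s) = 0.
Proof.
move=> XG s_nz y0 v0.
have ys g : g \in f -> mmap iota (fun j => y j * s) g = 0.
  move=> fg; apply: (homog_ideal_scale (X := X)).
    move=> h; rewrite XG => -[k [a [x [Gx ->]]]]; rewrite rmorph_sum big1 // => i _.
    by rewrite rmorphM /= [X in _ * X]y0 ?mulr0 //; exact: Gx.
  by rewrite XG; exact: sub_ideal_gen.
(* Scaling the dual point also scales the tangent vector. *)
suff : (s *: v) *m jac (fun j => y j * s) = 0.
  rewrite -scalemxAl => /eqP; rewrite scaler_eq0 (negPf s_nz) => /eqP //.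
apply/(jac_ker_dualP _ ys) => g; rewrite -XG => Xg.
rewrite (@mmap_eq _ _ _ _ (dninj \o iota) _ (fun j => dn (y j) (v 0 j) * dninj s)) //.
  apply: (homog_ideal_scale (X := X)) Xg => h; rewrite XG.
  exact: (jac_ker_dualP v y0).1 v0 h.
move=> j; apply/dnE; rewrite dnfstM dnsndM /dnfst /dnsnd /dninj /= mulr0 add0r.
by split=> //; rewrite mxE mulrC.
Qed.

End JacobianKernel.

Section MinorFamily.
Variable R : comNzRingType.

(** A family over a finite type, as the pigeonhole argument on saturations needs; non-injective
    choices are given the value 0. *)
Definition minor s t k (M : 'M[R]_(s, t))
    (p : {ffun 'I_k -> 'I_s} * {ffun 'I_k -> 'I_t}) : R :=
  if injectiveb p.1 && injectiveb p.2 then \det (mxsub p.1 p.2 M) else 0.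

Lemma minor_mem s t k (M : 'M[R]_(s, t)) p : minors_ideal k M (@minor s t k M p).
Proof.
rewrite /minor; case: ifP => [/andP[/injectiveP i1 /injectiveP i2]|_].
  by apply: sub_ideal_gen; exists p.1, p.2.
by have [] := ideal_gen_ideal [set d | exists (f : 'I_k -> 'I_s) (g : 'I_k -> 'I_t),
     [/\ injective f, injective g & d = \det (mxsub f g M)]].
Qed.

Lemma minors_ideal_range s t k (M : 'M[R]_(s, t)) :
  minors_ideal k M `<=` ideal_gen (range (@minor s t k M)).
Proof.
apply: ideal_gen_min; first exact: ideal_gen_ideal.
move=> _ [f [g [f_inj g_inj ->]]]; apply: sub_ideal_gen.
exists ([ffun i => f i], [ffun i => g i]) => //; rewrite /minor /=.
have -> : injectiveb [ffun i => f i].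
  by apply/injectiveP => i j; rewrite !ffunE; exact: f_inj.
have -> : injectiveb [ffun i => g i].
  by apply/injectiveP => i j; rewrite !ffunE; exact: g_inj.
by rewrite mxsub_ffun.
Qed.

Lemma minor_familyP (L : fieldType) (phi : {rmorphism R -> L}) s t k (M : 'M[R]_(s, t)) :
  (exists p, phi (@minor s t k M p) != 0) <-> (k <= \rank (map_mx phi M))%N.
Proof.
split=> [[p]|/minor_rankP[f [g [f_inj g_inj d_nz]]]].
  rewrite /minor; case: ifP => [/andP[/injectiveP i1 /injectiveP i2]|_].
    by rewrite -det_map_mx map_mxsub => d_nz; apply/minor_rankP; exists p.1, p.2.
  by rewrite rmorph0 eqxx.
exists ([ffun i => f i], [ffun i => g i]); rewrite /minor /=.
have -> : injectiveb [ffun i => f i].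
  by apply/injectiveP => i j; rewrite !ffunE; exact: f_inj.
have -> : injectiveb [ffun i => g i].
  by apply/injectiveP => i j; rewrite !ffunE; exact: g_inj.
by rewrite mxsub_ffun -det_map_mx map_mxsub.
Qed.

Lemma ideal_pow_sub (J : set R) k k' : ideal_pow J (k + k') `<=` ideal_pow J k.
Proof.
have idk := ideal_gen_ideal [set \prod_(i < k) a i | a in
    [set a : 'I_k -> R | forall i, J (a i)]].
apply: ideal_gen_min => // _ [a Ja <-]; rewrite big_split_ord /= mulrC.
have [_ _ idM] := idk; apply: idM; apply: sub_ideal_gen.
by exists (fun i => a (lshift k' i)).
Qed.

Lemma saturation_ideal (I J : set R) : is_ideal I -> is_ideal (saturation I J).
Proof.
move=> [I0 ID IM]; split.
- by exists 0%N => // b _; rewrite mul0r.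
- move=> a b [k _ Ia] [k' _ Ib]; exists (k + k')%N => // c Jc; rewrite mulrDl.
  apply: ID; first by apply: Ia; exact: ideal_pow_sub Jc.
  by apply: Ib; apply: (@ideal_pow_sub _ _ k); rewrite addnC.
- by move=> r a [k _ Ia]; exists k => // c Jc; rewrite -mulrA; apply: IM; exact: Ia.
Qed.

Lemma saturation_elim (I J P : set R) g b : prime_ideal P -> I `<=` P -> J b -> ~ P b ->
  saturation I J g -> P g.
Proof.
move=> /prime_idealP[_ P1 PP] IP Jb Pb [k _ Ig].
have : P (g * b ^+ k).
  apply: IP; apply: Ig; apply: sub_ideal_gen; exists (fun=> b) => //.
  by rewrite prodr_const card_ord.
case/PP => //; elim: k {Ig} => [|k IHk]; first by rewrite expr0.
by rewrite exprS => /PP[].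
Qed.

Lemma radical_elim (I P : set R) g : prime_ideal P -> I `<=` P -> ideal_radical I g -> P g.
Proof.
move=> /prime_idealP[_ P1 PP] IP [k /IP]; elim: k => [|k IHk]; first by rewrite expr0.
by rewrite exprS => /PP[].
Qed.

Variables (I J1 Ja Jb : set R) (T1 Ta Tb : finType).
Variables (G1 : T1 -> R) (Ga : Ta -> R) (Gb : Tb -> R).
Hypothesis idI : is_ideal I.
Hypothesis J1G : J1 `<=` ideal_gen (range G1).
Hypothesis JaG : Ja `<=` ideal_gen (range Ga).
Hypothesis JbG : Jb `<=` ideal_gen (range Gb).
Hypothesis GJ1 : forall p, J1 (G1 p).
Hypothesis idJa : is_ideal Ja.
Hypothesis idJb : is_ideal Jb.
Hypothesis GJa : forall p, Ja (Ga p).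
Hypothesis GJb : forall p, Jb (Gb p).
Let T := ideal_radical (saturation (saturation I J1) (Ja `&` Jb)).

Lemma prime_over_saturations P p a b : prime_ideal P -> I `<=` P ->
  ~ P (G1 p * Ga a * Gb b) -> T `<=` P.
Proof.
move=> primeP IP nP g Tg; have [[_ _ PM] _ PP] := (prime_idealP _).1 primeP.
apply: radical_elim Tg => // {}g.
apply: (@saturation_elim _ _ _ _ (Ga a * Gb b)) => //.
- move=> h; apply: (saturation_elim primeP IP (GJ1 p)) => P1; apply: nP.
  by rewrite -mulrA mulrC; exact: PM.
- have [_ _ Ma] := idJa; have [_ _ Mb] := idJb.
  by split; [rewrite mulrC; exact: Ma|exact: Mb].
by move=> Pab; apply: nP; rewrite -mulrA; exact: PM.
Qed.

(** The two saturations are undone one after the other, the outer one first, each time passing to a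
    smaller prime. *)
Lemma saturations_prime q : prime_ideal q -> T `<=` q ->
  exists P, [/\ prime_ideal P, P `<=` q, I `<=` P &
    exists p a b, ~ P (G1 p * Ga a * Gb b)].
Proof.
move=> primeq Tq.
pose Gab (t : Ta * Tb) := Ga t.1 * Gb t.2.
(* The intersection need not be generated by the products Ga Gb, but a product of two of its
   elements lies in the ideal they generate. *)
have JG x y : (Ja `&` Jb) x -> (Ja `&` Jb) y -> ideal_gen (range Gab) (x * y).
  move=> [/JaG Jax _] [_ /JbG Jby].
  have [i0 iD iM] := ideal_gen_ideal (range Gab).
  move: x Jax; apply: (@ideal_gen_min _ _ [set x | ideal_gen (range Gab) (x * y)]).
    split=> /=; first by rewrite mul0r.
      by move=> u v uy vy; rewrite mulrDl; exact: iD.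
    by move=> c u uy; rewrite -mulrA; exact: iM.
  move=> _ [a _ <-] /=.
  move: y Jby; apply: (@ideal_gen_min _ _ [set y | ideal_gen (range Gab) (Ga a * y)]).
    split=> /=; first by rewrite mulr0.
      by move=> u v uy vy; rewrite mulrDr; exact: iD.
    by move=> c u uy; rewrite mulrCA; exact: iM.
  by move=> _ [b _ <-] /=; apply: sub_ideal_gen; exists (a, b).
have satq : saturation (saturation I J1) (Ja `&` Jb) `<=` q.
  by move=> g sg; apply: Tq; exists 1%N.
have [P2 [primeP2 satP2 P2q [[a b] /= nab]]] :=
  saturation_prime (saturation_ideal J1 idI) primeq JG satq.
have JG1 x y : J1 x -> J1 y -> ideal_gen (range G1) (x * y).
  by move=> _ /J1G; have [_ _ iM] := ideal_gen_ideal (range G1); exact: iM.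
have [P1 [primeP1 IP1 P1P2 [p np]]] := saturation_prime idI primeP2 JG1 satP2.
exists P1; split=> //; first exact: subset_trans P2q.
exists p, a, b; have [_ _ PP] := (prime_idealP _).1 primeP1.
by rewrite -mulrA => /PP[//|/P1P2].
Qed.

End MinorFamily.

(** * Blocks of variables, one for each factor *)

Section Blocks.
Variables (r n : nat).

Definition block_index (k : 'I_(r * n.+1)) : 'I_r * 'I_n.+1 :=
  enum_val (cast_ord (esym (mxvec_cast r n.+1)) k).
Definition block (k : 'I_(r * n.+1)) : 'I_r := (block_index k).1.
(** With two blocks, reversing their order is the exchange of the two points. *)
Definition block_rev (k : 'I_(r * n.+1)) : 'I_(r * n.+1) :=
  mxvec_index (rev_ord (block_index k).1) (block_index k).2.

Lemma block_index_mxvec i j : block_index (mxvec_index i j) = (i, j).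
Proof. by rewrite /block_index /mxvec_index cast_ordK enum_rankK. Qed.

Lemma block_mxvec i j : block (mxvec_index i j) = i.
Proof. by rewrite /block block_index_mxvec. Qed.

Lemma block_rev_mxvec i j : block_rev (mxvec_index i j) = mxvec_index (rev_ord i) j.
Proof. by rewrite /block_rev block_index_mxvec. Qed.

Lemma block_revK : involutive block_rev.
Proof.
by move=> k; case/mxvec_indexP: k => i j; rewrite !block_rev_mxvec rev_ordK.
Qed.

Lemma block_rev_block k : block (block_rev k) = rev_ord (block k).
Proof.
by case/mxvec_indexP: k => i j; rewrite block_rev_mxvec !block_mxvec.
Qed.

Lemma sum_block (F : 'I_(r * n.+1) -> nat) i :
  (\sum_(k | block k == i) F k = \sum_(j < n.+1) F (mxvec_index i j))%N.
Proof.
rewrite (reindex (fun j => mxvec_index i j)) /=.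
  by apply: eq_bigl => j; rewrite block_mxvec eqxx.
exists (fun k => (block_index k).2) => k; first by rewrite block_index_mxvec.
case/mxvec_indexP: k => i' j; rewrite inE block_mxvec block_index_mxvec /=.
by move/eqP ->.
Qed.

Definition slice (L : Type) (x : 'I_(r * n.+1) -> L) i (j : 'I_n.+1) := x (mxvec_index i j).

Lemma mmap_subst_z (K L : fieldType) (iota : {rmorphism K -> L}) x i g :
  mmap iota x (@subst_z K r n i g) = mmap iota (slice x i) g.
Proof.
rewrite mmap_mPo; apply: mmap_eq => // j.
by rewrite tnth_mktuple /zvar mmapX mmap1U.
Qed.

Lemma multihomogeneousP (K : fieldType) (g : {mpoly K[r * n.+1]}) :
  multihomogeneous g <-> multihom block g.
Proof.
split=> [[d gd]|[d /multihom_degP gd]].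
  exists [multinom d i | i < r]; apply/multihom_degP => m /gd md.
  by apply/mnmP => i; rewrite !mnmE sum_block.
exists d => m /gd <- i.
by rewrite mnmE sum_block.
Qed.

End Blocks.

Lemma rank_col_vectors (L : fieldType) n (a b : 'rV[L]_n) : a != 0 ->
  (2 <= \rank (col_mx a b))%N <-> ~ exists c, b = c *: a.
Proof.
move=> a_nz; rewrite -addsmxE; split=> [r2 [c bE]|nc].
  have ba : (b <= a)%MS by apply/sub_rVP; exists c.
  move: r2; rewrite (addsmx_idPl ba).
  by rewrite leqNgt ltnS rank_leq_row.
have ra : \rank a = 1%N by rewrite rank_rV a_nz.
suff /rank_ltmx : (a < a + b)%MS by rewrite ra.
rewrite ltmxE addsmxSl /=; apply/negP => E; apply: nc; apply/sub_rVP.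
exact: submx_trans (addsmxSr a b) E.
Qed.

Lemma rank_ltP (L : fieldType) s n (M : 'M[L]_(s, n)) :
  (\rank M < n)%N <-> exists2 v : 'rV[L]_n, v != 0 & v *m M^T = 0.
Proof.
split=> [lt|[v v_nz vM]].
  have : kermx M^T != 0.
    by rewrite -mxrank_eq0 mxrank_ker mxrank_tr subn_eq0 -ltnNge.
  by case/rowV0Pn => v /sub_kermxP vM v_nz; exists v.
rewrite ltnNge; apply/negP => le; move/eqP: v_nz; apply.
have : row_free M^T.
  by rewrite /row_free mxrank_tr eqn_leq rank_leq_col le.
by move/row_free_inj; apply; rewrite mul0mx.
Qed.

(** * Terracini loci of pairs of points *)

Section TwoPoints.
Variables (K : fieldType) (n m : nat) (f : m.+1.-tuple {mpoly K[n.+1]}) (l : nat).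
Local Notation N := (2 * n.+1)%N.
Local Notation Q := {mpoly K[N]}.
Local Notation A := (jacobian f)^T.
Local Notation G := [set g | g \in f].

Definition pair_eqs : set Q := ideal_sum (minors_ideal n.+1 (@mx_zz K 2 n _ _ A)) (@ideal_zz K 2 n G).

(** Nonzero at a pair of zeros of [f] only if the points are distinct and, for l = n - dim X, both
    smooth. *)
Definition minor_product p p0 p1 : Q :=
  @minor _ _ _ 2 (@Zmx K 2 n ord0 ord_max) p * @minor _ _ _ l (@mx_z K 2 n _ _ A ord0) p0 *
  @minor _ _ _ l (@mx_z K 2 n _ _ A ord_max) p1.

Definition pair_minors : set Q := [set b | exists p p0 p1, b = minor_product p p0 p1].

Section GoodPairs.
Variables (L : fieldType) (iota : {rmorphism K -> L}) (x : 'I_N -> L).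
Local Notation J i := (jac iota f (slice x i)).

Lemma map_mx_z i : map_mx (mmap iota x) (mx_z A i) = (J i)^T.
Proof. by apply/matrixP => a b; rewrite !mxE mmap_subst_z. Qed.

Lemma map_mx_zz : map_mx (mmap iota x) (@mx_zz K 2 n _ _ A) = \mxcol_i (J i)^T.
Proof.
by apply/matrixP => a b; rewrite mxE /mx_zz !mxE mmap_subst_z.
Qed.

Lemma map_Zmx : map_mx (mmap iota x) (@Zmx K 2 n ord0 ord_max) =
  col_mx (\row_j slice x ord0 j) (\row_j slice x ord_max j).
Proof.
rewrite map_col_mx; congr col_mx; apply/rowP => j;
  by rewrite !mxE /zvar mmapX mmap1U.
Qed.

Lemma ideal_zzP : (forall g, @ideal_zz K 2 n G g -> mmap iota x g = 0) <->
  forall i g, g \in f -> mmap iota (slice x i) g = 0.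
Proof.
split=> [x0 i g fg|x0 g].
  rewrite -mmap_subst_z; apply: x0; apply: sub_ideal_gen; exists i => //.
  by apply: sub_ideal_gen; exists g.
have [idk _ _] := (prime_idealP _).1 (pt_ker_prime iota x).
apply: (ideal_gen_min (I := pt_ker iota x)) => // h [i _].
apply: (ideal_gen_min (I := pt_ker iota x)) => // _ [g' fg' <-].
by rewrite /pt_ker /= mmap_subst_z x0.
Qed.

(** The stacked matrix has n + 1 columns, and its rank is smaller iff the two Jacobian matrices have
    a common nonzero vector in their left kernels. *)
Lemma pair_eqsP : (forall g, pair_eqs g -> mmap iota x g = 0) <->
  (forall i g, g \in f -> mmap iota (slice x i) g = 0) /\
  (exists2 v : 'rV[L]_n.+1, v != 0 & forall i, v *m J i = 0).
Proof.
have [idk _ _] := (prime_idealP _).1 (pt_ker_prime iota x).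
have stackP : (forall g, minors_ideal n.+1 (@mx_zz K 2 n _ _ A) g -> mmap iota x g = 0) <->
    (exists2 v : 'rV[L]_n.+1, v != 0 & forall i, v *m J i = 0).
  rewrite minors_idealP map_mx_zz rank_ltP tr_mxcol.
  split=> -[v v_nz vJ]; exists v => //.
    move=> i; have := congr1 (fun M => submxrow M i) vJ.
    by rewrite mul_mxrow mxrowK submxrow0 trmxK.
  rewrite mul_mxrow -mxrow0; apply: eq_mxrow => i.
  by rewrite trmxK vJ.
rewrite -ideal_zzP -stackP; split=> [x0|[z0 m0] g].
  by split=> g Ig; apply: x0; apply: sub_ideal_gen; [right|left].
by apply: (ideal_gen_min (I := pt_ker iota x)) => // h [/m0|/z0].
Qed.

Lemma pair_minorsP : (exists2 b, pair_minors b & mmap iota x b != 0) <->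
  (2 <= \rank (col_mx (\row_j slice x ord0 j) (\row_j slice x ord_max j)))%N /\
  forall i, (l <= \rank (J i))%N.
Proof.
have rkJ i : (exists p, mmap iota x (@minor _ _ _ l (mx_z A i) p) != 0) <->
    (l <= \rank (J i))%N.
  by rewrite (minor_familyP (mmap iota x)) map_mx_z mxrank_tr.
have prodP (a b c : Q) : mmap iota x (a * b * c) != 0 <->
    [/\ mmap iota x a != 0, mmap iota x b != 0 & mmap iota x c != 0].
  rewrite rmorphM rmorphM /= !mulf_eq0 !negb_or -andbA.
  by split=> [/and3P|/and3P].
rewrite -map_Zmx -(minor_familyP (mmap iota x)); split.
  move=> [_ [p [p0 [p1 ->]]] /prodP[h h0 h1]]; split=> [|i]; first by exists p.
  apply/rkJ; have [->|->] : i = ord0 \/ i = ord_max.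
  - by case: i => -[|[|//]] ?; [left|right]; apply: val_inj.
  - by exists p0; exact: h0.
  - by exists p1; exact: h1.
move=> [[p h] rk]; have [p0 h0] := (rkJ ord0).2 (rk ord0).
have [p1 h1] := (rkJ ord_max).2 (rk ord_max).
exists (minor_product p p0 p1); first by exists p, p0, p1.
by apply/prodP; split; [exact: h|exact: h0|exact: h1].
Qed.

End GoodPairs.
End TwoPoints.

Lemma dim_row_space (F : fieldType) n s (W : {vspace 'rV[F]_n}) (M : 'M[F]_(s, n)) :
  (forall v, v \in W <-> (v <= M)%MS) -> \dim W = \rank M.
Proof.
move=> WM; pose b := [tuple row i (row_base M) | i < \rank M].
have bE (c : 'I_(\rank M) -> F) : \sum_i c i *: b`_i = (\row_i c i) *m row_base M.
  rewrite mulmx_sum_row; apply: eq_bigr => i _.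
  by rewrite -tnth_nth tnth_mktuple mxE.
have b_free : free b.
  apply/freeP => c; rewrite bE => c0 i.
  have c0' : \row_i c i = 0.
    by apply: (row_free_inj (row_base_free M)); rewrite c0 mul0mx.
  by have /rowP/(_ i) := c0'; rewrite !mxE.
have -> : W = <<b>>%VS.
  apply/vspaceP => v; apply/idP/idP.
    move/WM; rewrite -(eq_row_base M) => /submxP[c ->].
    rewrite mulmx_sum_row rpred_sum // => i _; apply/rpredZ/memv_span.
    by apply/tnthP; exists i; rewrite tnth_mktuple.
  move/coord_span ->; rewrite bE; apply/WM.
  by rewrite -(eq_row_base M) submxMl.
by rewrite (eqP (b_free : \dim <<b>> == size b)) size_tuple.
Qed.

(** * Tangent spaces and smooth points through the Jacobian matrix *)

Section TangentSpaces.
Variables (K : closedFieldType) (n m : nat).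
Hypothesis charK : [pchar K] =i pred0.
Variables (X : set (proj K n)) (f : m.+1.-tuple {mpoly K[n.+1]}).
Hypothesis varX : proj_variety X.
Hypothesis idealX : homog_ideal X = ideal_gen [set g | g \in f].
Variable d : nat.
Hypothesis dimXd : dim_variety X = (d%:Z)%:E.
Hypothesis trdegX : prime_trdeg_ge (homog_ideal X) d.+1.

Let Kid : {rmorphism K -> K} := idfun.
Local Notation J u := (jac Kid f u).

Lemma dim_le : (d <= n)%N.
Proof. exact: (prime_trdeg_le charK (homog_ideal_prime varX) trdegX). Qed.

Lemma eqs_homog_ideal g : g \in f -> homog_ideal X g.
Proof. by move=> fg; rewrite idealX; exact: (@sub_ideal_gen _ [set g | g \in f]). Qed.

Lemma homog_ideal_zero (L : fieldType) (iota : {rmorphism K -> L}) x :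
  (forall g, g \in f -> mmap iota x g = 0) -> forall g, homog_ideal X g -> mmap iota x g = 0.
Proof.
have [idk _ _] := (prime_idealP _).1 (pt_ker_prime iota x).
move=> f0 g; rewrite idealX; move: g.
by apply: (ideal_gen_min (I := pt_ker iota x)) => // g; exact: f0.
Qed.

(** A larger minor that is nonzero at [u] is not in the ideal of X, hence is nonzero at the generic
    point, where [trdeg_rank] gives (d + 1) + rank <= n + 1. *)
Lemma rank_jac_le u : (forall g, g \in f -> mmap Kid u g = 0) -> (\rank (J u) <= n - d)%N.
Proof.
move=> u0; rewrite leqNgt; apply/negP.
rewrite -(mxrank_tr (J u)) => /minor_rankP[a [b [a_inj b_inj d_nz]]].
pose D := \det (mxsub a b (jacobian f)^T).
have Du : mmap Kid u D != 0 by rewrite -det_map_mx map_mxsub -map_trmx.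
have XD : ~ homog_ideal X D.
  by move/(homog_ideal_zero u0) => D0; rewrite D0 eqxx in Du.
have [L [iota [x XE]]] := prime_point (homog_ideal_prime varX).
have charL := point_char charK iota.
have xd : trdeg_ge iota x d.+1 by apply/pt_ker_trdeg; rewrite -XE.
have f0 g : g \in f -> mmap iota x g = 0.
  by move=> /eqs_homog_ideal; rewrite XE.
have Gf i : mmap iota x (tnth f i) = 0 by apply: f0; exact: mem_tnth.
have := trdeg_rank charL xd Gf.
have -> : grad iota x (tnth f) = (jac iota f x)^T.
  by apply/matrixP => i j; rewrite !mxE.
have : (n - d < \rank (jac iota f x)^T)%N.
  apply/minor_rankP; exists a, b; split=> //; apply/eqP => D0; apply: XD.
  by rewrite XE /pt_ker /= -det_map_mx map_mxsub -map_trmx.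
move=> lt le.
by have := leq_trans (leq_add (leqnn d.+1) lt) le; rewrite addSn addnS subnKC ?ltnn // dim_le.
Qed.

(** The definition of the tangent space runs over the whole ideal and all representatives;
    generators at a single representative are enough, by [jac_ker_scale]. *)
Lemma tangent_spaceP p u v : X p -> represents u p ->
  (v \in tangent_space X p <-> v *m J (u 0) = 0).
Proof.
move=> Xp pu; rewrite /tangent_space; case: cid => W /= WP; rewrite WP.
have fu w : represents w p -> forall g, g \in f -> mmap Kid (w 0) g = 0.
  by move=> pw g /eqs_homog_ideal Xg; exact: homog_ideal_vanish Xg Xp pw.
split=> [tv|v0 g w Xg pw].
  by apply/jac_kerP => g fg; apply: tv => //; exact: eqs_homog_ideal.
have [c c_nz wE] := represents_scale pu pw.
have vw : v *m J (w 0) = 0.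
  have := jac_ker_scale idealX c_nz (fu u pu) v0.
  congr (_ *m _ = 0); apply/matrixP => i j; rewrite !mxE.
  by apply: mmap_eq => // k; rewrite wE mxE mulrC.
have := (jac_ker_dualP v (fu w pw)).1 vw g; rewrite -idealX => /(_ Xg).
by rewrite mmap_dual => /dnE[].
Qed.

Lemma dim_tangent_space p u : X p -> represents u p ->
  (\dim (tangent_space X p) + \rank (J (u 0%R)) = n.+1)%N.
Proof.
move=> Xp pu; rewrite (@dim_row_space _ _ _ _ (kermx (J (u 0)))).
  by rewrite mxrank_ker subnK // rank_leq_row.
move=> v; rewrite (tangent_spaceP v Xp pu).
by split=> /sub_kermxP.
Qed.

Lemma smooth_pointsP p u : represents u p ->
  (smooth_points X p <-> X p /\ (n - d <= \rank (J (u 0%R)))%N).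
Proof.
move=> pu; rewrite /smooth_points /= /proj_dim dimXd.
split=> -[Xp h]; split=> //; have dimT := dim_tangent_space Xp pu.
  move: h => [/eqP]; rewrite subr_eq -PoszD eqz_nat addn1 => /eqP E.
  by move: dimT; rewrite E addSn => -[dimT]; rewrite leq_subLR dimT.
have le : (\rank (J (u 0%R)) <= n - d)%N.
  by apply: rank_jac_le => g /eqs_homog_ideal Xg; exact: homog_ideal_vanish Xg Xp pu.
have rk : \rank (J (u 0%R)) = (n - d)%N by apply/eqP; rewrite eqn_leq le h.
congr (_%:E); apply/eqP; rewrite subr_eq -PoszD eqz_nat addn1; apply/eqP.
by apply/eqP; rewrite -(eqn_add2r (n - d)) -rk dimT rk addSn subnKC // dim_le.
Qed.

Lemma dim_smooth_tangent_space p : smooth_points X p -> \dim (tangent_space X p) = d.+1.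
Proof.
move=> [_]; rewrite /proj_dim dimXd => -[/eqP].
by rewrite subr_eq -PoszD eqz_nat addn1 => /eqP.
Qed.

End TangentSpaces.

Lemma ord2P (i : 'I_2) : i = ord0 \/ i = ord_max.
Proof. by case: i => -[|[|//]] ?; [left|right]; apply: val_inj. Qed.

Lemma inj_ord2 (T : Type) (p : 'I_2 -> T) : p ord0 <> p ord_max -> injective p.
Proof.
by move=> np i j; case: (ord2P i) => ->; case: (ord2P j) => -> // E; case: np.
Qed.

(** * Unordered pairs and their two orderings *)

Section UnorderedPairs.
Variable T : choiceType.
Implicit Types (S : {fset T}) (p : 'I_2 -> T).

Lemma mem_image2 p x : (x \in [fset p i | i in 'I_2]%fset) = (x == p ord0) || (x == p ord_max).
Proof.
apply/imfsetP/idP => [[i _ ->]|/orP[]/eqP ->].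
- by case: (ord2P i) => ->; rewrite eqxx ?orbT.
- by exists ord0.
- by exists ord_max.
Qed.

Lemma perm_image2 p : injective p ->
  perm_eq (enum_fset [fset p i | i in 'I_2]%fset) [:: p ord0; p ord_max].
Proof.
move=> p_inj; apply: uniq_perm; first exact: fset_uniq.
  by rewrite /= inE andbT; apply/eqP => /p_inj.
by move=> x; rewrite -[LHS]/(x \in [fset p i | i in 'I_2]%fset) mem_image2 !inE.
Qed.

Lemma card_image2 p : injective p -> #|` [fset p i | i in 'I_2]|%fset = 2.
Proof. by move=> p_inj; rewrite cardfE -[RHS](perm_size (perm_image2 p_inj)) -cardfE. Qed.

Lemma card2_image S : #|` S|%fset = 2 ->
  exists2 p, injective p & S = [fset p i | i in 'I_2]%fset.
Proof.
move=> S2; have sz : size (enum_fset S) == 2 by apply/eqP.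
pose t := Tuple sz; exists (tnth t).
  by apply/tuple_uniqP; exact: fset_uniq.
apply/fsetP => x; apply/idP/imfsetP => [xS|[i _ ->]].
  have /tnthP[i xi] : x \in t by [].
  by exists i.
exact: (mem_tnth i t).
Qed.

Lemma image2_orders p p' : injective p -> injective p' ->
  [fset p i | i in 'I_2]%fset = [fset p' i | i in 'I_2]%fset ->
  p' =1 p \/ p' =1 p \o @rev_ord 2.
Proof.
move=> p_inj p'_inj /fsetP E.
have r0 : rev_ord ord0 = ord_max :> 'I_2 by apply: val_inj.
have r1 : rev_ord ord_max = ord0 :> 'I_2 by apply: val_inj.
have n01 : ord0 <> ord_max :> 'I_2 by move/(congr1 val).
have h i : (p' i == p ord0) || (p' i == p ord_max).
  by rewrite -mem_image2 E; apply/imfsetP; exists i.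
case/orP: (h ord0) => /eqP E0; case/orP: (h ord_max) => /eqP E1.
- by case: n01; apply: p'_inj; rewrite E0 E1.
- by left=> i; case: (ord2P i) => ->.
- by right=> i; case: (ord2P i) => -> /=; rewrite ?r0 ?r1.
- by case: n01; apply: p'_inj; rewrite E0 E1.
Qed.

End UnorderedPairs.

Lemma dim_cap_pos (F : fieldType) (V : vectType F) (U W : {vspace V}) k :
  \dim U = k -> \dim W = k ->
  (\dim (U + W) < 2 * k)%N <-> exists2 v, v != 0 & v \in U /\ v \in W.
Proof.
move=> dU dW; have := dimv_sum_cap U W; rewrite dU dW addnn -mul2n => <-.
rewrite -[X in (X < _)%N]addn0 ltn_add2l lt0n dimv_eq0; split=> [UW|[v v_nz [vU vW]]].
  exists (vpick (U :&: W)%VS); first by rewrite vpick0.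
  by have := memv_pick (U :&: W)%VS; rewrite memv_cap => /andP[].
apply: contraNneq v_nz => UW0; have : v \in (U :&: W)%VS by rewrite memv_cap vU vW.
by rewrite UW0 memv0.
Qed.

(** * Homogeneous coordinates of defective pairs of points *)

Section TerraciniPairs.
Variables (K : closedFieldType) (n m : nat).
Hypothesis charK : [pchar K] =i pred0.
Variables (X : set (proj K n)) (f : m.+1.-tuple {mpoly K[n.+1]}).
Hypothesis varX : proj_variety X.
Hypothesis idealX : homog_ideal X = ideal_gen [set g | g \in f].
Variable d : nat.
Hypothesis dimXd : dim_variety X = (d%:Z)%:E.
Hypothesis trdegX : prime_trdeg_ge (homog_ideal X) d.+1.

Local Notation N := (2 * n.+1)%N.
Local Notation P := (proj K n).
Local Notation l := (n - d)%N.
Let Kid : {rmorphism K -> K} := idfun.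
Local Notation J u := (jac Kid f u).
Local Notation Xsm := (smooth_points X).
Local Notation good := (good (pair_eqs f) (pair_minors f l)).
Local Notation w := (@block 2 n).
Local Notation sigma := (@block_rev 2 n).

(** The defining condition of the locus before the closure is taken. *)
Definition terracini_set : set {fset P} := [set S | sym_points 2 Xsm S /\
  (proj_dim (\sum_(p <- S) tangent_space X p)%VS
          < ((2 : nat)%:Z)%:E * (dim_variety X + 1) - 1)%E].
Local Notation Y := terracini_set.

Definition orders (p : 'I_2 -> P) (S : {fset P}) :=
  injective p /\ S = [fset p i | i in 'I_2]%fset.

Definition rep (S : {fset P}) (x : 'I_N -> K) :=
  exists2 p, orders p S & forall i, represents (\row_j slice x i j) (p i).

Let row_slice (x : 'I_N -> K) i : (\row_j slice x i j) 0 =1 slice x i.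
Proof. by move=> j; rewrite mxE. Qed.

Let J_row (x : 'I_N -> K) i : J ((\row_j slice x i j) 0) = J (slice x i).
Proof.
apply/matrixP => a b; rewrite !mxE; apply: mmap_eq => // j; exact: row_slice.
Qed.

Lemma terracini_setP p S (x : 'I_N -> K) : orders p S ->
  (forall i, represents (\row_j slice x i j) (p i)) -> (forall i, Xsm (p i)) ->
  (Y S <-> exists2 v : 'rV[K]_n.+1, v != 0 & forall i, v *m J (slice x i) = 0).
Proof.
move=> [p_inj SE] px smp.
have sumE : (\sum_(q <- S) tangent_space X q)%VS =
    (tangent_space X (p ord0) + tangent_space X (p ord_max))%VS.
  by rewrite SE (perm_big _ (perm_image2 p_inj)) /= !big_cons big_nil addv0.
have dimT i := dim_smooth_tangent_space dimXd (smp i).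
have symS : sym_points 2 Xsm S.
  split; first by rewrite SE card_image2.
  by move=> q; rewrite SE mem_image2 => /orP[]/eqP ->.
have -> : Y S <-> (\dim (tangent_space X (p ord0) + tangent_space X (p ord_max)) < 2 * d.+1)%N.
  rewrite /Y /= sumE /proj_dim dimXd -EFinD lte_fin ltrD2r.
  rewrite -PoszD -PoszM ltz_nat addn1.
  by split=> [[]|].
rewrite (dim_cap_pos (dimT _) (dimT _)).
have TP i v : v \in tangent_space X (p i) <-> v *m J (slice x i) = 0.
  by rewrite (tangent_spaceP idealX v (smp i).1 (px i)) J_row.
split=> -[v v_nz vT]; exists v => //.
  by case: vT => v0 v1 i; apply/TP; case: (ord2P i) => ->.
by split; apply/TP.
Qed.

Lemma slice_eqs p (x : 'I_N -> K) i : X p -> represents (\row_j slice x i j) p ->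
  forall g, g \in f -> mmap Kid (slice x i) g = 0.
Proof.
move=> Xp px g fg; have Xg := eqs_homog_ideal idealX fg.
rewrite -(homog_ideal_vanish Xg Xp px); apply: mmap_eq => // j.
by rewrite row_slice.
Qed.

Lemma indep_slices (p : 'I_2 -> P) (x : 'I_N -> K) : (forall i, represents (\row_j slice x i j) (p i)) ->
  p ord0 <> p ord_max ->
  (2 <= \rank (col_mx (\row_j slice x ord0 j) (\row_j slice x ord_max j)))%N.
Proof.
move=> px np; apply/rank_col_vectors; first by case: (px ord0).
move=> [c E]; apply: np; apply: val_inj; rewrite /= (represents_line (px ord0)).
have [l1 nz] := px ord_max; move: nz; rewrite (represents_line (px ord_max)) E.
rewrite scaler_eq0 negb_or => /andP[c_nz u_nz]; apply/eqP.
rewrite eqEdim !dim_vline u_nz scaler_eq0 negb_or c_nz u_nz leqnn andbT.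
by apply/vlineP; exists c^-1; rewrite scalerA mulVf // scale1r.
Qed.

Lemma rep_ex S : Y S -> exists x, rep S x.
Proof.
move=> [[/card2_image[p p_inj SE] _] _].
have /choice[u pu] i : exists u, represents u (p i) by exact: represents_ex.
exists (fun k => u (block_index k).1 0 (block_index k).2), p => // i.
rewrite (_ : \row_j _ = u i) //; apply/rowP => j.
by rewrite mxE /slice block_index_mxvec.
Qed.

Lemma smooth_of_sym p S : orders p S -> sym_points 2 Xsm S -> forall i, Xsm (p i).
Proof.
move=> [_ SE] [_ Ssm] i; apply: Ssm; rewrite SE mem_image2.
by case: (ord2P i) => ->; rewrite eqxx ?orbT.
Qed.

Lemma rep_good S x : Y S -> rep S x -> good Kid x.
Proof.
move=> YS [p pS px]; have smp := smooth_of_sym pS YS.1.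
split.
  apply/pair_eqsP; split; first by move=> i; exact: slice_eqs (smp i).1 (px i).
  exact: (terracini_setP pS px smp).1 YS.
apply/pair_minorsP; split.
  by apply: (indep_slices px) => /pS.1/(congr1 val).
move=> i; have := (smooth_pointsP charK varX idealX dimXd trdegX (px i)).1 (smp i).
by rewrite J_row => -[].
Qed.

Lemma good_rep x : good Kid x -> exists2 S, Y S & rep S x.
Proof.
move=> [/pair_eqsP[f0 v_ex] /pair_minorsP[r2 rk]].
have nz0 : \row_j slice x ord0 j != 0.
  apply/eqP => E; move: r2; rewrite E -addsmxE (addsmx_idPr (sub0mx _ _)).
  by rewrite leqNgt ltnS rank_leq_row.
have nc := (rank_col_vectors _ nz0).1 r2.
have nz1 : \row_j slice x ord_max j != 0.
  by apply/eqP => E; apply: nc; exists 0; rewrite E scale0r.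
have /choice[p px] i : exists p, represents (\row_j slice x i j) p.
  by apply: represented_ex; case: (ord2P i) => ->.
have np : p ord0 <> p ord_max.
  move=> E; apply: nc; have := px ord_max; rewrite -E => p1.
  by have [c _ cE] := represents_scale (px ord0) p1; exists c.
have pS : orders p [fset p i | i in 'I_2]%fset by split=> //; exact: inj_ord2.
have Xp i : X (p i).
  have [[F Fhom XE] _] := varX; rewrite XE => g Fg u pu.
  have Xg : homog_ideal X g.
    by apply: homog_ideal_gen; [exact: Fhom|move=> q; rewrite XE; apply].
  have [c c_nz uE] := represents_scale (px i) pu.
  have [e ge] := (homogeneousP _).1 (Fhom _ Fg).
  have E : u 0 =1 (fun j => slice x i j * c) by move=> j; rewrite uE !mxE mulrC.
  rewrite (meval_eq g E) /meval (multihom_scale Kid _ (fun=> c) ge).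
  by rewrite (homog_ideal_zero idealX (f0 i) Xg) mul0r.
have smp i : Xsm (p i).
  apply/(smooth_pointsP charK varX idealX dimXd trdegX (px i)).
  by rewrite J_row.
exists [fset p i | i in 'I_2]%fset; last by exists p.
by apply/(terracini_setP pS px smp).
Qed.

Lemma rep_orbit S x x' : Y S -> rep S x -> rep S x' ->
  exists (s : 'I_2 -> K) (v : 'I_N -> K), [/\ forall i, s i != 0,
    v = x \/ v = x \o sigma & x' =1 (fun k => v k * s (w k))].
Proof.
move=> _ [p [p_inj SE] px] [p' [p'_inj S'E] p'x'].
have key (v : 'I_N -> K) : (forall i, represents (\row_j slice v i j) (p' i)) ->
    exists s : 'I_2 -> K, (forall i, s i != 0) /\ x' =1 (fun k => v k * s (w k)).
  move=> pv; have /choice[s sP] i : exists c : K, c != 0 /\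
      \row_j slice x' i j = c *: \row_j slice v i j.
    by have [c c_nz E] := represents_scale (pv i) (p'x' i); exists c.
  exists s; split=> [i|k]; first by case: (sP i).
  case/mxvec_indexP: k => i j; rewrite block_mxvec mulrC.
  by have [_ /rowP/(_ j)] := sP i; rewrite !mxE.
have [E|E] := image2_orders p_inj p'_inj (etrans (esym SE) S'E).
  have [|s [s_nz x'E]] := key x; first by move=> i; rewrite E.
  by exists s, x; split=> //; left.
have [|s [s_nz x'E]] := key (x \o sigma).
  move=> i; rewrite E /=; have := px (rev_ord i).
  congr (represents _ _); apply/rowP => j; rewrite !mxE /slice /=.
  by rewrite block_rev_mxvec.
by exists s, (x \o sigma); split=> //; right.
Qed.

Lemma rep_swap S x : rep S x -> rep S (x \o sigma).
Proof.
move=> [p [p_inj SE] px]; exists (p \o @rev_ord 2).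
  split; first exact: inj_comp p_inj (@rev_ord_inj 2).
  apply/fsetP => q; rewrite SE !mem_image2 orbC.
  have r0 : rev_ord ord0 = ord_max :> 'I_2 by apply: val_inj.
  have r1 : rev_ord ord_max = ord0 :> 'I_2 by apply: val_inj.
  by rewrite /= r0 r1.
move=> i; have := px (rev_ord i); congr (represents _ _).
by apply/rowP => j; rewrite !mxE /slice /= block_rev_mxvec.
Qed.

Lemma good_nz (L : fieldType) (iota : {rmorphism K -> L}) x : good iota x ->
  forall i : 'I_2, exists2 k, w k = i & x k != 0.
Proof.
move=> [_ /pair_minorsP[r2 _]] i.
suff /eqP/rowP nz : \row_j slice x i j != 0.
  have [j xj] : exists j, slice x i j != 0.
    apply: contrapT => nex; apply: nz => j; rewrite !mxE; apply/eqP.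
    by apply: contrapT => /negP xj; apply: nex; exists j.
  by exists (mxvec_index i j); rewrite ?block_mxvec.
apply: contraTneq r2 => E; rewrite -leqNgt.
case: (ord2P i) E => -> ->; rewrite -addsmxE.
  by rewrite (addsmx_idPr (sub0mx _ _)) rank_leq_row.
by rewrite (addsmx_idPl (sub0mx _ _)) rank_leq_row.
Qed.

Lemma good_scale (L : fieldType) (iota : {rmorphism K -> L}) x (s : 'I_2 -> L) :
  (forall i, s i != 0) -> good iota x -> good iota (fun k => x k * s (w k)).
Proof.
move=> s_nz [/pair_eqsP[f0 [v v_nz vJ]] /pair_minorsP[r2 rk]].
have sliceE i : slice (fun k => x k * s (w k)) i = (fun j => slice x i j * s i).
  by apply/funext => j; rewrite /slice block_mxvec.
have f0' i g : g \in f -> mmap iota (slice (fun k => x k * s (w k)) i) g = 0.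
  move=> fg; rewrite sliceE; apply: (homog_ideal_scale (s i) _ (eqs_homog_ideal idealX fg)).
  by move=> h Xh; exact: (homog_ideal_zero idealX (f0 i) Xh).
split.
  apply/pair_eqsP; split=> //; exists v => // i; rewrite sliceE.
  exact: (jac_ker_scale idealX (s_nz i) (f0 i) (vJ i)).
apply/pair_minorsP; split.
  have nz0 : \row_j slice x ord0 j != 0.
    apply/eqP => E; move: r2; rewrite E -addsmxE (addsmx_idPr (sub0mx _ _)).
    by rewrite leqNgt ltnS rank_leq_row.
  have rowE i : \row_j slice (fun k => x k * s (w k)) i j = s i *: \row_j slice x i j.
    by apply/rowP => j; rewrite !mxE sliceE mulrC.
  rewrite !rowE; apply/rank_col_vectors.
    by rewrite scaler_eq0 negb_or s_nz.
  move=> [c E]; have := (rank_col_vectors _ nz0).1 r2; apply.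
  exists ((s ord_max)^-1 * (c * s ord0)); apply: (@scalerI _ _ (s ord_max)) => //.
  by rewrite E !scalerA mulrA divff // mul1r.
(* Scaling back by the inverse scalar shows that the left kernel does not grow, so the rank does not
   drop. *)
move=> i; apply: leq_trans (rk i) _; apply: kernel_rank => u; rewrite sliceE => u0.
have si : (s i)^-1 != 0 by rewrite invr_eq0.
have := jac_ker_scale idealX si _ u0.
have -> : (fun j => slice x i j * s i * (s i)^-1) = slice x i.
  by apply/funext => j; rewrite mulfK.
by apply=> g; rewrite -sliceE; exact: f0'.
Qed.

End TerraciniPairs.

Lemma multi_vanishesP (K : fieldType) r n (g : {mpoly K[r * n.+1]}) (p : 'I_r -> proj K n) :
  multi_vanishes_at g p <-> forall x : 'I_(r * n.+1) -> K,
    (forall i, represents (\row_j slice x i j) (p i)) -> g.@[x] = 0.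
Proof.
split=> [vg x px|vg M pM].
  rewrite -(vg (\matrix_(i, j) slice x i j)); last first.
    move=> i; have := px i; congr (represents _ _).
    by apply/rowP => j; rewrite !mxE.
  by apply: meval_eq => k; case/mxvec_indexP: k => i j; rewrite mxvecE mxE.
apply: vg => i; have := pM i; congr (represents _ _).
by apply/rowP => j; rewrite !mxE /slice mxvecE.
Qed.

(** * Closed sets of unordered pairs and their equations *)

Section TerraciniTopology.
Variables (K : closedFieldType) (n m : nat).
Hypothesis charK : [pchar K] =i pred0.
Variables (X : set (proj K n)) (f : m.+1.-tuple {mpoly K[n.+1]}).
Hypothesis varX : proj_variety X.
Hypothesis idealX : homog_ideal X = ideal_gen [set g | g \in f].
Variable d : nat.
Hypothesis dimXd : dim_variety X = (d%:Z)%:E.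
Hypothesis trdegX : prime_trdeg_ge (homog_ideal X) d.+1.

Local Notation N := (2 * n.+1)%N.
Local Notation w := (@block 2 n).
Local Notation sigma := (@block_rev 2 n).
Local Notation Xsm := (smooth_points X).
Local Notation Y := (terracini_set X).
Local Notation closedS := (sym_closed 2 Xsm).
Let Kid : {rmorphism K -> K} := idfun.

Lemma sigmaK : involutive sigma. Proof. exact: block_revK. Qed.

Lemma closed_eqs C : closedS C -> exists2 F, F `<=` multihom w &
  forall S, Y S -> (C S <-> forall g x, F g -> rep S x -> g.@[x] = 0).
Proof.
move=> [_ [F' [F Fhom F'E] CF']]; exists F; first by move=> g /Fhom/multihomogeneousP.
move=> S [symS _]; split=> [CS g x Fg [p [p_inj SE] px]|h].
  have smp := smooth_of_sym (conj p_inj SE) symS.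
  have : F' p by apply/CF' => //; rewrite -SE.
  by rewrite F'E => /(_ g Fg)/multi_vanishesP; apply.
have [p p_inj SE] := card2_image symS.1.
have smp := smooth_of_sym (conj p_inj SE) symS.
rewrite SE; apply/CF' => //; rewrite F'E => g Fg; apply/multi_vanishesP => x px.
by apply: h Fg _; exists p.
Qed.

Lemma sym_points_image (p : 'I_2 -> proj K n) : injective p -> (forall i, Xsm (p i)) ->
  sym_points 2 Xsm [fset p i | i in 'I_2]%fset.
Proof.
move=> p_inj smp; split; first by rewrite card_image2.
by move=> q; rewrite mem_image2 => /orP[]/eqP ->.
Qed.

Lemma eqs_closed F : F `<=` multihom w -> (forall g, F g -> F (swap K sigma g)) ->
  exists2 C, closedS C &
  forall S, Y S -> (C S <-> forall g x, F g -> rep S x -> g.@[x] = 0).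
Proof.
move=> Fhom Fswap.
exists [set S | sym_points 2 Xsm S /\ forall g x, F g -> rep S x -> g.@[x] = 0]; last first.
  by move=> S [symS _]; split=> [[]|].
split; first by move=> S [].
exists [set p | forall g, F g -> multi_vanishes_at g p].
  by exists F => // g /Fhom/multihomogeneousP.
move=> p p_inj smp; split=> [[_ h] g Fg|h].
  by apply/multi_vanishesP => x px; apply: h Fg _; exists p.
split; first exact: sym_points_image.
move=> g x Fg [p' [p'_inj SE] px].
have [E|E] := image2_orders p_inj p'_inj SE.
  by have /multi_vanishesP := h g Fg; apply=> i; rewrite -E.
(* The coordinates order the pair the other way round; stability of [F] under the swap covers this
   case. *)
have /multi_vanishesP/(_ (x \o sigma)) := h _ (Fswap g Fg).
rewrite (meval_swap sigma) => v0.
have sE : (x \o sigma) \o sigma = x by apply/funext => k; rewrite /= sigmaK.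
move: v0; rewrite sE; apply=> i.
have := px (rev_ord i); rewrite E /= rev_ordK; congr (represents _ _).
by apply/rowP => j; rewrite !mxE /slice /= block_rev_mxvec.
Qed.

(** The elements of [pair_eqs] need not be multihomogeneous, so their components serve as equations;
    these vanish on the locus by [vanish_I0]. *)
Lemma terracini_closed : closedS Y.
Proof.
split; first by move=> S [].
exists [set p | forall h, (exists g e, pair_eqs f g /\ h = component w e g) ->
    multi_vanishes_at h p].
  exists [set h | exists g e, pair_eqs f g /\ h = component w e g] => //.
  by move=> _ [g [e [_ ->]]]; apply/multihomogeneousP; exact: component_hom.
move=> p p_inj smp; have pS : orders p [fset p i | i in 'I_2]%fset by [].
split=> [YS _ [g [e [Ig ->]]]|h].
  apply/multi_vanishesP => x px; have Sx : rep [fset p i | i in 'I_2]%fset x by exists p.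
  by have := vanish_I0 (good_scale idealX (d := d))
    (rep_good charK varX idealX dimXd trdegX) (@subset_refl _ Y) Ig e YS Sx.
have /choice[u pu] i : exists u, represents u (p i) by exact: represents_ex.
pose x k := u (block_index k).1 0 (block_index k).2.
have px i : represents (\row_j slice x i j) (p i).
  rewrite (_ : \row_j _ = u i) //; apply/rowP => j.
  by rewrite mxE /slice /x block_index_mxvec.
apply/(terracini_setP idealX dimXd pS px smp).
suff /pair_eqsP[_ //] : forall g, pair_eqs f g -> mmap Kid x g = 0.
move=> g Ig; rewrite (sum_component w g) rmorph_sum big1 // => e _.
have hg : exists g' e', pair_eqs f g' /\ component w e g = component w e' g' by exists g, e.
by have /multi_vanishesP := h _ hg; apply.
Qed.

Lemma terracini_locusE : terracini_locus 2 X = Y.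
Proof.
apply/seteqP; split=> S; last by move=> YS C [_]; apply.
by apply; split; [exact: terracini_closed|].
Qed.

End TerraciniTopology.

(** * The dimension formula *)

Theorem proposition8p5 (K : closedFieldType) (charK : [pchar K] =i pred0)
    (n m : nat) (X : set (proj K n)) (f : m.+1.-tuple {mpoly K[n.+1]})
    (varX : proj_variety X) (nondegX : nondegenerate_variety X)
    (dimX : (2%:E * (dim_variety X + 1) <= (n.+1%:Z)%:E)%E)
    (idealX : homog_ideal X = ideal_gen [set g | g \in f]) :
  (dim_terracini_locus 2 X
     = krull_dim (terracini_ideal 2 (jacobian f)^T [set g | g \in f]) - 2%:E)%E.
Proof.
have [d [dimXd trdegX trdegX']] := dim_variety_trdeg charK varX.
have primeX := homog_ideal_prime varX.
have dn : (2 * d.+1 <= n.+1)%N.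
  by move: dimX; rewrite dimXd -EFinD lee_fin -PoszD -[2%R]/(Posz 2) -PoszM lez_nat addn1.
have ld : (d <= n)%N := dim_le charK varX trdegX.
(* A zero ideal would give n <= d, against 2 (d + 1) <= n + 1; otherwise the codimension is (n + 1)
   - (d + 1). *)
have lE : ell (jacobian f)^T (ideal_gen [set g | g \in f]) = (n - d)%N.
  rewrite /ell -idealX; case: asboolP => [X0|_].
    have : (n.+1 <= d.+1)%N.
      rewrite leqNgt; apply/negP => lt; apply: trdegX'.
      apply: (prime_trdeg_geW primeX (D := n.+1)) => //; rewrite X0.
      exists (fun i => 'X_i) => H /=; rewrite -[X in _ -> X = 0]comp_mpoly_id => <-.
      by apply: mmap_eq => // i; rewrite tnth_map tnth_ord_tuple.
    by move/(leq_trans dn); rewrite mul2n -addnn addnS ltnNge leq_addr.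
  rewrite /ideal_codim (krull_dim0 _ charK) (krull_dim_prime charK primeX trdegX trdegX').
  by rewrite -EFinB /= subzn // subSS.
(* Equivalent to 2 (d + 1) <= n + 1: the minors in the ideal are the maximal ones, with n + 1
   columns. *)
have minE : minn (2 * (n - d)) n.+1 = n.+1.
  apply/minn_idPr; rewrite mulnBr leq_subRL; last by rewrite leq_mul2l ld orbT.
  by rewrite [X in (_ <= X)%N]mul2n -addnn addnS -addSn leq_add2r -ltnS; move: dn; rewrite mulnS.
pose A := (jacobian f)^T.
pose J1 := minors_ideal 2 (@Zmx K 2 n ord0 ord_max).
pose J2 (i : 'I_2) := minors_ideal (n - d) (@mx_z K 2 n _ _ A i).
have TE : terracini_ideal 2 A [set g | g \in f] =
    ideal_radical (saturation (saturation (pair_eqs f) J1) (J2 ord0 `&` J2 ord_max)).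
  rewrite /terracini_ideal lE minE; congr (ideal_radical (saturation (saturation _ _) _)).
    apply/seteqP; split=> [g h|g h [i j] /= ij]; first by have := h (ord0, ord_max) isT.
    have [-> ->] : i = ord0 /\ j = ord_max; last exact: h.
    by case: (ord2P i) ij => ->; case: (ord2P j) => ->.
  apply/seteqP; split=> [g h|g [h0 h1] i _]; last first.
    by case: (ord2P i) => ->; [exact: h0|exact: h1].
  by split; [exact: (h ord0 Logic.I)|exact: (h ord_max Logic.I)].
rewrite -/A TE /dim_terracini_locus (terracini_locusE charK varX idealX dimXd trdegX).
set T := ideal_radical _.
have idE : is_ideal (pair_eqs f) by exact: ideal_gen_ideal.
have gens := fun s t k M => @minors_ideal_range {mpoly K[2 * n.+1]} s t k M.
have mem := fun s t k M p => @minor_mem {mpoly K[2 * n.+1]} s t k M p.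
have idJ := fun s t k M => ideal_gen_ideal _ : is_ideal (@minors_ideal {mpoly K[2 * n.+1]} s t k M).
have rEx := @rep_ex K n X.
have gs := @good_scale K n m X f idealX d.
have gn := @good_nz K n m f d.
have rg := rep_good charK varX idealX dimXd trdegX.
have gr := good_rep charK varX idealX dimXd trdegX.
have ro := @rep_orbit K n X.
have rs := @rep_swap K n.
have ce := @closed_eqs K n X.
have ec := @eqs_closed K n X.
have up k : has_chain (pieces (sym_closed 2 (smooth_points X)) (terracini_set X)) k ->
    has_chain (primes_over T) (k + 2).
  move/(chain_to_prime (@sigmaK n) (@block_rev_block 2 n) gs gn rEx rg ro rs ce ec).
  move=> [P [primeP EP [_ [p [p0 [p1 ->]]] nP] Pk]].
  apply: (primes_over_chain charK _ primeP Pk).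
  exact: (prime_over_saturations (mem _ _ _ _) (idJ _ _ _ _) (idJ _ _ _ _)
    (mem _ _ _ _) (mem _ _ _ _) primeP EP nP).
have down k : has_chain (primes_over T) k ->
    exists2 k', has_chain (pieces (sym_closed 2 (smooth_points X)) (terracini_set X)) k' &
      (k <= k' + 2)%N.
  move=> /chain_bottom_trdeg[q [primeq Tq qk]]; exists (k - 2)%N; last by rewrite addnC -leq_subLR.
  (* The prime [q] itself may contain the ideals removed by saturation; the smaller prime [P] does
     not, and its transcendence degree is at least that of [q]. *)
  have [P [primeP Pq EP [p [p0 [p1 nP]]]]] := saturations_prime idE (@gens _ _ _ _)
    (@gens _ _ _ _) (@gens _ _ _ _) primeq Tq.
  apply: (prime_to_chain charK (@sigmaK n) (@block_rev_block 2 n) gs gn rEx gr ro rs ce ec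
    primeP EP); last exact: prime_trdeg_sub Pq qk.
  by exists (minor_product f p p0 p1) => //; exists p, p0, p1.
(* This includes the empty locus, where the ideal is the unit ideal and both sides are -oo. *)
exact: (chain_dim_shift up down (primes_over_chain_bound charK (I := T))).1.
Qed.
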